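(* Let $n\ge2$ be an integer, let $1\le p\le\infty$, and let $q$ satisfy $q>\frac{2n}{n-1}$ and $q\ge p'$. Then there is a constant $C<\infty$ depending only on $p,q,n$ such that for every cylindrically symmetric function $f\in L^p(S,d\sigma)$ supported on a subset of $S=\{(|\xi|,\xi):\ \xi\in\mathbf{R}^n,\ 1\le|\xi|\le2\}$, $$\|(f\,d\sigma)^\vee\|_{L^q(\mathbf{R}\times\mathbf{R}^n)}\le C\,\|f\|_{L^p(S,d\sigma)}.$$
   Context: The measure $d\sigma$ on the cone $\{(\tau,\xi)\in\mathbf{R}\times\mathbf{R}^n:\tau=|\xi|\}$ is the pull-back of the measure $\frac{d\xi}{|\xi|}$ on $\mathbf{R}^n$ under the projection $(\tau,\xi)\mapsto\xi$, and $$(f\,d\sigma)^\vee(t,x)=\int_{\mathbf{R}^n} f(|\xi|,\xi)\,e^{i(x\cdot\xi+t|\xi|)}\,\frac{d\xi}{|\xi|},\qquad (t,x)\in\mathbf{R}\times\mathbf{R}^n .$$ A function $f$ supported on the cone is cylindrically symmetric if it is invariant under spatial rotations, i.e. $f(|\xi|,\xi)$ depends only on $|\xi|$. $p'$ denotes the conjugate exponent, $1/p+1/p'=1$. The exponent $q=\infty$ is allowed. *)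

(* Defs.v *)
From HB Require Import structures.
From mathcomp Require Import all_boot all_order all_algebra.
From mathcomp Require Import all_classical all_reals all_analysis.
From mathcomp Require Import measurable_realfun ess_sup_inf complex.

Set Implicit Arguments.
Unset Strict Implicit.
Unset Printing Implicit Defensive.

Import Order.TTheory GRing.Theory Num.Theory.
Import numFieldNormedType.Exports.

Local Open Scope classical_set_scope.
Local Open Scope ring_scope.

(* R^n with the product of the Borel sigma-algebras of the coordinates, and the
   space-time R x R^n, whose points are written (t, x) or (tau, xi). *)
Notation Rn R n := (n.-tuple (measurableTypeR R)).
Notation Rspacetime R n := (measurableTypeR R * Rn R n)%type.

(* One more coordinate: the product of the Lebesgue measure on the line with a
   measure on R^n, transported to R^(n+1) by (a, x) |-> a :: x. *)
Section lebesgue_cons.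
Context {R : realType} {n : nat}.
Variable m : {sigma_finite_measure set (Rn R n) -> \bar R}.
Local Open Scope ereal_scope.

Definition tuple_cons (z : Rspacetime R n) : Rn R n.+1 :=
  [tuple of z.1 :: z.2].

Lemma measurable_tuple_cons : measurable_fun setT tuple_cons.
Proof. exact: measurable_cons. Qed.

Definition lebesgue_cons : set (Rn R n.+1) -> \bar R :=
  pushforward (lebesgue_measure \x m) tuple_cons.

Let lebesgue_cons0 : lebesgue_cons set0 = 0.
Proof. by rewrite /lebesgue_cons /pushforward preimage_set0 measure0. Qed.

Let lebesgue_cons_ge0 A : 0 <= lebesgue_cons A.
Proof. by rewrite /lebesgue_cons /pushforward measure_ge0. Qed.

Let lebesgue_cons_sigma_additive : semi_sigma_additive lebesgue_cons.
Proof.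
have mf (A : set (Rn R n.+1)) : measurable A -> measurable (tuple_cons @^-1` A).
  by move=> mA; rewrite -[X in measurable X]setTI; exact: measurable_tuple_cons.
move=> F mF tF mUF; rewrite /lebesgue_cons /pushforward preimage_bigcup.
apply: measure_semi_sigma_additive.
- by move=> k; exact: mf.
- apply/trivIsetP => /= i j _ _ ij; rewrite -preimage_setI.
  by move/trivIsetP : tF => /(_ _ _ _ _ ij) ->//; rewrite preimage_set0.
- by rewrite -preimage_bigcup; exact: mf.
Qed.

HB.instance Definition _ := isMeasure.Build _ _ _ lebesgue_cons
  lebesgue_cons0 lebesgue_cons_ge0 lebesgue_cons_sigma_additive.

Let tuple_unconsK (z : Rspacetime R n) :
  (thead (tuple_cons z), [tuple of behead (tuple_cons z)] : Rn R n) = z.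
Proof. by case: z => x y; congr pair; exact/val_inj. Qed.

Lemma lebesgue_cons_box (A : set (measurableTypeR R)) (B : set (Rn R n)) :
  measurable A -> measurable B ->
  lebesgue_cons [set x | A (thead x) /\ B [tuple of behead x]] =
    lebesgue_measure A * m B.
Proof.
move=> mA mB; rewrite -product_measure1E// /lebesgue_cons /pushforward.
congr (product_measure1 _ _ _); apply/funext => z.
have /(congr1 fst)/= E1 := tuple_unconsK z.
have /(congr1 snd)/= E2 := tuple_unconsK z.
by rewrite /preimage/= E1 E2.
Qed.

Let lebesgue_cons_sigma_finite : sigma_finite setT lebesgue_cons.
Proof.
have /sigma_finiteP[F [TF ndF Foo]] := sigma_finiteT (@lebesgue_measure R).
have /sigma_finiteP[G [TG ndG Goo]] := sigma_finiteT m.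
exists (fun k => [set x | F k (thead x) /\ G k [tuple of behead x]]).
  apply/seteqP; split=> // x _.
  have [i _ Fi] : (\bigcup_k F k) (thead x) by rewrite -TF.
  have [j _ Gj] : (\bigcup_k G k) [tuple of behead x] by rewrite -TG.
  exists (maxn i j) => //; split.
    by move: Fi; apply: subsetPset; apply: ndF; exact: leq_maxl.
  by move: Gj; apply: subsetPset; apply: ndG; exact: leq_maxr.
move=> k; have [mF Fk] := Foo k; have [mG Gk] := Goo k; split.
  apply: measurableI; rewrite -[X in measurable X]setTI.
    exact: (measurable_tnth ord0).
  exact: measurable_behead.
by rewrite lebesgue_cons_box// lte_mul_pinfty// ge0_fin_numE.
Qed.

HB.instance Definition _ := Measure_isSigmaFinite.Build _ _ _ lebesgue_cons
  lebesgue_cons_sigma_finite.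

End lebesgue_cons.

Fixpoint lebesgue_Rn (R : realType) (n : nat) :
    {sigma_finite_measure set (Rn R n) -> \bar R} :=
  if n is k.+1 then lebesgue_cons (lebesgue_Rn R k)
  else \d_([tuple] : Rn R 0).

(* Boxes have the product of the lengths of their sides as measure, so
   lebesgue_Rn is the n-dimensional Lebesgue measure (on Borel sets). *)
Lemma lebesgue_Rn_box (R : realType) (n : nat)
    (A : 'I_n -> set (measurableTypeR R)) :
  (forall i, measurable (A i)) ->
  lebesgue_Rn R n [set x | forall i, A i (tnth x i)] =
    (\prod_(i < n) lebesgue_measure (A i))%E.
Proof.
have tb k (x : Rn R k.+1) (i : 'I_k) :
    tnth [tuple of behead x] i = tnth x (lift ord0 i).
  by case/tupleP: x => a x; rewrite tnthS; congr tnth; exact/val_inj.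
elim: n A => [A _|n IH A mA] /=.
  by rewrite big_ord0 diracE mem_set// => -[].
rewrite big_ord_recl -(IH (fun i => A (lift ord0 i)))// -lebesgue_cons_box//.
  congr (lebesgue_cons _ _); apply/seteqP; split=> [x Ax|x [A0 Ax] i] /=.
    by split=> [|i]; [exact: Ax|rewrite tb; exact: Ax].
  have [j ->|->//] := unliftP ord0 i.
  by rewrite -tb; exact: Ax.
rewrite (_ : mkset _ = \bigcap_(i in [set: 'I_n])
    ((@tnth _ _ ^~ i) @^-1` A (lift ord0 i))); last first.
  by apply/seteqP; split=> x /=; [move=> Ax i _; exact: Ax|move=> Ax i; exact: Ax].
apply: fin_bigcap_measurable => // i _.
by rewrite -[X in measurable X]setTI; exact: measurable_tnth.
Qed.

Section cone.
Context {R : realType} {n : nat}.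
Implicit Types (x xi eta : Rn R n) (z : Rspacetime R n).
Implicit Types f : Rspacetime R n -> R[i].

Definition dotp x xi : R := \sum_(i < n) tnth x i * tnth xi i.

Definition enorm xi : R := Num.sqrt (dotp xi xi).

Definition cone_point xi : Rspacetime R n := (enorm xi, xi).

(* dsigma: since xi |-> (|xi|, xi) inverts the projection of the cone to R^n, the
   pull-back of dxi / |xi| gives A the (dxi / |xi|)-measure of the set of the xi
   with (|xi|, xi) in A.  The value 0^-1 = 0 at the origin only affects a set of
   Lebesgue measure zero when n > 0. *)
Definition cone_measure (A : set (Rspacetime R n)) : \bar R :=
  (\int[lebesgue_Rn R n]_(xi in cone_point @^-1` A) ((enorm xi)^-1)%:E)%E.

Lemma measurable_enorm : measurable_fun setT enorm.
Proof.
apply: (@measurableT_comp _ _ _ _ _ _ (@Num.sqrt R)).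
  by apply: continuous_measurable_fun; exact: sqrt_continuous.
by apply: measurable_sum => i; apply: measurable_funM; exact: measurable_tnth.
Qed.

Lemma measurable_cone_point : measurable_fun setT cone_point.
Proof. by apply/measurable_fun_pair => //; exact: measurable_enorm. Qed.

Let measurable_cone_preimage (A : set (Rspacetime R n)) :
  measurable A -> measurable (cone_point @^-1` A).
Proof.
by move=> mA; rewrite -[X in measurable X]setTI; exact: measurable_cone_point.
Qed.

Let cone_measure0 : cone_measure set0 = 0%E.
Proof. by rewrite /cone_measure preimage_set0 integral_set0. Qed.

Let cone_measure_ge0 A : (0 <= cone_measure A)%E.
Proof.
by apply: integral_ge0 => xi _; rewrite lee_fin invr_ge0 sqrtr_ge0.
Qed.

Let cone_measure_sigma_additive : semi_sigma_additive cone_measure.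
Proof.
move=> F mF tF mUF; rewrite /cone_measure preimage_bigcup.
apply: semi_sigma_additive_nng_induced.
- apply/measurable_EFinP.
  rewrite (_ : (fun _ => _) = (fun xi => enorm xi `^ (-1))).
    apply: (@measurableT_comp _ _ _ _ _ _ (fun t : R => t `^ (-1))) => //.
    exact: measurable_enorm.
  by apply/funext => xi; rewrite powR_inv1// sqrtr_ge0.
- by move=> xi; rewrite lee_fin invr_ge0 sqrtr_ge0.
- by move=> k; exact: measurable_cone_preimage.
- apply/trivIsetP => /= i j _ _ ij; rewrite -preimage_setI.
  by move/trivIsetP : tF => /(_ _ _ _ _ ij) ->//; rewrite preimage_set0.
- by rewrite -preimage_bigcup; exact: measurable_cone_preimage.
Qed.

HB.instance Definition _ := isMeasure.Build _ _ _ cone_measure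
  cone_measure0 cone_measure_ge0 cone_measure_sigma_additive.

(* S *)
Definition cone_shell : set (Rspacetime R n) :=
  [set z | z.1 = enorm z.2 /\ 1 <= enorm z.2 <= 2].

Lemma measurable_cone_shell : measurable cone_shell.
Proof.
have mn : measurable_fun setT (fun z : Rspacetime R n => enorm z.2).
  exact: measurableT_comp measurable_enorm measurable_snd.
have -> : cone_shell = (fun z : Rspacetime R n => z.1 - enorm z.2) @^-1` [set 0]
    `&` (fun z : Rspacetime R n => enorm z.2) @^-1` `[1, 2].
  apply/seteqP; split=> z /=; rewrite in_itv/=.
    by move=> [-> ->]; rewrite subrr.
  by move=> [/eqP]; rewrite subr_eq0 => /eqP.
apply: measurableI; rewrite -[X in measurable X]setTI.
  by apply: measurable_funB => //; exact: measurable_fst.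
exact: mn.
Qed.

(* dsigma restricted to S *)
Definition shell_measure := mrestr cone_measure measurable_cone_shell.

HB.instance Definition _ := Measure.on shell_measure.

Definition cylindrically_symmetric f : Prop :=
  forall xi eta, enorm xi = enorm eta -> f (cone_point xi) = f (cone_point eta).

(* x . xi + t |xi|, for z = (t, x) *)
Definition phase z xi : R := dotp z.2 xi + z.1 * enorm xi.

End cone.

Section complex_functions.
Context d (T : measurableType d) {R : realType}.
Variable mu : {measure set T -> \bar R}.
Implicit Type f : T -> R[i].

(* Real and imaginary parts are integrated separately. *)
Definition cRintegral f : R[i] :=
  (Rintegral mu setT (fun x => complex.Re (f x)) +i* Rintegral mu setT (fun x => complex.Im (f x)))%C.

(* The L^p norm of the modulus; p = +oo gives the essential supremum. *)
Definition cLnorm (p : \bar R) f : \bar R :=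
  Lnorm mu p (fun x => (Normc.normc (f x))%:E).

Definition cLfun (p : \bar R) f : Prop :=
  [/\ measurable_fun setT (fun x => complex.Re (f x)),
      measurable_fun setT (fun x => complex.Im (f x)) &
      (cLnorm p f < +oo)%E].

End complex_functions.

Definition expi {R : realType} (t : R) : R[i] := (cos t +i* sin t)%C.

(* (f dsigma)^\vee *)
Definition cone_extension {R : realType} {n : nat} (f : Rspacetime R n -> R[i])
    (z : Rspacetime R n) : R[i] :=
  cRintegral (lebesgue_Rn R n)
    (fun xi => f (cone_point xi) * expi (phase z xi) * ((enorm xi)^-1)%:C%C).

(* Main.v *)
(* For f(|xi|, xi) = F(|xi|) and fixed x, integrating over spheres turns
   (f dsigma)^vee(., x) into the one-dimensional Fourier transform in r of
   h_x(r) = c F(r) r^(n-2) J(|x| r), where J is a Bessel integral with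
   |J(|x| r)| <= C (1 + |x|^2)^(-(n-1)/4) on 1 <= r <= 2.  Interpolation between the
   L^1-L^oo and L^2-L^2 bounds (Hausdorff-Young) in t gives
     ||(f dsigma)^vee(., x)||_q <= C (1 + |x|^2)^(-(n-1)/4) ||F||_q',
   and the right-hand side is in L^q(dx) exactly when q > 2n/(n-1).  Since
   q' <= p and S has finite measure, the L^q' norm is bounded by the L^p norm.
   The formula for h_x is obtained by differentiating the integrals of plane waves
   over balls, the decay of J from the energy of the Bessel equation, and the L^2
   bound in t from Fejer means. *)

From HB Require Import structures.
Require Import Defs.
From mathcomp Require Import all_boot all_order all_algebra.
From mathcomp Require Import all_classical all_reals all_analysis.
From mathcomp Require Import complex zify ring lra measurable_realfun ess_sup_inf.
Import Order.TTheory GRing.Theory Num.Theory.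
Import numFieldNormedType.Exports.
Set Implicit Arguments.
Unset Strict Implicit.
Unset Printing Implicit Defensive.
Local Open Scope classical_set_scope.
Local Open Scope ring_scope.

(** * Integration on R^n *)

(** Spheres are never integrated over. The measure (1 + cos(x.xi)) dxi is pushed forward to the line
    by [enorm]; its values on rays are integrals over balls, which slicing computes, and a measure
    finite on rays is determined by them. Differentiating one explicit primitive in the radius
    therefore gives the polar formula for every measurable profile, however irregular F is.
    Rotations enter only through the fact that the integral of phi(|xi|^2) G(x.xi) depends on x
    through |x|, which reduces to rotations of a plane.

    The transform in t is split into real cosine and sine transforms. The L^2 bound is proved for
    bounded functions supported in [1, 2], since interpolation applies it to truncations. Estimates
    compare integrals of powers: if B bounds the integral of |f|^q', the right-hand side is a
    multiple of B^(q-1), which has the homogeneity of the q-th power of a norm. For q = +oo the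
    extension is simply bounded pointwise by twice an L^1 norm. *)

Section density_measure.
Context d (T : measurableType d) (R : realType).
Variables (mu : {measure set T -> \bar R}) (w : T -> \bar R).
Hypotheses (mw : measurable_fun setT w) (w0 : forall x, (0 <= w x)%E).
Local Open Scope ereal_scope.

(** The proofs about [w] are arguments of the constant so that the measure structure declared below
    can be inferred from the term [density_measure mw w0]. *)
Definition density_measure of measurable_fun setT w & (forall x, 0 <= w x) :=
  fun A : set T => \int[mu]_(x in A) w x.

Local Notation nu := (density_measure mw w0).

Let nu0 : nu set0 = 0. Proof. exact: integral_set0. Qed.

Let nu_ge0 A : 0 <= nu A. Proof. exact: integral_ge0. Qed.

Let nu_sigma_additive : semi_sigma_additive nu.
Proof. exact: semi_sigma_additive_nng_induced. Qed.

HB.instance Definition _ := isMeasure.Build _ _ _ nu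
  nu0 nu_ge0 nu_sigma_additive.

Import HBNNSimple.

(** Monotone convergence along simple functions reduces the formula to indicators, for which it is
    the definition of the measure. *)
Lemma ge0_integral_density (f : T -> \bar R) :
  measurable_fun setT f -> (forall x, 0 <= f x) ->
  \int[nu]_x f x = \int[mu]_x (f x * w x).
Proof.
move=> mf f0; pose h := nnsfun_approx measurableT mf.
have fE x : f x = limn (fun n => (h n x)%:E).
  by apply/esym/cvg_lim => //; exact: cvg_nnsfun_approx.
have indich m r : measurable_fun setT (fun x => (r * \1_(h m @^-1` [set r]) x)%:E).
  by apply/measurable_EFinP; exact: measurable_funM.
have hnd x : {homo (fun n => (h n x)%:E) : a b / (a <= b)%N >-> a <= b}.
  by move=> a b ab; rewrite lee_fin; exact/lefP/nd_nnsfun_approx.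
transitivity (limn (fun n => \int[nu]_x (h n x)%:E)).
  under eq_integral do rewrite fE.
  apply: monotone_convergence => //.
  - by move=> n; exact/measurable_EFinP.
  - by move=> n x _; rewrite lee_fin.
transitivity (limn (fun n => \int[mu]_x ((h n x)%:E * w x))); last first.
  have fwE x : f x * w x = limn (fun n => (h n x)%:E * w x).
    apply/esym/cvg_lim => //.
    have [->|wx0] := eqVneq (w x) 0.
      by rewrite mule0; under eq_fun do rewrite mule0; exact: cvg_cst.
    have hf : (h n x)%:E @[n --> \oo] --> f x by exact: cvg_nnsfun_approx.
    (* Multiplication by +oo is discontinuous at 0, so the limit is found by hand: the
       approximations are all 0 when [f x] is 0, and eventually positive otherwise. *)
    have [wxoo|wxfin] := eqVneq (w x) +oo; last first.
      by apply: cvgeZr => //; rewrite ge0_fin_numE ?lt_neqAle ?wxfin ?leey.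
    rewrite wxoo.
    have [fx0|fx0] := eqVneq (f x) 0.
      have hn0 n : (h n x)%:E = 0.
        apply/eqP; rewrite eq_le; apply/andP; split; last by rewrite lee_fin.
        rewrite -fx0 [leRHS]fE.
        apply: lime_ge; first exact: ereal_nondecreasing_is_cvgn.
        by exists n => // m; exact: hnd.
      rewrite fx0 mul0e; under eq_fun do rewrite hn0 mul0e.
      exact: cvg_cst.
    rewrite gt0_muley; last by rewrite lt0e fx0 f0.
    have hpos : \forall n \near \oo, 0 < (h n x)%:E.
      have fx_gt0 : 0 < f x by rewrite lt0e fx0 f0.
      exact: (hf _ (open_ereal_gt' fx_gt0)).
    apply: cvg_near_cst.
    by apply: filterS hpos => n hn; rewrite gt0_muley.
  under [RHS]eq_integral do rewrite fwE.
  apply/esym/monotone_convergence => //.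
  - by move=> n; apply: emeasurable_funM => //; exact/measurable_EFinP.
  - by move=> n x _; rewrite mule_ge0 ?lee_fin.
  - by move=> x _ a b ab; rewrite lee_wpmul2r// hnd.
congr (limn _); apply/funext => n.
transitivity (\int[nu]_x
   (\sum_(y \in range (h n)) (y * \1_(h n @^-1` [set y]) x)%:E)).
  by apply: eq_integral => t tE; rewrite /= fimfunE -fsumEFin.
rewrite ge0_integral_fsum//; last by move=> m y Ey; exact: nnfun_muleindic_ge0.
transitivity (\int[mu]_x
   (\sum_(y \in range (h n)) (y * \1_(h n @^-1` [set y]) x)%:E * w x)); last first.
  apply: eq_integral => t tE; rewrite [in RHS]fimfunE -fsumEFin//.
  rewrite ge0_mule_fsuml// => y; exact: nnfun_muleindic_ge0.
rewrite ge0_integral_fsum//.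
- apply: eq_fsbigr => r rh.
  have r0 : (0 <= r)%R by move: rh; rewrite inE => -[x _ <-].
  under eq_integral do rewrite EFinM.
  under [RHS]eq_integral do rewrite EFinM -muleA.
  rewrite ge0_integralZl//; last exact/measurable_EFinP.
  rewrite ge0_integralZl//; last 2 first.
  - by apply: emeasurable_funM => //; exact/measurable_EFinP.
  - by move=> x _; rewrite mule_ge0// lee_fin.
  rewrite integral_indic// setIT; congr (_ * _).
  transitivity (\int[mu]_(x in h n @^-1` [set r]) w x) => //.
  rewrite integral_mkcond; apply: eq_integral => x _.
  by rewrite epatch_indic muleC.
- by move=> r; apply: emeasurable_funM.
- by move=> r x _; rewrite mule_ge0//; exact: nnfun_muleindic_ge0.
Qed.

End density_measure.

Section line_symmetries.
Context (R : realType).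
Local Open Scope ereal_scope.
Local Notation mu := (@lebesgue_measure R).

Lemma ge0_integral_opp (f : R -> \bar R) :
  measurable_fun setT f -> (forall x, 0 <= f x) ->
  \int[mu]_x f (- x)%R = \int[mu]_x f x.
Proof.
move=> mf f0; rewrite -[LHS](@ge0_integral_pushforward _ _ (measurableTypeR R)
  (measurableTypeR R) R -%R _ mu setT f)//.
by apply: eq_measure_integral => //= A mA _; exact: lebesgue_measureN.
Qed.

Let addc (c : R) : measurableTypeR R -> measurableTypeR R := fun x => (x + c)%R.

Let measurable_addc c : measurable_fun setT (addc c).
Proof. exact: measurable_funD. Qed.

Lemma ge0_integral_translate (f : R -> \bar R) (c : R) :
  measurable_fun setT f -> (forall x, 0 <= f x) ->
  \int[mu]_x f (x + c)%R = \int[mu]_x f x.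
Proof.
move=> mf f0; rewrite -[LHS](@ge0_integral_pushforward _ _ (measurableTypeR R)
  (measurableTypeR R) R (addc c) (measurable_addc c) mu setT f)//.
pose mx := isMeasurableFun.Build _ _ _ _ _ (measurable_addc c).
pose ac : {mfun _ >-> _} := HB.pack (addc c) mx.
apply: eq_measure_integral => //= A mA _.
apply/esym/(@lebesgue_measure_unique _ (pushforward mu ac)) => //= _ [[a b]] _ <-.
rewrite /pushforward (_ : ac @^-1` _ = `]a - c, b - c]%classic)%R; last first.
  by apply/seteqP; split => x /=; rewrite !in_itv/= lerBrDr ltrBlDr.
rewrite !lebesgue_measure_itv/= !lte_fin ltrD2r.
by rewrite -!EFinB opprB addrA subrK.
Qed.

End line_symmetries.

Section euclidean_tonelli.
Context (R : realType).
Local Open Scope ereal_scope.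
Local Notation mu := (@lebesgue_measure R).

Lemma ge0_integral_lebesgue_Rn0 (f : Rn R 0 -> \bar R) :
  measurable_fun setT f -> (forall x, 0 <= f x) ->
  \int[lebesgue_Rn R 0]_x f x = f [tuple].
Proof. by move=> mf f0; rewrite integral_dirac// diracT mul1e. Qed.

Lemma ge0_integral_lebesgue_RnS (n : nat) (f : Rn R n.+1 -> \bar R) :
  measurable_fun setT f -> (forall x, 0 <= f x) ->
  \int[lebesgue_Rn R n.+1]_x f x =
  \int[mu]_a \int[lebesgue_Rn R n]_x f (tuple_cons (a, x)).
Proof.
move=> mf f0.
have mc := @measurable_tuple_cons R n.
have mfc : measurable_fun setT (f \o tuple_cons) by exact: measurableT_comp.
have fc0 (z : Rspacetime R n) : 0 <= (f \o tuple_cons) z by exact: f0.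
transitivity (\int[mu \x lebesgue_Rn R n]_z (f \o tuple_cons) z); last first.
  exact: fubini_tonelli1.
by rewrite -[RHS](@ge0_integral_pushforward _ _ _ _ _ _ mc _ setT f).
Qed.

Lemma dotp_cons (n : nat) (a b : R) (x y : Rn R n) :
  dotp (tuple_cons (a, x)) (tuple_cons (b, y)) = (a * b + dotp x y)%R.
Proof.
rewrite /dotp big_ord_recl/= !tnth0; congr (_ + _)%R.
by apply: eq_bigr => i _; rewrite !tnthS.
Qed.

Lemma measurable_dotp (n : nat) (x : Rn R n) : measurable_fun setT (dotp x).
Proof.
apply: measurable_sum => i; apply: measurable_funM => //; exact: measurable_tnth.
Qed.

Lemma measurable_dotpp (n : nat) :
  measurable_fun setT (fun x : Rn R n => dotp x x).
Proof. by apply: measurable_sum => i; apply: measurable_funM; exact: measurable_tnth. Qed.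

Lemma dotpp_ge0 (n : nat) (x : Rn R n) : (0 <= dotp x x)%R.
Proof. by apply: sumr_ge0 => i _; rewrite -expr2 sqr_ge0. Qed.

Lemma sqr_enorm (n : nat) (x : Rn R n) : (enorm x ^+ 2 = dotp x x)%R.
Proof. by rewrite /enorm sqr_sqrtr// dotpp_ge0. Qed.

Lemma enorm_ge0 (n : nat) (x : Rn R n) : (0 <= enorm x)%R.
Proof. exact: sqrtr_ge0. Qed.

End euclidean_tonelli.

(** * Rotation invariance of integrals of plane waves *)

Section rotation.
Context (R : realType).
Local Open Scope ereal_scope.
Local Notation mu := (@lebesgue_measure R).
Implicit Type h : R -> R -> \bar R.

Let measurable_comp2 (h : R -> R -> \bar R) d (T : measurableType d) (f g : T -> R) :
  measurable_fun setT (fun z : R * R => h z.1 z.2) ->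
  measurable_fun setT f -> measurable_fun setT g ->
  measurable_fun setT (fun z => h (f z) (g z)).
Proof.
move=> mh mf mg.
exact: (measurableT_comp mh (measurable_fun_pair mf mg)).
Qed.

Let shearr (h : R -> R -> \bar R) (k : R) :
  measurable_fun setT (fun z : R * R => h z.1 z.2) -> (forall a b, 0 <= h a b) ->
  \int[mu]_a \int[mu]_b h a (b + k * a)%R = \int[mu]_a \int[mu]_b h a b.
Proof.
move=> mh h0; apply: eq_integral => a _.
apply: (@ge0_integral_translate _ (h a)) => //.
exact: measurable_comp2.
Qed.

Let swap (h : R -> R -> \bar R) :
  measurable_fun setT (fun z : R * R => h z.1 z.2) -> (forall a b, 0 <= h a b) ->
  \int[mu]_a \int[mu]_b h a b = \int[mu]_b \int[mu]_a h a b.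
Proof.
by move=> mh h0; exact: (@fubini_tonelli _ _ _ _ _ mu mu (fun z => h z.1 z.2)).
Qed.

Let shearl (h : R -> R -> \bar R) (k : R) :
  measurable_fun setT (fun z : R * R => h z.1 z.2) -> (forall a b, 0 <= h a b) ->
  \int[mu]_a \int[mu]_b h (a + k * b)%R b = \int[mu]_a \int[mu]_b h a b.
Proof.
move=> mh h0.
have mh' : measurable_fun setT (fun z : R * R => h (z.1 + k * z.2)%R z.2).
  apply: measurable_comp2 => //.
  by apply: measurable_funD => //; exact: measurable_funM.
have mh'' : measurable_fun setT (fun z : R * R => h z.2 z.1).
  exact: measurable_comp2.
apply: (etrans (@swap (fun a b => h (a + k * b)%R b) mh' _)) => [*|].
  exact: h0.
apply: (etrans (@shearr (fun b a => h a b) k mh'' _)) => [*|]; first exact: h0.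
exact/esym/swap.
Qed.

(* A plane rotation by an angle other than pi is a product of three shears. *)
Lemma ge0_integral_rotation (h : R -> R -> \bar R) (c s : R) :
  measurable_fun setT (fun z : R * R => h z.1 z.2) -> (forall a b, 0 <= h a b) ->
  (c ^+ 2 + s ^+ 2 = 1)%R -> (1 + c != 0)%R ->
  \int[mu]_a \int[mu]_b h (c * a + s * b)%R (- s * a + c * b)%R =
  \int[mu]_a \int[mu]_b h a b.
Proof.
(* [k] is the tangent of half the angle; the three shears have slopes [k], [- s] and [k]. *)
move=> mh h0 cs c1; pose k := (s / (1 + c))%R.
pose h1 a b := h (a + k * b)%R b.
pose h2 a b := h1 a (b + - s * a)%R.
have mh1 : measurable_fun setT (fun z : R * R => h1 z.1 z.2).
  apply: (measurable_comp2 mh) => //.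
  by apply: measurable_funD => //; exact: measurable_funM.
have mh2 : measurable_fun setT (fun z : R * R => h2 z.1 z.2).
  apply: (measurable_comp2 mh1) => //.
  by apply: measurable_funD => //; exact: measurable_funM.
have h10 a b : 0 <= h1 a b by exact: h0.
have h20 a b : 0 <= h2 a b by exact: h0.
apply: etrans (shearl k mh h0).
apply: etrans (shearr (- s)%R mh1 h10).
apply: etrans (shearl k mh2 h20).
apply: eq_integral => a _; apply: eq_integral => b _; rewrite /h2 /h1.
have e : (s ^+ 2 = (1 - c) * (1 + c))%R by rewrite -subr_sqr expr1n -cs addrAC subrr add0r.
have sk : (s * k = 1 - c)%R by rewrite /k mulrA -expr2 e mulfK.
have kc : (k * (1 + c) = s)%R by rewrite /k mulfVK.
have -> : (b + - s * (a + k * b) = - s * a + c * b)%R.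
  by rewrite mulrDr mulrA mulNr mulNr sk; ring.
congr h; rewrite mulrDr !mulrA mulrN (mulrC k s) sk.
have -> : (s * b = k * (1 + c) * b)%R by rewrite kc.
by ring.
Qed.

(** The rotation that takes (x, y) to (|(x, y)|, 0) preserves a^2 + b^2, hence the factor [phi]. *)
Lemma ge0_integral_plane_wave (phi G : R -> \bar R) (x y : R) :
  measurable_fun setT phi -> measurable_fun setT G ->
  (forall u, 0 <= phi u) -> (forall u, 0 <= G u) ->
  \int[mu]_a \int[mu]_b (phi (a ^+ 2 + b ^+ 2)%R * G (x * a + y * b)%R) =
  \int[mu]_a \int[mu]_b
    (phi (a ^+ 2 + b ^+ 2)%R * G (Num.sqrt (x ^+ 2 + y ^+ 2) * a)%R).
Proof.
move=> mphi mG phi0 G0; pose rho : R := Num.sqrt (x ^+ 2 + y ^+ 2).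
rewrite -/rho.
have mm (X Y : R) : measurable_fun setT (fun z : R * R =>
    phi (z.1 ^+ 2 + z.2 ^+ 2)%R * G (X * z.1 + Y * z.2)%R).
  apply: emeasurable_funM.
    apply: (measurableT_comp mphi); apply: measurable_funD; exact: measurable_funX.
  apply: (measurableT_comp mG); apply: measurable_funD; exact: measurable_funM.
have rho2 : (rho ^+ 2 = x ^+ 2 + y ^+ 2)%R.
  by rewrite sqr_sqrtr// addr_ge0// sqr_ge0.
have [rho0|rhoN0] := eqVneq rho 0%R.
  have [x0 y0] : (x = 0)%R /\ (y = 0)%R.
    by move: rho2; rewrite rho0 expr0n/= => r0; split; nra.
  apply: eq_integral => a _; apply: eq_integral => b _.
  by rewrite rho0 x0 y0 !mul0r addr0.
have rot (c s : R) : (c ^+ 2 + s ^+ 2 = 1)%R -> (1 + c != 0)%R ->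
  \int[mu]_a \int[mu]_b
    (phi (a ^+ 2 + b ^+ 2)%R * G (rho * c * a + rho * s * b)%R) =
  \int[mu]_a \int[mu]_b (phi (a ^+ 2 + b ^+ 2)%R * G (rho * a)%R).
  move=> cs c1.
  pose hh a b := phi (a ^+ 2 + b ^+ 2)%R * G (rho * a + 0 * b)%R.
  have hh0 a b : 0 <= hh a b by rewrite mule_ge0.
  apply: (@etrans _ _ (\int[mu]_a \int[mu]_b hh a b)); last first.
    by apply: eq_integral => a _; apply: eq_integral => b _;
      rewrite /hh mul0r addr0.
  apply: etrans (ge0_integral_rotation (mm rho 0%R) hh0 cs c1).
  apply: eq_integral => a _; apply: eq_integral => b _; rewrite /hh.
  congr (phi _ * G _); last by ring.
  by rewrite -[LHS]mul1r -cs; ring.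
have xE : (x = rho * (x / rho))%R by rewrite mulrC mulfVK.
have yE : (y = rho * (y / rho))%R by rewrite mulrC mulfVK.
have cs1 : ((x / rho) ^+ 2 + (y / rho) ^+ 2 = 1)%R.
  by rewrite !expr_div_n -mulrDl -rho2 divff// sqrf_eq0.
(* The half turn, excluded from the factorization into shears, occurs when (x, y) = (-rho, 0); the
   reflection a -> -a replaces it. *)
have [c1|c1] := eqVneq (1 + x / rho)%R 0%R; last first.
  by move: (rot _ _ cs1 c1); rewrite -xE -yE.
have xr : (x / rho = -1)%R by apply/eqP; rewrite -subr_eq0 opprK addrC c1.
have y0 : (y = 0)%R.
  move: cs1; rewrite xr sqrrN expr1n -[RHS]addr0 => /addrI/eqP.
  by rewrite sqrf_eq0 mulf_eq0 invr_eq0 (negPf rhoN0) orbF => /eqP.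
have xrho : (x = - rho)%R by rewrite xE xr mulrN1.
pose g a := \int[mu]_b (phi (a ^+ 2 + b ^+ 2)%R * G (rho * a + 0 * b)%R).
have mg : measurable_fun setT g.
  by apply: (@measurable_fun_fubini_tonelli_F _ _ _ _ _ mu _ (mm rho 0%R)) => z;
    rewrite mule_ge0.
have g0 a : 0 <= g a by apply: integral_ge0 => b _; rewrite mule_ge0.
apply: (@etrans _ _ (\int[mu]_a g a)); last first.
  by apply: eq_integral => a _; apply: eq_integral => b _; rewrite mul0r addr0.
apply: etrans (ge0_integral_opp mg g0).
apply: eq_integral => a _; apply: eq_integral => b _.
by rewrite xrho y0 !mul0r !addr0 sqrrN mulrN mulNr.
Qed.

Let tuple_consK (n : nat) (x : Rn R n.+1) :
  exists a (y : Rn R n), x = tuple_cons (a, y).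
Proof. by case/tupleP: x => a y; exists a, y; apply: val_inj. Qed.

Let measurable_plane_wave (n : nat) (phi G : R -> \bar R) (x : Rn R n) :
  measurable_fun setT phi -> measurable_fun setT G ->
  measurable_fun setT (fun xi : Rn R n => phi (dotp xi xi) * G (dotp x xi)).
Proof.
move=> mphi mG; apply: emeasurable_funM.
  exact: (measurableT_comp mphi (@measurable_dotpp R n)).
exact: (measurableT_comp mG (measurable_dotp x)).
Qed.

(** Induction on the dimension. With the first coordinate a fixed, the induction hypothesis for
    [phi (a ^+ 2 + _)] and [G (x1 * a + _)] aligns the remaining part y of x with one axis b; a
    rotation of the (a, b) plane then aligns (x1, |y|), whose length is |x|. *)
Lemma ge0_integral_plane_wave_Rn (n : nat) (phi G : R -> \bar R) (x : Rn R n.+1) :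
  measurable_fun setT phi -> measurable_fun setT G ->
  (forall u, 0 <= phi u) -> (forall u, 0 <= G u) ->
  \int[lebesgue_Rn R n.+1]_xi (phi (dotp xi xi) * G (dotp x xi)) =
  \int[mu]_a \int[lebesgue_Rn R n]_eta
    (phi (a ^+ 2 + dotp eta eta)%R * G (enorm x * a)%R).
Proof.
elim: n phi G x => [|n IH] phi G x mphi mG phi0 G0.
  have [x1 [y xE]] := tuple_consK x.
  have m0 (c : R) a : \int[lebesgue_Rn R 0]_eta
      (phi (a ^+ 2 + dotp eta eta)%R * G (c * a)%R) =
      phi (a ^+ 2)%R * G (c * a)%R.
    rewrite ge0_integral_lebesgue_Rn0; last 2 first.
    - apply: emeasurable_funM => //; apply: (measurableT_comp mphi).
      by apply: measurable_funD => //; exact: measurable_dotpp.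
    - by move=> ?; rewrite mule_ge0.
    by rewrite {1}/dotp big_ord0 addr0.
  have E1 : enorm x = `|x1|%R.
    by rewrite /enorm xE dotp_cons {1}/dotp big_ord0 addr0 -expr2 sqrtr_sqr.
  rewrite ge0_integral_lebesgue_RnS; last 2 first.
  - exact: measurable_plane_wave.
  - by move=> ?; rewrite mule_ge0.
  transitivity (\int[mu]_a (phi (a ^+ 2)%R * G (x1 * a)%R)).
    apply: eq_integral => a _; rewrite -m0; apply: eq_integral => eta _.
    rewrite xE !dotp_cons -expr2; congr (_ * G _).
    by rewrite {1}/dotp big_ord0 addr0.
  transitivity (\int[mu]_a (phi (a ^+ 2)%R * G (`|x1| * a)%R)); last first.
    by apply: eq_integral => a _; rewrite E1 m0.
  have mf (c : R) : measurable_fun setT (fun a : R => phi (a ^+ 2)%R * G (c * a)%R).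
    apply: emeasurable_funM.
      apply: (measurableT_comp mphi); exact: measurable_funX.
    by apply: (measurableT_comp mG); exact: measurable_funM.
  have [x10|x10] := leP 0%R x1; first by rewrite ger0_norm.
  rewrite ltr0_norm//.
  have f0 a : 0 <= phi (a ^+ 2)%R * G (- x1 * a)%R by rewrite mule_ge0.
  apply: etrans (ge0_integral_opp (mf _) f0).
  by apply: eq_integral => a _; rewrite sqrrN mulrNN.
have [x1 [y xE]] := tuple_consK x.
rewrite ge0_integral_lebesgue_RnS; last 2 first.
- exact: measurable_plane_wave.
- by move=> ?; rewrite mule_ge0.
(* [Phi] integrates out the coordinates orthogonal to the (a, b) plane, so that the planar lemma
   applies with [Phi] in place of [phi]. *)
pose Phi u := \int[lebesgue_Rn R n]_zeta phi (u + dotp zeta zeta)%R.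
have mphi2 : measurable_fun setT
    (fun z : R * Rn R n => phi (z.1 + dotp z.2 z.2)%R).
  apply: (measurableT_comp mphi); apply: measurable_funD => //.
  exact: (measurableT_comp (@measurable_dotpp R n) measurable_snd).
have mPhi : measurable_fun setT Phi.
  exact: (measurable_fun_fubini_tonelli_F _ mphi2).
have Phi0 u : 0 <= Phi u by exact: integral_ge0.
have PhiZ u c : 0 <= c -> Phi u * c =
    \int[lebesgue_Rn R n]_zeta (phi (u + dotp zeta zeta)%R * c).
  move=> c0; rewrite ge0_integralZr//.
  apply: (measurableT_comp mphi); apply: measurable_funD => //.
  exact: measurable_dotpp.
transitivity (\int[mu]_a \int[mu]_b
    (Phi (a ^+ 2 + b ^+ 2)%R * G (x1 * a + enorm y * b)%R)).
  apply: eq_integral => a _.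
  transitivity (\int[lebesgue_Rn R n.+1]_eta
      ((fun u => phi (a ^+ 2 + u)%R) (dotp eta eta) *
       (fun v => G (x1 * a + v)%R) (dotp y eta))).
    by apply: eq_integral => eta _; rewrite xE !dotp_cons -expr2.
  have mphia : measurable_fun setT (fun u => phi (a ^+ 2 + u)%R).
    by apply: (measurableT_comp mphi); exact: measurable_funD.
  have mGa : measurable_fun setT (fun v => G (x1 * a + v)%R).
    by apply: (measurableT_comp mG); exact: measurable_funD.
  apply: (etrans (IH _ _ y mphia mGa (fun=> phi0 _) (fun=> G0 _))).
  apply: eq_integral => b _; rewrite PhiZ//.
  by apply: eq_integral => zeta _; rewrite addrA.
apply: etrans (ge0_integral_plane_wave _ _ mPhi mG Phi0 G0) _.
apply: eq_integral => a _.
have -> : Num.sqrt (x1 ^+ 2 + enorm y ^+ 2) = enorm x.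
  by rewrite /enorm xE dotp_cons -expr2 sqr_sqrtr// dotpp_ge0.
rewrite ge0_integral_lebesgue_RnS; last 2 first.
- apply: emeasurable_funM => //; apply: (measurableT_comp mphi).
  by apply: measurable_funD => //; exact: measurable_dotpp.
- by move=> ?; rewrite mule_ge0.
apply: eq_integral => b _; rewrite PhiZ//.
by apply: eq_integral => zeta _; rewrite dotp_cons -expr2 addrA.
Qed.

End rotation.

(** * Bessel integrals *)

Section pointwise_derivatives.
Context (R : realType).
Implicit Types (f g : R -> R) (x a b : R).

(** The differentiation rules are restated for explicit lambda terms, the syntactic shape on which
    [derive_rec] matches. *)
Lemma is_derive_fun_cst x a : is_derive x 1 (fun=> a) 0.
Proof. exact: is_derive_cst. Qed.

Lemma is_derive_fun_id x : is_derive x 1 (fun y => y) 1.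
Proof. exact: is_derive_id. Qed.

Lemma is_derive_funD f g x a b : is_derive x 1 f a -> is_derive x 1 g b ->
  is_derive x 1 (fun y => f y + g y) (a + b).
Proof. by move=> fa gb; exact: is_deriveD. Qed.

Lemma is_derive_funN f x a : is_derive x 1 f a ->
  is_derive x 1 (fun y => - f y) (- a).
Proof. by move=> fa; exact: is_deriveN. Qed.

Lemma is_derive_funM f g x a b : is_derive x 1 f a -> is_derive x 1 g b ->
  is_derive x 1 (fun y => f y * g y) (a * g x + f x * b).
Proof.
move=> fa gb; apply: (is_derive_eq (is_deriveM fa gb)).
by rewrite addrC; congr +%R; exact: mulrC.
Qed.

Lemma is_derive_funV f x a : f x != 0 -> is_derive x 1 f a ->
  is_derive x 1 (fun y => (f y)^-1) (- (f x ^- 2 * a)).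
Proof.
move=> fx0 fa; apply: (is_derive_eq (is_deriveV fx0 fa)).
by rewrite /GRing.scale/= mulNr.
Qed.

Lemma is_derive_funX f n x a : is_derive x 1 f a ->
  is_derive x 1 (fun y => f y ^+ n) (n%:R * f x ^+ n.-1 * a).
Proof.
move=> fa; elim: n => [|n IH].
  by rewrite !mul0r; under eq_fun do rewrite expr0; exact: is_derive_fun_cst.
under eq_fun do rewrite exprS.
apply: (is_derive_eq (is_derive_funM fa IH)).
case: n {IH} => [|n]/=; first by rewrite expr0; ring.
by rewrite exprS -[in RHS]addn1 natrD; ring.
Qed.

Lemma is_derive_fun_sin f x a : is_derive x 1 f a ->
  is_derive x 1 (fun y => sin (f y)) (cos (f x) * a).
Proof. by move=> fa; exact: (is_derive1_comp (is_derive_sin (f x)) fa). Qed.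

Lemma is_derive_fun_cos f x a : is_derive x 1 f a ->
  is_derive x 1 (fun y => cos (f y)) (- sin (f x) * a).
Proof. by move=> fa; exact: (is_derive1_comp (is_derive_cos (f x)) fa). Qed.

Lemma is_derive_fun_expR f x a : is_derive x 1 f a ->
  is_derive x 1 (fun y => expR (f y)) (expR (f x) * a).
Proof. by move=> fa; exact: (is_derive1_comp (is_derive_expR (f x)) fa). Qed.

Lemma is_derive_fun_atan f x a : is_derive x 1 f a ->
  is_derive x 1 (fun y => atan (f y)) ((1 + f x ^+ 2)^-1 * a).
Proof. by move=> fa; exact: (is_derive1_comp (is_derive1_atan (f x)) fa). Qed.

Lemma is_derive_continuous f x a : is_derive x 1 f a -> {for x, continuous f}.
Proof.
by move=> fa; apply: differentiable_continuous; apply/derivable1_diffP.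
Qed.

Lemma continuous_funM f g : continuous f -> continuous g ->
  continuous (fun x => f x * g x).
Proof.
by move=> cf cg x; apply: (@continuousM _ _ f g); [exact: cf|exact: cg].
Qed.

Lemma continuous_fun_comp f g : continuous f -> continuous g ->
  continuous (fun x => g (f x)).
Proof.
by move=> cf cg x; apply: (@continuous_comp _ _ _ f g); [exact: cf|exact: cg].
Qed.

Lemma derivable_oo_LR_is_derive f g a b :
  (forall x, is_derive x 1 f (g x)) -> derivable_oo_LRcontinuous f a b.
Proof.
move=> df; have cf : continuous f by move=> x; exact: is_derive_continuous (df x).
split => [x _||]; first by have [] := df x.
- by apply: cvg_at_right_filter; exact: cf.
- by apply: cvg_at_left_filter; exact: cf.
Qed.

Lemma is_derive_derive1 f g :
  (forall x, is_derive x 1 f (g x)) -> f^`()%classic = g.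
Proof. by move=> df; apply/funext => x; rewrite derive1E; have [_ ->] := df x. Qed.

Lemma Rintegral_is_derive (F f : R -> R) (a b : R) : a < b ->
  (forall x, is_derive x 1 F (f x)) -> continuous f ->
  \int[lebesgue_measure]_(x in `[a, b]) f x = F b - F a.
Proof.
move=> ab dF cf; rewrite /Rintegral (@continuous_FTC2 _ f F a b)//.
- exact: continuous_subspaceT.
- exact: derivable_oo_LR_is_derive dF.
- by move=> x _; rewrite derive1E; have [_ ->] := dF x.
Qed.

Lemma continuous_integrable_itv (f : R -> R) (a b : R) : continuous f ->
  lebesgue_measure.-integrable `[a, b] (EFin \o f).
Proof.
move=> cf; apply: continuous_compact_integrable; first exact: segment_compact.
exact: continuous_subspaceT.
Qed.

End pointwise_derivatives.

(* The type class resolution triggered by apply: is too slow on the nested goals. *)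
Ltac derive_rec := cbv beta; first [notypeclasses refine (is_derive_fun_cst _ _) |
  lazymatch goal with
  | |- is_derive _ _ (fun y => y) _ =>
    notypeclasses refine (is_derive_fun_id _)
  | |- is_derive _ _ (fun y => _ + _) _ =>
    notypeclasses refine (is_derive_funD _ _); derive_rec
  | |- is_derive _ _ (fun y => - _) _ =>
    notypeclasses refine (is_derive_funN _); derive_rec
  | |- is_derive _ _ (fun y => _ * _) _ =>
    notypeclasses refine (is_derive_funM _ _); derive_rec
  | |- is_derive _ _ (fun y => _ ^+ _) _ =>
    notypeclasses refine (is_derive_funX _ _); derive_rec
  | |- is_derive _ _ (fun y => _^-1) _ =>
    notypeclasses refine (is_derive_funV _ _); [|derive_rec]
  | |- is_derive _ _ (fun y => sin _) _ =>
    notypeclasses refine (is_derive_fun_sin _); derive_rec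
  | |- is_derive _ _ (fun y => cos _) _ =>
    notypeclasses refine (is_derive_fun_cos _); derive_rec
  | |- is_derive _ _ (fun y => expR _) _ =>
    notypeclasses refine (is_derive_fun_expR _); derive_rec
  | |- is_derive _ _ (fun y => atan _) _ =>
    notypeclasses refine (is_derive_fun_atan _); derive_rec
  | |- is_derive _ _ (@GRing.inv _) _ =>
    notypeclasses refine (is_derive_funV (f := fun y => y) _ (is_derive_fun_id _))
  | |- is_derive _ _ (@GRing.opp _) _ =>
    notypeclasses refine (is_derive_funN (is_derive_fun_id _))
  | |- is_derive _ _ (@GRing.mul _ ?c) _ =>
    notypeclasses refine (is_derive_funM (f := fun=> c) (g := fun y => y)
      (is_derive_fun_cst _ _) (is_derive_fun_id _))
  | |- is_derive _ _ (@Algebra.add _ ?c) _ =>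
    notypeclasses refine (is_derive_funD (f := fun=> c) (g := fun y => y)
      (is_derive_fun_cst _ _) (is_derive_fun_id _))
  | |- is_derive _ _ sin _ => notypeclasses refine (is_derive_sin _)
  | |- is_derive _ _ cos _ => notypeclasses refine (is_derive_cos _)
  | |- is_derive _ _ expR _ => notypeclasses refine (is_derive_expR _)
  | |- is_derive _ _ atan _ => notypeclasses refine (is_derive1_atan _)
  | |- _ => eassumption
  end].

Ltac derive := notypeclasses refine (is_derive_eq _ _); [derive_rec|cbv beta].
Ltac derive_cont := notypeclasses refine (is_derive_continuous _); derive_rec.

Section bessel.
Context (R : realType).
Local Notation mu := (@lebesgue_measure R).
Local Notation I := `[- (pi / 2), (pi / 2 : R)]%classic.

(* Up to a constant, the Bessel function J_(k/2)(s) / s^(k/2). *)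
Definition bessel_int (k : nat) (s : R) : R :=
  \int[mu]_(th in I) (cos (s * sin th) * cos th ^+ k).

Local Notation J := bessel_int.

Let ltI : - (pi / 2) < pi / 2 :> R.
Proof. by have := @pi_gt0 R; lra. Qed.

Let cont_trig (s : R) (k : nat) : continuous (fun th : R => cos (s * sin th) * cos th ^+ k).
Proof.
by move=> th; derive_cont.
Qed.

(** This is the three-term recurrence between the Bessel functions of orders k/2, k/2 + 1 and k/2 +
    2. The combination of the integrands is the exact derivative of [F], which vanishes at both
    endpoints because cos(pi/2) = 0. *)
Lemma bessel_int_recurrence (k : nat) (s : R) :
  s ^+ 2 * J k.+4 s = (k.+3)%:R * ((k.+2)%:R * J k.+2 s - k.+1%:R * J k s).
Proof.
pose F th : R := s * cos th ^+ k.+3 * sin (s * sin th) -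
  k.+3%:R * (sin th * cos th ^+ k.+1 * cos (s * sin th)).
pose f th : R := s ^+ 2 * (cos (s * sin th) * cos th ^+ k.+4) -
  k.+3%:R * (k.+2%:R * (cos (s * sin th) * cos th ^+ k.+2) -
             k.+1%:R * (cos (s * sin th) * cos th ^+ k)).
have dF (th : R) : is_derive th 1 F (f th).
  rewrite /F; derive.
  rewrite /f /=.
  have c2 := cos2Dsin2 th.
  have -> : k.+3%:R = k%:R + 3 :> R by rewrite -natrD addn3.
  have -> : k.+2%:R = k%:R + 2 :> R by rewrite -natrD addn2.
  have -> : k.+1%:R = k%:R + 1 :> R by rewrite natr1.
  rewrite !exprS.
  have e : sin th ^+ 2 = 1 - cos th ^+ 2 by rewrite -c2; ring.
  set C := cos (s * _); set S := sin (s * _); set c := cos th; set u := c ^+ k.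
  rewrite -/c in e.
  by transitivity (s * s * c ^+ 4 * u * C - (k%:R + 3) * (c ^+ 2 * u * C -
    (k%:R + 1) * sin th ^+ 2 * u * C)); [ring|rewrite e; ring].
have cf : continuous f.
  move=> th; rewrite /f; derive_cont.
have F0 : \int[mu]_(th in I) f th = 0.
  rewrite (Rintegral_is_derive ltI dF cf) /F cosN cos_pihalf.
  by rewrite !expr0n/=; ring.
have iJ j (a : R) : mu.-integrable I
    (EFin \o (fun th => a * (cos (s * sin th) * cos th ^+ j))).
  by apply: continuous_integrable_itv => th; derive_cont.
have iJ1 j : mu.-integrable I (EFin \o (fun th => cos (s * sin th) * cos th ^+ j)).
  by apply: continuous_integrable_itv => th; derive_cont.
have iB : mu.-integrable I (EFin \o (fun th =>
   k.+2%:R * (cos (s * sin th) * cos th ^+ k.+2) -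
             k.+1%:R * (cos (s * sin th) * cos th ^+ k))).
  by apply: continuous_integrable_itv => th; derive_cont.
have iB3 : mu.-integrable I (EFin \o (fun th => k.+3%:R * (
   k.+2%:R * (cos (s * sin th) * cos th ^+ k.+2) -
             k.+1%:R * (cos (s * sin th) * cos th ^+ k)))).
  by apply: continuous_integrable_itv => th; derive_cont.
move: F0; rewrite /f RintegralB// !RintegralZl// RintegralB// !RintegralZl//.
by move/eqP; rewrite subr_eq0 => /eqP.
Qed.

(** Differentiation under the integral sign, dominated by 1, produces a sine integral. The
    derivative of [cos th ^+ k.+1 * sin (s * sin th)] integrates to 0 and converts it into
    [J k.+2]. *)
Lemma derivable_bessel_int (k : nat) (s : R) :
  is_derive s 1 (J k) (- (s / k.+1%:R * J k.+2 s)).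
Proof.
pose f (s' th : R) : R := cos (s' * sin th) * cos th ^+ k.
pose df (s' th : R) : R := - (sin th * sin (s' * sin th) * cos th ^+ k).
have dfE (s' th : R) : is_derive s' 1 (f ^~ th) (df s' th).
  rewrite /f; derive.
  by rewrite /df; ring.
have d1 s' th : partial1of2 f s' th = df s' th.
  by rewrite partial1of2E; have [_ ->] := dfE s' th.
have mI : measurable (I : set (measurableTypeR R)) by [].
have Ia : `]s - 1, s + 1[%classic s by rewrite /= in_itv/=; apply/andP; split; lra.
have intf x : `]s - 1, s + 1[%classic x -> mu.-integrable I (EFin \o f x).
  by move=> _; apply: continuous_integrable_itv => th; rewrite /f; derive_cont.
have derf x y : `]s - 1, s + 1[%classic x -> I y -> derivable (f ^~ y) x 1.
  by move=> _ _; have [] := dfE x y.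
have G0 (y : R) : 0 <= (cst 1 : R -> R) y by [].
have iG : mu.-integrable I (EFin \o (cst 1 : R -> R)).
  by apply: continuous_integrable_itv; exact: cst_continuous.
have Gub x y : `]s - 1, s + 1[%classic x -> I y -> `|partial1of2 f x y| <= (cst 1 : R -> R) y.
  move=> _ _; rewrite d1 /df normrN !normrM normrX /=.
  rewrite mulr_ile1 ?mulr_ge0 ?exprn_ge0//.
    by rewrite mulr_ile1// ler_norml ?sin_geN1 ?sin_le1.
  by rewrite exprn_ile1// ler_norml cos_geN1 cos_le1.
have dJ := derivable_under_integral mI Ia intf derf G0 iG Gub.
have dJE := differentiation_under_integral mI Ia intf derf G0 iG Gub.
apply: DeriveDef; first exact: dJ.
rewrite -derive1E dJE; under eq_Rintegral do rewrite d1.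
pose F th : R := cos th ^+ k.+1 * sin (s * sin th).
pose g th : R := s * (cos (s * sin th) * cos th ^+ k.+2) +
  k.+1%:R * (df s th).
have dF (th : R) : is_derive th 1 F (g th).
  rewrite /F; derive.
  by rewrite /g /df /= !exprS; ring.
have cdf : continuous (df s).
  by move=> th; rewrite /df; derive_cont.
have cg : continuous g.
  by move=> th; rewrite /g /df; derive_cont.
have : \int[mu]_(th in I) g th = 0.
  rewrite (Rintegral_is_derive ltI dF cg) /F cosN cos_pihalf.
  by rewrite !expr0n/=; ring.
have i1 (a : R) : mu.-integrable I
    (EFin \o (fun th => a * (cos (s * sin th) * cos th ^+ k.+2))).
  by apply: continuous_integrable_itv => th; derive_cont.
have i2 (a : R) : mu.-integrable I (EFin \o (fun th => a * df s th)).
  by apply: continuous_integrable_itv => th; rewrite /df; derive_cont.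
have i3 : mu.-integrable I (EFin \o (fun th => cos (s * sin th) * cos th ^+ k.+2)).
  exact: continuous_integrable_itv.
rewrite /g RintegralD// !RintegralZl//; last exact: continuous_integrable_itv.
rewrite -/(J k.+2 s) => H.
have k0 : k.+1%:R != 0 :> R by rewrite pnatr_eq0.
set X := \int[mu]_(x in _) _ in H *.
have -> : X = (k.+1%:R)^-1 * (k.+1%:R * X) by rewrite mulKf.
have -> : k.+1%:R * X = - (s * J k.+2 s) by apply/eqP; rewrite -addr_eq0 addrC H.
by rewrite mulrN mulrA (mulrC _ s).
Qed.

Lemma bessel_int_le_pi (k : nat) (s : R) : `|J k s| <= pi.
Proof.
apply: (@le_trans _ _ (\int[mu]_(th in I) `|cos (s * sin th) * cos th ^+ k|)).
  by apply: le_normr_Rintegral => //; apply: continuous_integrable_itv; exact: cont_trig.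
apply: (@le_trans _ _ (\int[mu]_(th in I) (cst 1 th))).
  apply: le_Rintegral => //.
  - have := continuous_integrable_itv (- (pi / 2)) (pi / 2) (@cont_trig s k).
    by move/integrable_norm.
  - by apply: continuous_integrable_itv; exact: cst_continuous.
  - move=> th _ /=; rewrite normrM normrX mulr_ile1 ?exprn_ge0//.
      by rewrite ler_norml cos_geN1 cos_le1.
    by rewrite exprn_ile1// ler_norml cos_geN1 cos_le1.
rewrite Rintegral_cst//= lebesgue_measure_itv/= lte_fin ltI/= mul1r.
by have := @pi_gt0 R; lra.
Qed.

(** With m = (k+1)/2, the function u = s^m J_k solves u'' + (1 + c/s^2) u = 0 for c = m(1 - m), and
    [P] is -u'/s^m. The energy u^2 + u'^2 has derivative -2c u u'/s^2, which the factor exp(K/s)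
    absorbs once K >= |c|, so [E] is nonincreasing on [1, +oo[. Taking the fourth power of J makes
    the exponent of 1 + s^2 an integer. *)
Lemma bessel_int_decay (k : nat) :
  exists2 C : R, 0 <= C &
    forall s : R, 0 <= s -> J k s ^+ 4 * (1 + s ^+ 2) ^+ k.+1 <= C.
Proof.
pose N : R := k.+1%:R; pose m : R := N / 2; pose K : R := m ^+ 2 + 1.
have N_gt0 : 0 < N by rewrite ltr0n.
have m_gt0 : 0 < m by rewrite divr_gt0.
pose P s := s * J k.+2 s / N - m * J k s / s.
pose E s := s ^+ k.+1 * (J k s ^+ 2 + (s * J k.+2 s / N - m * J k s / s) ^+ 2) * expR (K / s).
pose c := m * (1 - m).
have dE (s : R) : 0 < s -> is_derive s 1 E (expR (K / s) * s ^+ k.+1 *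
    (2 * c * J k s * P s - K * (J k s ^+ 2 + P s ^+ 2)) / s ^+ 2).
  move=> s0; have sN0 : s != 0 by rewrite gt_eqF.
  have dX := derivable_bessel_int k s.
  have dY := derivable_bessel_int k.+2 s.
  have rec := bessel_int_recurrence k s.
  have {}rec : J k.+4 s = k.+3%:R * ((k.+2)%:R * J k.+2 s - k.+1%:R * J k s) / s ^+ 2.
    by rewrite -rec mulrAC divff ?mul1r// sqrf_eq0.
  rewrite /E; derive=> //.
  rewrite /P rec /= [s ^+ k.+1]exprS.
  set X := J k s; set Y := J k.+2 s; set e := expR _; set sk := s ^+ k.
  rewrite /c /K /m.
  have -> : k.+3%:R = N + 2 :> R by rewrite /N -natrD addn2.
  have -> : k.+2%:R = N + 1 :> R by rewrite /N natr1.
  rewrite -/N.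
  by field; rewrite sN0 !gt_eqF// addr_gt0.
have E_nincr (s : R) : 1 <= s -> E s <= E 1.
  move=> s1; apply: (@ler0_derive1_nincry _ E 1) => //.
  - by move=> x; rewrite in_itv/= andbT => x1; have [] := dE _ (lt_trans ltr01 x1).
  - move=> x; rewrite in_itv/= andbT => x1; have x0 := lt_trans ltr01 x1.
    rewrite derive1E; have [_ ->] := dE _ x0.
    rewrite mulr_le0_ge0 ?invr_ge0 ?sqr_ge0//.
    rewrite mulr_ge0_le0 ?mulr_ge0 ?expR_ge0 ?exprn_ge0 ?(ltW x0)//.
    set X := J k x; set p := P x.
    (* K = m^2 + 1 dominates |m - m^2|, so the quadratic form in (X, p) is minus a nonnegative
       combination of (X + p)^2 and (X - p)^2. *)
    have cK1 : 0 <= K - c by rewrite /K /c; nra.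
    have cK2 : 0 <= K + c by rewrite /K /c; nra.
    have h1 := mulr_ge0 cK1 (sqr_ge0 (X + p)).
    have h2 := mulr_ge0 cK2 (sqr_ge0 (X - p)).
    rewrite -oppr_ge0 [leRHS](_ : _ =
      ((K - c) * (X + p) ^+ 2 + (K + c) * (X - p) ^+ 2) / 2); last by field.
    by rewrite divr_ge0// addr_ge0.
  - apply: derivable_within_continuous => x.
    by rewrite in_itv/= andbT => x1; have [] := dE _ (lt_le_trans ltr01 x1).
have K0 : 0 <= K by rewrite /K addr_ge0// sqr_ge0.
have JE (s : R) : 1 <= s -> s ^+ k.+1 * J k s ^+ 2 <= E 1.
  move=> s1; apply: le_trans (E_nincr _ s1).
  have s0 := lt_le_trans ltr01 s1.
  rewrite /E -[leLHS]mulr1; apply: ler_pM => //.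
  - by apply: mulr_ge0; [rewrite exprn_ge0// ltW|exact: sqr_ge0].
  - by rewrite ler_wpM2l ?exprn_ge0 ?(ltW s0)// lerDl sqr_ge0.
  - by rewrite -expR0 ler_expR divr_ge0// ltW.
have E1_ge0 : 0 <= E 1.
  by apply: le_trans (JE 1 (lexx _)); rewrite expr1n mul1r sqr_ge0.
have J4 (s : R) : 0 <= J k s ^+ 4.
  by rewrite -[4%N]/(2 * 2)%N exprM sqr_ge0.
have pi4 : 0 <= (pi : R) ^+ 4 by rewrite exprn_ge0 ?pi_ge0.
have two_k : 0 <= 2 ^+ k.+1 :> R by rewrite exprn_ge0.
(* For s >= 1, use 1 + s^2 <= 2 s^2 and the energy bound; for s < 1, use 1 + s^2 <= 2 and |J| <=
   pi. *)
exists (2 ^+ k.+1 * (E 1 ^+ 2 + pi ^+ 4)).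
  by rewrite mulr_ge0// addr_ge0 ?sqr_ge0.
move=> s s0; have [s1|s1] := leP 1 s.
  apply: (@le_trans _ _ (2 ^+ k.+1 * E 1 ^+ 2)); last by rewrite ler_wpM2l// lerDl.
  apply: (@le_trans _ _ (2 ^+ k.+1 * (s ^+ k.+1 * J k s ^+ 2) ^+ 2)); last first.
    rewrite ler_wpM2l// lerXn2r ?nnegrE ?JE//.
    by apply: mulr_ge0; [exact: exprn_ge0|exact: sqr_ge0].
  have -> : 2 ^+ k.+1 * (s ^+ k.+1 * J k s ^+ 2) ^+ 2 = J k s ^+ 4 * (2 * s ^+ 2) ^+ k.+1.
    by rewrite exprMn [in RHS]exprMn -!exprM mulnC; ring.
  have s2 : 0 <= s ^+ 2 by exact: sqr_ge0.
  apply: ler_wpM2l => //; apply: lerXn2r; rewrite ?nnegrE; [lra|lra|].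
  by nra.
apply: (@le_trans _ _ (2 ^+ k.+1 * pi ^+ 4)); last first.
  by rewrite ler_wpM2l// lerDr sqr_ge0.
have s2 : 0 <= s ^+ 2 by exact: sqr_ge0.
rewrite mulrC; apply: ler_pM => //.
- by apply: exprn_ge0; lra.
- by apply: lerXn2r; rewrite ?nnegrE; [lra|lra|nra].
- rewrite -(ger0_norm (J4 s)) normrX.
  by apply: lerXn2r; rewrite ?nnegrE ?pi_ge0 ?bessel_int_le_pi.
Qed.

End bessel.

(** * Polar coordinates *)

Section balls.
Context (R : realType).
Local Notation mu := (@lebesgue_measure R).
Local Notation I := `[- (pi / 2), (pi / 2 : R)]%classic.
Local Notation J := (@bessel_int R).

Let ltI : - (pi / 2) < pi / 2 :> R.
Proof. by have := @pi_gt0 R; lra. Qed.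

Let cos_ge0I (th : R) : th \in `[- (pi / 2), (pi / 2 : R)] -> 0 <= cos th.
Proof. exact: cos_ge0_pihalf. Qed.

(** Substitution a = r sin th. The weight is, up to [ball_volume k], the measure of the
    k-dimensional slice at height a of the ball of radius r. *)
Lemma integral_circle_slices (k : nat) (G : R -> R) (r : R) : 0 <= r -> continuous G ->
  (\int[mu]_(a in `[(- r)%R, r]) (G a * Num.sqrt (r ^+ 2 - a ^+ 2) ^+ k)%:E =
  (r ^+ k.+1 * \int[mu]_(th in I) (G (r * sin th) * cos th ^+ k.+1))%:E)%E.
Proof.
rewrite le_eqVlt => /predU1P[<- cG|r0 cG].
  by rewrite oppr0 set_itv1 integral_set1 exprS !mul0r.
pose F th := r * sin th.
have dF (th : R) : is_derive th 1 F (r * cos th).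
  by rewrite /F; derive; ring.
have F'E := is_derive_derive1 dF.
have cF' : continuous (fun th => r * cos th) by move=> th; derive_cont.
have Fl : F (- (pi / 2)) = - r by rewrite /F sinN sin_pihalf mulrN mulr1.
have Fr : F (pi / 2) = r by rewrite /F sin_pihalf mulr1.
have cg : continuous (fun a => G a * Num.sqrt (r ^+ 2 - a ^+ 2) ^+ k).
  apply: continuous_funM => //.
  apply: (@continuous_fun_comp _ (fun a => Num.sqrt (r ^+ 2 - a ^+ 2))
    (fun y => y ^+ k)); last exact: exprn_continuous.
  apply: (@continuous_fun_comp _ (fun a => r ^+ 2 - a ^+ 2) Num.sqrt).
    by move=> a; derive_cont.
  exact: sqrt_continuous.
rewrite -{1}Fl -{1}Fr integration_by_substitution_increasing; last 7 first.
- exact: ltW.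
- move=> x y xI yI xy; rewrite /F ltr_pM2l//.
  by rewrite ltr_sin.
- by move=> x _; rewrite F'E; exact: cF'.
- apply/cvg_ex; eexists; rewrite F'E; apply: cvg_at_right_filter; exact: cF'.
- apply/cvg_ex; eexists; rewrite F'E; apply: cvg_at_left_filter; exact: cF'.
- exact: derivable_oo_LR_is_derive dF.
- exact: continuous_subspaceT.
rewrite F'E.
transitivity (\int[mu]_(th in I) (r ^+ k.+1 * (G (r * sin th) * cos th ^+ k.+1))%:E)%E.
  apply: eq_integral => th; rewrite inE/= => thI.
  congr EFin.
  change (G (r * sin th) * Num.sqrt (r ^+ 2 - (r * sin th) ^+ 2) ^+ k *
    (r * cos th) = r ^+ k.+1 * (G (r * sin th) * cos th ^+ k.+1)).
  have -> : r ^+ 2 - (r * sin th) ^+ 2 = (r * cos th) ^+ 2.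
    by rewrite !exprMn -[X in X - _]mulr1 -(cos2Dsin2 th); ring.
  rewrite sqrtr_sqr ger0_norm ?mulr_ge0 ?(ltW r0) ?cos_ge0I//.
  by rewrite exprMn !exprS; ring.
have ig : mu.-integrable I (EFin \o (fun th => G (r * sin th) * cos th ^+ k.+1)).
  apply: continuous_integrable_itv; apply: continuous_funM.
    apply: (@continuous_fun_comp _ (fun th => r * sin th) G) => // th.
    by derive_cont.
  by move=> th; derive_cont.
rewrite [in RHS]EFinM fineK ?integrable_fin_num//.
by rewrite -integralZl.
Qed.

(** Slicing the unit ball at height sin th gives V_(j+1) = V_j times the integral of cos^(j+1),
    which is [J j.+1 0]. *)
Fixpoint ball_volume (k : nat) : R :=
  if k is j.+1 then ball_volume j * J k 0 else 1.

Lemma bessel_int_ge0 (k : nat) (s : R) : 0 <= J k 0 + J k s.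
Proof.
have ci (u : R) : mu.-integrable I (EFin \o (fun th => cos (u * sin th) * cos th ^+ k)).
  by apply: continuous_integrable_itv => th; derive_cont.
rewrite /bessel_int -RintegralD//.
apply: Rintegral_ge0 => th thI; rewrite mul0r cos0 -mulrDl mulr_ge0//; last first.
  by rewrite exprn_ge0// cos_ge0I.
Qed.

Lemma bessel_int0_ge0 (k : nat) : 0 <= J k 0.
Proof. by have := bessel_int_ge0 k 0; lra. Qed.

Lemma ball_volume_ge0 k : 0 <= ball_volume k.
Proof. by elim: k => //= k IH; rewrite mulr_ge0 ?bessel_int0_ge0. Qed.

Local Notation ray u := `]-oo, u]%classic.

Let mray (u : R) : measurable_fun setT (fun v : R => (\1_(ray u) v)%:E : \bar R).
Proof. by apply/measurable_EFinP; exact: measurable_indic. Qed.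

Let ray0 (u v : R) : (0 <= (\1_(ray u) v)%:E :> \bar R)%E.
Proof. by rewrite lee_fin. Qed.

Let rayE (u v : R) : \1_(ray u) v = (v <= u)%R%:R :> R.
Proof. by rewrite indicE mem_setE in_itv. Qed.

Let slices (k : nat) (G : R -> R) (u : R) : continuous G -> 0 <= u ->
  (forall a, 0 <= G a) ->
  (\int[mu]_a ((G a)%:E * (if 0 <= u - a ^+ 2 then
       ball_volume k * Num.sqrt (u - a ^+ 2) ^+ k else 0)%:E) =
  (ball_volume k * (Num.sqrt u ^+ k.+1 *
     \int[mu]_(th in I) (G (Num.sqrt u * sin th) * cos th ^+ k.+1)))%:E)%E.
Proof.
move=> cG u0 G0; set r := Num.sqrt u.
have r0 : 0 <= r by exact: sqrtr_ge0.
have r2 : r ^+ 2 = u by rewrite sqr_sqrtr.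
have cG2 : continuous (fun a => ball_volume k * G a).
  by apply: continuous_funM => //; exact: cst_continuous.
have := integral_circle_slices k r0 cG2.
rewrite r2 => E.
transitivity (\int[mu]_(a in `[(- r)%R, r])
  (ball_volume k * G a * Num.sqrt (u - a ^+ 2) ^+ k)%:E)%E.
  rewrite [RHS]integral_mkcond; apply: eq_integral => a _.
  rewrite patchE mem_setE in_itv/= -ler_norml.
  have -> : (`|a| <= r) = (0 <= u - a ^+ 2).
    by rewrite subr_ge0 -r2 -[in RHS]real_normK ?num_real// ler_pXn2r ?nnegrE.
  by case: ifP => _; rewrite -?EFinM ?mulr0//; congr EFin; ring.
rewrite E; congr EFin; rewrite mulrCA; congr (_ * _).
rewrite -RintegralZl//.
  by apply: eq_Rintegral => th _; rewrite mulrA.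
apply: continuous_integrable_itv; apply: continuous_funM.
  apply: (@continuous_fun_comp _ (fun th => r * sin th) G) => // th.
  by derive_cont.
by move=> th; derive_cont.
Qed.

Lemma lebesgue_Rn_ball (k : nat) (u : R) :
  (\int[lebesgue_Rn R k]_eta (\1_(ray u) (dotp eta eta))%:E =
   (if 0 <= u then ball_volume k * Num.sqrt u ^+ k else 0)%:E)%E.
Proof.
have mf j v : measurable_fun setT (fun eta : Rn R j => (\1_(ray v) (dotp eta eta))%:E : \bar R).
  exact: (measurableT_comp (mray v) (@measurable_dotpp R j)).
elim: k u => [|k IH] u.
  rewrite ge0_integral_lebesgue_Rn0//.
  by rewrite /dotp big_ord0 rayE expr0 /= mulr1; case: ifP.
rewrite ge0_integral_lebesgue_RnS//.
transitivity (\int[mu]_a ((cst 1 a)%:E * (if 0 <= u - a ^+ 2 then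
       ball_volume k * Num.sqrt (u - a ^+ 2) ^+ k else 0)%:E))%E.
  apply: eq_integral => a _; rewrite mul1e -IH; apply: eq_integral => eta _.
  by rewrite dotp_cons !rayE -expr2 lerBrDl.
have [u0|u0] := leP 0 u.
  rewrite slices//; last exact: cst_continuous.
  congr EFin; rewrite /= -mulrA; congr (_ * _); rewrite mulrC; congr (_ * _).
  by apply: eq_Rintegral => th _; rewrite mul0r cos0.
rewrite integral0_eq// => a _; rewrite ifF ?mule0//.
by apply/negbTE; rewrite -ltNge; have := sqr_ge0 a; lra.
Qed.

(** Once x is aligned with an axis, the integrand depends only on the height of the slice, and
    slices of a ball are balls of known volume. *)
Lemma integral_ball_plane_wave (k : nat) (x : Rn R k.+1) (u : R) : 0 <= u ->
  (\int[lebesgue_Rn R k.+1]_xi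
     ((\1_(ray u) (dotp xi xi))%:E * (1 + cos (dotp x xi))%:E) =
  (ball_volume k * (Num.sqrt u ^+ k.+1 *
     (J k.+1 0 + J k.+1 (enorm x * Num.sqrt u))))%:E)%E.
Proof.
move=> u0; pose G s a : R := 1 + cos (s * a).
have G0 s a : 0 <= G s a by rewrite /G; have := cos_geN1 (s * a); lra.
have cG s : continuous (G s) by move=> a; rewrite /G; derive_cont.
have mG : measurable_fun setT (fun a => (1 + cos a)%:E : \bar R).
  apply/measurable_EFinP; apply: continuous_measurable_fun => a.
  by derive_cont.
have G0' a : (0 <= (1 + cos a)%:E :> \bar R)%E.
  by have := G0 1 a; rewrite /G mul1r lee_fin.
rewrite (ge0_integral_plane_wave_Rn _ (mray u) mG (ray0 u) G0').
transitivity (\int[mu]_a ((G (enorm x) a)%:E * (if 0 <= u - a ^+ 2 then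
       ball_volume k * Num.sqrt (u - a ^+ 2) ^+ k else 0)%:E))%E.
  apply: eq_integral => a _; rewrite -lebesgue_Rn_ball muleC -ge0_integralZr//.
  - by apply: eq_integral => eta _; rewrite !rayE lerBrDl.
  - exact: (measurableT_comp (mray _) (@measurable_dotpp R k)).
  - by rewrite lee_fin.
rewrite slices//; congr EFin; congr (_ * (_ * _)).
have ci (v : R) : mu.-integrable I (EFin \o (fun th => cos (v * sin th) * cos th ^+ k.+1)).
  by apply: continuous_integrable_itv => th; derive_cont.
rewrite /bessel_int -RintegralD//; apply: eq_Rintegral => th _.
by rewrite /G mul0r cos0 mulrDl mulrA.
Qed.

(** For s = |x| and r >= 0, this is the derivative in r of the integral of 1 + cos(x.xi) over the
    ball of radius r in R^(k+2), namely of [primitive] below. *)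
Definition polar_density (k : nat) (s r : R) : R :=
  ball_volume k.+1 * (k.+1%:R * r ^+ k.+1 * (J k 0 + J k (s * r))).

Lemma continuous_bessel_int k : continuous (J k).
Proof. by move=> s; exact: is_derive_continuous (derivable_bessel_int k s). Qed.

(** This is the classical rule (z^nu J_nu)' = z^nu J_(nu-1) with nu = k/2 + 1. The derivative of
    [J k.+2] brings in [J k.+4], which the recurrence eliminates. *)
Let is_derive_exprn_bessel (k : nat) (s r : R) :
  is_derive r 1 (fun r => r ^+ k.+2 * J k.+2 (s * r))
    (k.+1%:R * r ^+ k.+1 * J k (s * r)).
Proof.
have dJ : is_derive r 1 (fun r => J k.+2 (s * r))
    (- (s * r / k.+3%:R * J k.+4 (s * r)) * s).
  have ds : is_derive r 1 (fun r => s * r) s by derive; ring.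
  exact: (is_derive1_comp (derivable_bessel_int k.+2 (s * r)) ds).
notypeclasses refine (is_derive_eq (is_derive_funM _ dJ) _); first by derive_rec.
have rec := bessel_int_recurrence k (s * r).
have k3 : k.+3%:R != 0 :> R by rewrite pnatr_eq0.
transitivity (r ^+ k.+1 * (k.+2%:R * J k.+2 (s * r) -
    ((s * r) ^+ 2 * J k.+4 (s * r)) / k.+3%:R)).
  by rewrite /= !exprS; field.
rewrite rec; field.
by rewrite -(natrD _ 3 k) pnatr_eq0.
Qed.

Let primitive (k : nat) (s r : R) : R :=
  ball_volume k.+1 * (r ^+ k.+2 * (J k.+2 0 + J k.+2 (s * r))).

Let dprimitive (k : nat) (s r : R) :
  is_derive r 1 (primitive k s) (polar_density k s r).
Proof.
have d0 := is_derive_exprn_bessel k 0 r.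
have ds := is_derive_exprn_bessel k s r.
have -> : primitive k s = (fun r => ball_volume k.+1 *
    (r ^+ k.+2 * J k.+2 (0 * r) + r ^+ k.+2 * J k.+2 (s * r))).
  by apply/funext => u; rewrite /primitive mulrDr mul0r.
notypeclasses refine (is_derive_eq (is_derive_funM (is_derive_fun_cst _ _)
  (is_derive_funD d0 ds)) _).
by rewrite /polar_density (mul0r r); ring.
Qed.

Lemma continuous_polar_density k s : continuous (polar_density k s).
Proof.
apply: continuous_funM; first exact: cst_continuous.
apply: continuous_funM; first by move=> r; derive_cont.
move=> r; apply: (@continuousD _ _ _ (cst (J k 0)) (fun r => J k (s * r))).
  exact: cst_continuous.
apply: (@continuous_fun_comp _ (fun r => s * r)); last exact: continuous_bessel_int.
by move=> u; derive_cont.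
Qed.

Lemma polar_density_ge0 k s r : 0 <= r -> 0 <= polar_density k s r.
Proof.
move=> r0; apply: mulr_ge0; first exact: ball_volume_ge0.
apply: mulr_ge0; last exact: bessel_int_ge0.
by apply: mulr_ge0 => //; exact: exprn_ge0.
Qed.

(** A half-open interval is a difference of two rays, and finiteness on rays makes the subtraction
    legitimate. Half-open intervals form a pi-system that generates the Borel sets. *)
Lemma measure_eq_rays (m1 m2 : {measure set (measurableTypeR R) -> \bar R}) :
  (forall u, m1 (ray u) = m2 (ray u)) -> (forall u, (m1 (ray u) < +oo)%E) ->
  forall A, measurable A -> m1 A = m2 A.
Proof.
move=> m12 m1oo; have m2oo u : (m2 (ray u) < +oo)%E by rewrite -m12.
have ocE (m : {measure set (measurableTypeR R) -> \bar R}) (a b : R) :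
    (m (ray b) < +oo)%E -> m `]a, b]%classic = (m (ray b) - m (ray b `&` ray a))%E.
  move=> moo; rewrite -measureD//; congr (m _).
  apply/seteqP; split => z /=; rewrite !in_itv/=.
    by move=> /andP[az ->]; split => //; apply/negP; rewrite -ltNge.
  by move=> [-> /negP]; rewrite -ltNge => ->.
refine (@measure_unique _ R (measurableTypeR R) (@ocitv R)
  (fun k => `](- (k%:R : R)), k%:R]%classic) erefl (@ocitvI R) _ _ m1 m2 _ _) => //.
- by move=> i; exact: is_ocitv.
- apply/seteqP; split => // x _; exists (Num.bound `|x|) => //=.
  have := archi_boundP (normr_ge0 x).
  by rewrite in_itv/= ltr_norml => /andP[-> /ltW].
- move=> _ [[a b] _ <-]; rewrite !ocE//= m12; congr (_ - _)%E.
  have [ab|ab] := leP a b.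
    by rewrite setIC (setIidl (subset_itvl _)) ?bnd_simp.
  by rewrite (setIidl (subset_itvl _)) ?bnd_simp// ltW.
- move=> k; apply: (le_lt_trans _ (m1oo k%:R)).
  by rewrite le_measure ?inE//; apply: subset_itvr.
Qed.

(* The weight 1 + cos keeps the integrands nonnegative, so that no integrability
   has to be assumed; at x = 0 it is the constant 2. *)
Lemma ge0_integral_polar (k : nat) (x : Rn R k.+2) (psi : R -> \bar R) :
  measurable_fun setT psi -> (forall r, 0 <= psi r)%E ->
  (\int[lebesgue_Rn R k.+2]_xi (psi (enorm xi) * (1 + cos (dotp x xi))%:E) =
   \int[mu]_r (psi r * (polar_density k (enorm x) r * \1_(`[0%R, +oo[) r)%:E))%E.
Proof.
move=> mpsi psi0.
pose w (xi : Rn R k.+2) : \bar R := (1 + cos (dotp x xi))%:E.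
have w0 xi : (0 <= w xi)%E.
  by rewrite lee_fin; have := cos_geN1 (dotp x xi); lra.
have mcos : measurable_fun setT (fun a => 1 + cos a : R).
  by apply: continuous_measurable_fun => a; derive_cont.
have mw : measurable_fun setT w.
  by apply/measurable_EFinP; exact: (measurableT_comp mcos (measurable_dotp x)).
pose w2 r : \bar R := (polar_density k (enorm x) r * \1_(`[0%R, +oo[) r)%:E.
have w20 r : (0 <= w2 r)%E.
  rewrite lee_fin indicE mem_setE in_itv/= andbT.
  by case: (leP 0 r) => r0; rewrite ?mulr0// mulr1 polar_density_ge0.
have mw2 : measurable_fun setT w2.
  apply/measurable_EFinP; apply: measurable_funM; last exact: measurable_indic.
  by apply: continuous_measurable_fun; exact: continuous_polar_density.
have me : measurable_fun setT (@enorm R k.+2 : Rn R k.+2 -> measurableTypeR R).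
  exact: measurable_enorm.
pose mx := isMeasurableFun.Build _ _ _ _ _ me.
pose en : {mfun Rn R k.+2 >-> measurableTypeR R} := HB.pack (@enorm R k.+2 : Rn R k.+2 -> measurableTypeR R) mx.
(* [nu1] and [nu2] have the same value [primitive k (enorm x) u] on the ray up to u >= 0, the first
   by the integral over a ball, the second by the fundamental theorem of calculus. Hence they agree,
   and any nonnegative measurable [psi] can be integrated against them. *)
pose nu1 := pushforward (density_measure (lebesgue_Rn R k.+2) mw w0) en.
pose nu2 := density_measure mu mw2 w20.
have nu1E (u : R) : nu1 (ray u) = (if 0 <= u then primitive k (enorm x) u else 0)%:E.
  rewrite /nu1 /pushforward /density_measure.
  have [u0|u0] := leP 0 u; last first.
    rewrite (_ : _ @^-1` _ = set0) ?integral_set0//.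
    apply/seteqP; split => // xi /=; rewrite in_itv/=.
    by have := enorm_ge0 xi; rewrite /=; lra.
  transitivity (\int[lebesgue_Rn R k.+2]_xi
     ((\1_(ray (u ^+ 2)) (dotp xi xi))%:E * (1 + cos (dotp x xi))%:E))%E.
    rewrite integral_mkcond; apply: eq_integral => xi _.
    rewrite patchE rayE.
    rewrite [X in if X then _ else _](_ : _ = (dotp xi xi <= u ^+ 2)%R); last first.
      apply/idP/idP; rewrite inE/= in_itv/= -sqr_enorm.
        by move=> h; rewrite ler_pXn2r ?nnegrE ?enorm_ge0.
      by rewrite ler_pXn2r ?nnegrE ?enorm_ge0.
    by case: ifP => _; rewrite ?mul1e ?mul0e.
  rewrite integral_ball_plane_wave ?sqr_ge0// sqrtr_sqr ger0_norm//.
have p0 : primitive k (enorm x) 0 = 0 by rewrite /primitive expr0n/= mul0r mulr0.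
have nu2E (u : R) : nu2 (ray u) = (if 0 <= u then primitive k (enorm x) u else 0)%:E.
  rewrite /nu2 /density_measure.
  transitivity (\int[mu]_(r in `[0%R, u]) (polar_density k (enorm x) r)%:E)%E.
    rewrite integral_mkcond [RHS]integral_mkcond; apply: eq_integral => r _.
    rewrite !patchE /w2 indicE !mem_setE !in_itv/= andbT.
    by case: (leP 0 r) => _; case: (leP r u) => _ /=; rewrite ?mulr1 ?mulr0.
  case: (ltgtP 0 u) => [u0|u0|<-].
  - rewrite (@continuous_FTC2 _ _ (primitive k (enorm x)))//.
    + by rewrite p0 sube0.
    + by apply: continuous_subspaceT; exact: continuous_polar_density.
    + by apply: derivable_oo_LR_is_derive => r; exact: dprimitive.
    + by move=> r _; rewrite (is_derive_derive1 (dprimitive k (enorm x))).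
  - by rewrite set_itv_ge ?integral_set0// bnd_simp -ltNge.
  - by rewrite set_itv1 integral_set1 p0.
have nuE : forall A, measurable A -> nu1 A = nu2 A.
  apply: measure_eq_rays => u; first exact: etrans (nu1E u) (esym (nu2E u)).
  by move: (ltry (if 0 <= u then primitive k (enorm x) u else 0)); rewrite -nu1E.
rewrite -(ge0_integral_density mu mw2 w20)//.
transitivity (\int[nu1]_r psi r)%E; last by apply: eq_measure_integral => A mA _; exact: nuE.
transitivity (\int[density_measure (lebesgue_Rn R k.+2) mw w0]_xi psi (enorm xi))%E.
  rewrite (ge0_integral_density (lebesgue_Rn R k.+2) mw w0)//.
  exact: (measurableT_comp mpsi me).
exact/esym/(@ge0_integral_pushforward _ _ _ _ _ _ me _ setT psi).
Qed.

End balls.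

(** * The Plancherel inequality *)

Section integration_tools.
Context d (T : measurableType d) (R : realType).
Variable m : {measure set T -> \bar R}.

Lemma integrable_bounded_support (A : set T) (f : T -> R) (M : R) : 0 <= M ->
  measurable A -> (m A < +oo)%E -> measurable_fun setT f ->
  (forall x, `|f x| <= M) -> (forall x, ~ A x -> f x = 0) ->
  m.-integrable setT (EFin \o f).
Proof.
move=> M0 mA Aoo mf fM f0; apply/integrableP; split; first exact/measurable_EFinP.
apply: (@le_lt_trans _ _ (\int[m]_x (M * \1_A x)%:E)%E).
  apply: ge0_le_integral => //.
  - apply/measurable_EFinP; exact: measurableT_comp.
  - by apply/measurable_EFinP; apply: measurable_funM => //; exact: measurable_indic.
  - move=> x _; rewrite /= lee_fin indicE; have [xA|xA] := boolP (x \in A).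
      by rewrite mulr1.
    by rewrite notin_setE in xA; rewrite mulr0 f0 ?normr0.
under eq_integral do rewrite EFinM.
rewrite ge0_integralZl//.
- by rewrite integral_indic// setIT lte_mul_pinfty.
- by apply/measurable_EFinP; exact: measurable_indic.
Qed.

Lemma integrable_funZl (a : R) (f : T -> R) : m.-integrable setT (EFin \o f) ->
  m.-integrable setT (EFin \o (fun x => a * f x)).
Proof.
move=> fi; rewrite (_ : _ \o _ = (fun x => a%:E * (f x)%:E)%E)//.
exact: integrableZl.
Qed.

Lemma integrable_funD (f g : T -> R) :
  m.-integrable setT (EFin \o f) -> m.-integrable setT (EFin \o g) ->
  m.-integrable setT (EFin \o (fun x => f x + g x)).
Proof.
move=> fi gi; rewrite (_ : _ \o _ = (fun x => (f x)%:E + (g x)%:E)%E)//.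
exact: integrableD.
Qed.

Lemma ge0_integral_funZl (a : R) (f : T -> R) : 0 <= a -> measurable_fun setT f ->
  (forall x, 0 <= f x) ->
  (\int[m]_x (a * f x)%:E = a%:E * \int[m]_x (f x)%:E)%E.
Proof.
move=> a0 mf f0; under eq_integral do rewrite EFinM.
by apply: ge0_integralZl_EFin => //;
  first [move=> x _; rewrite lee_fin|exact/measurable_EFinP].
Qed.

Lemma EFin_Rintegral (f : T -> R) : m.-integrable setT (EFin \o f) ->
  (\int[m]_x (f x)%:E)%E = (\int[m]_x f x)%:E.
Proof. by move=> fi; rewrite /Rintegral fineK// integrable_fin_num. Qed.

End integration_tools.

(* The library's sigma-finite instance on [m1 \x m2] is shadowed by its
   subprobability instance, hence this alias. *)
Section sigma_finite_product.
Context d1 d2 (T1 : measurableType d1) (T2 : measurableType d2) (R : realType).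
Variables (m1 : {sigma_finite_measure set T1 -> \bar R})
  (m2 : {sigma_finite_measure set T2 -> \bar R}).

Definition sigma_finite_product : set (T1 * T2) -> \bar R := (m1 \x m2)%E.

HB.instance Definition _ := Measure.on sigma_finite_product.

Let sigma_finite_product_sigma_finite : sigma_finite setT sigma_finite_product.
Proof.
have /sigma_finiteP[F [TF ndF Foo]] := sigma_finiteT m1.
have /sigma_finiteP[G [TG ndG Goo]] := sigma_finiteT m2.
exists (fun k => F k `*` G k).
  apply/seteqP; split=> // -[x y] _.
  have [i _ Fi] : (\bigcup_k F k) x by rewrite -TF.
  have [j _ Gj] : (\bigcup_k G k) y by rewrite -TG.
  exists (maxn i j) => //; split.
    by move: Fi; apply: subsetPset; apply: ndF; exact: leq_maxl.
  by move: Gj; apply: subsetPset; apply: ndG; exact: leq_maxr.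
move=> k; have [mF Fk] := Foo k; have [mG Gk] := Goo k; split.
  exact: measurableX.
rewrite /sigma_finite_product product_measure1E//.
by rewrite lte_mul_pinfty// ge0_fin_numE.
Qed.

HB.instance Definition _ := Measure_isSigmaFinite.Build _ _ _ sigma_finite_product
  sigma_finite_product_sigma_finite.

End sigma_finite_product.

Lemma integrable_bounded_support_prod d1 d2 (T1 : measurableType d1)
    (T2 : measurableType d2) (R : realType)
    (m1 : {sigma_finite_measure set T1 -> \bar R})
    (m2 : {sigma_finite_measure set T2 -> \bar R})
    (A : set T1) (B : set T2) (f : T1 * T2 -> R) (M : R) : 0 <= M ->
  measurable A -> measurable B -> (m1 A < +oo)%E -> (m2 B < +oo)%E ->
  measurable_fun setT f -> (forall x, `|f x| <= M) ->
  (forall x, ~ (A `*` B) x -> f x = 0) ->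
  (m1 \x m2)%E.-integrable setT (EFin \o f).
Proof.
move=> M0 mA mB Aoo Boo mf fM f0.
apply: (@integrable_bounded_support _ _ _ (m1 \x m2)%E (A `*` B) _ M) => //.
- exact: measurableX.
- change ((m1 \x m2)%E (A `*` B) < +oo)%E.
  by rewrite product_measure1E// lte_mul_pinfty// ge0_fin_numE.
Qed.

Section parametric.
Context d1 d2 (T1 : measurableType d1) (T2 : measurableType d2) (R : realType).
Variable m2 : {sigma_finite_measure set T2 -> \bar R}.

(** The real integral is [fine] of a difference of integrals of positive and negative parts; each is
    measurable in the parameter by Tonelli, and so are [fine] and the subtraction. *)
Lemma measurable_Rintegral_param (g : T1 * T2 -> R) : measurable_fun setT g ->
  measurable_fun setT (fun x => \int[m2]_y g (x, y)).
Proof.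
move=> mg; rewrite /Rintegral.
apply: (measurableT_comp (fine_measurable measurableT)).
under eq_fun do rewrite integralE.
have mge : measurable_fun setT (EFin \o g) by exact/measurable_EFinP.
apply: emeasurable_funB.
  rewrite (_ : (fun x => _) = fubini_F m2 (EFin \o g)^\+%E); last first.
    by apply/funext => x; apply: eq_integral => y _; rewrite !funeposE.
  by apply: measurable_fun_fubini_tonelli_F => //; exact: measurable_funepos.
rewrite (_ : (fun x => _) = fubini_F m2 (EFin \o g)^\-%E); last first.
  by apply/funext => x; apply: eq_integral => y _; rewrite !funenegE.
by apply: measurable_fun_fubini_tonelli_F => //; exact: measurable_funeneg.
Qed.

End parametric.

(** * Fejer kernels and their integrable majorants *)

Section fejer.
Context (R : realType).
Local Notation mu := (@lebesgue_measure R).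

(** For u <> 0 this equals (1 - cos(S u))/(S u^2). The triangular weight gives decay in u^-2, where
    a sharp cutoff at S would give only sin(S u)/u. *)
Definition fejer (S u : R) : R := \int[mu]_(t in `[0, S]) ((1 - t / S) * cos (t * u)).

Definition tent (S t : R) : R := (1 - t / S) * \1_(`[0, S]%classic) t.

Lemma tent_ge0 S t : 0 < S -> 0 <= tent S t.
Proof.
move=> S0; rewrite /tent indicE mem_setE in_itv/=.
case: (boolP (_ && _)) => [/andP[t0 tS]|_]; last by rewrite mulr0.
by rewrite mulr1 subr_ge0 ler_pdivrMr ?mul1r.
Qed.

Lemma tent_le1 S t : 0 < S -> `|tent S t| <= 1.
Proof.
move=> S0; rewrite ger0_norm ?tent_ge0// /tent indicE mem_setE in_itv/=.
case: (boolP (_ && _)) => [/andP[t0 tS]|_]; last by rewrite mulr0.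
by rewrite mulr1 gerBl divr_ge0// ltW.
Qed.

Lemma measurable_tent S : measurable_fun setT (tent S).
Proof.
apply: measurable_funM; last exact: measurable_indic.
by apply: continuous_measurable_fun => t; derive_cont.
Qed.

Lemma fejer_tent (S u : R) : fejer S u = \int[mu]_t (tent S t * cos (t * u)).
Proof.
rewrite /fejer Rintegral_mkcond; apply: eq_Rintegral => t _.
rewrite patchE /tent indicE; case: ifP => _; first by rewrite mulr1.
by rewrite mulr0 mul0r.
Qed.

Let cont_integrand (S u : R) : continuous (fun t : R => (1 - t / S) * cos (t * u)).
Proof. by move=> t; derive_cont. Qed.

(** The kernel is at most S trivially and at most 2/(S u^2) by its closed form; adding the two
    bounds after clearing denominators gives the constant 3. *)
Lemma fejer_bound (S u : R) : 0 < S ->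
  `|fejer S u| <= 3 * S / (1 + S ^+ 2 * u ^+ 2).
Proof.
move=> S0; have SN0 : S != 0 by rewrite gt_eqF.
have b1 : `|fejer S u| <= S.
  apply: (@le_trans _ _ (\int[mu]_(t in `[0, S]) `|(1 - t / S) * cos (t * u)|)).
    apply: le_normr_Rintegral => //.
    by apply: continuous_integrable_itv; exact: cont_integrand.
  apply: (@le_trans _ _ (\int[mu]_(t in `[0, S]) (cst 1 t))).
    apply: le_Rintegral => //.
    - have := continuous_integrable_itv 0 S (@cont_integrand S u).
      by move/integrable_norm.
    - by apply: continuous_integrable_itv; exact: cst_continuous.
    - move=> t /=; rewrite in_itv/= => /andP[t0 tS].
      rewrite normrM mulr_ile1//; last by rewrite ler_norml cos_geN1 cos_le1.
      rewrite ger0_norm; first by rewrite gerBl divr_ge0// ltW.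
      by rewrite subr_ge0 ler_pdivrMr ?mul1r.
  by rewrite Rintegral_cst//= lebesgue_measure_itv/= lte_fin S0/= mul1r subr0.
have b2 : `|fejer S u| * (S * u ^+ 2) <= 2.
  have [->|u0] := eqVneq u 0; first by rewrite expr0n/= !mulr0.
  pose F t := (1 - t / S) * (sin (t * u) / u) - cos (t * u) / (S * u ^+ 2).
  have dF (t : R) : is_derive t 1 F ((1 - t / S) * cos (t * u)).
    by rewrite /F; derive; field; rewrite SN0 u0.
  rewrite /fejer (Rintegral_is_derive S0 dF (@cont_integrand S u)) /F.
  rewrite divff// !mul0r sin0 cos0 mul0r mulr0 !sub0r subrr mul0r sub0r opprK.
  have Su : 0 < S * u ^+ 2 by rewrite mulr_gt0// exprn_even_gt0.
  have -> : - (cos (S * u) / (S * u ^+ 2)) + 1 / (S * u ^+ 2) =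
      (1 - cos (S * u)) / (S * u ^+ 2) by field; rewrite SN0 u0.
  rewrite normrM normfV (gtr0_norm Su) mulfVK ?gt_eqF//.
  rewrite ler_norml; have := cos_geN1 (S * u); have := cos_le1 (S * u); lra.
have p : 0 < 1 + S ^+ 2 * u ^+ 2.
  by rewrite ltr_pwDl// mulr_ge0// sqr_ge0.
rewrite ler_pdivlMr// mulrDr mulr1.
have -> : `|fejer S u| * (S ^+ 2 * u ^+ 2) = S * (`|fejer S u| * (S * u ^+ 2)) by ring.
have := ler_wpM2l (ltW S0) b2; lra.
Qed.

Definition fejer_dominant (S u : R) : R := 3 * S / (1 + S ^+ 2 * u ^+ 2).

Let dom_gt0 S u : 0 < 1 + S ^+ 2 * u ^+ 2 :> R.
Proof. by rewrite ltr_pwDl// mulr_ge0// sqr_ge0. Qed.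

Lemma fejer_dominant_ge0 S u : 0 < S -> 0 <= fejer_dominant S u.
Proof.
by move=> S0; rewrite /fejer_dominant !mulr_ge0 ?ltW ?invr_gt0.
Qed.

Lemma continuous_fejer_dominant S : continuous (fejer_dominant S).
Proof.
move=> u; rewrite /fejer_dominant; derive_cont.
by rewrite gt_eqF.
Qed.

(** The majorant is the derivative of an arctangent, so the bound does not depend on S. This
    uniformity is what allows the cutoff in t to be removed. *)
Lemma integral_fejer_dominant (S r : R) : 0 < S ->
  (\int[mu]_(s in `[1%R, 2%R]) (fejer_dominant S (r - s))%:E <= (3 * pi)%:E)%E.
Proof.
move=> S0.
pose F s := - (3 * atan (S * (r - s))).
have dF (s : R) : is_derive s 1 F (fejer_dominant S (r - s)).
  rewrite /F; derive; rewrite /fejer_dominant exprMn; field.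
  by rewrite exprMn gt_eqF.
have cf : continuous (fun s => fejer_dominant S (r - s)).
  apply: (@continuous_fun_comp _ (fun s => r - s)) => [s|]; first by derive_cont.
  exact: continuous_fejer_dominant.
have lt12 : (1 < 2 :> R) by lra.
rewrite (@continuous_FTC2 _ _ F)//.
- rewrite -EFinB lee_fin /F.
  have := atan_ltpi2 (S * (r - 1)); have := atan_gtNpi2 (S * (r - 2)); lra.
- exact: continuous_subspaceT.
- exact: derivable_oo_LR_is_derive dF.
- by move=> s _; rewrite (is_derive_derive1 dF).
Qed.

Lemma ge0_integral_even_le (G : R -> R) (B : \bar R) : measurable_fun setT G ->
  (forall t, 0 <= G t) -> (forall t, G (- t) = G t) ->
  (forall n : nat, \int[mu]_(t in `[0%R, n%:R]) (G t)%:E <= B)%E ->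
  (\int[mu]_t (G t)%:E <= B + B)%E.
Proof.
move=> mG G0 evG GB.
have pos : (\int[mu]_(t in `[0%R, +oo[) (G t)%:E <= B)%E.
  have cv := ge0_cvgn_integral (mu := mu) G0 mG.
  rewrite -(cvg_lim _ cv)//; apply: lime_le; first by apply/cvg_ex; eexists; exact: cv.
  exact: nearW.
have neg : (\int[mu]_(t in `]-oo, 0%R]) (G t)%:E <= B)%E.
  apply: le_trans pos.
  rewrite [leLHS](_ : _ = (\int[mu]_(t in `]-oo, 0%R]) (G (- t))%:E)%E); last first.
    by apply: eq_integral => t _; rewrite evG.
  rewrite -(ge0_integration_by_substitution0 (f := EFin \o G))//.
  exact/measurable_EFinP.
have -> : [set: R] = `]-oo, 0] `|` `]0, +oo[.
  by apply/seteqP; split => // t _ /=; rewrite !in_itv/= andbT; case: (leP t 0); [left|right].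
rewrite ge0_integral_setU//=; last 3 first.
- by apply/measurable_EFinP/measurable_funTS.
- by move=> t _; rewrite lee_fin.
- apply/disj_setPS => t /= []; rewrite !in_itv/= andbT => t0 t1.
  by move: t1; rewrite ltNge t0.
apply: leeD => //; apply: le_trans pos; apply: ge0_subset_integral => //.
- by apply/measurable_EFinP/measurable_funTS.
- by move=> t _; rewrite lee_fin.
- by move=> t /=; rewrite !in_itv/= !andbT => /ltW.
Qed.

End fejer.

(** * The L^2 bound for cosine and sine transforms *)

Section plancherel.
Context (R : realType).
Local Notation mu := (@lebesgue_measure R).
Local Notation RR := (measurableTypeR R).
Local Notation D := (`[1, (2 : R)]%classic).

Definition real_fourier (k : R -> R -> R) (h : R -> R) (t : R) : R :=
  \int[mu]_r (h r * k t r).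

Definition cos_kernel (t r : R) : R := cos (t * r).
Definition sin_kernel (t r : R) : R := sin (t * r).

Let mD : measurable (D : set (measurableTypeR R)). Proof. exact: measurable_itv. Qed.

Let muD : (mu D < +oo)%E.
Proof. by rewrite lebesgue_measure_itv/= lte_fin ltr1n -EFinB ltry. Qed.

Lemma measurable_cosR : measurable_fun setT (cos : R -> R).
Proof. by apply: continuous_measurable_fun; exact: continuous_cos. Qed.

Lemma measurable_sinR : measurable_fun setT (sin : R -> R).
Proof. by apply: continuous_measurable_fun; exact: continuous_sin. Qed.

Lemma measurable_cos_kernel : measurable_fun setT (fun z : RR * RR => cos_kernel z.1 z.2).
Proof. by apply: (measurableT_comp measurable_cosR); exact: measurable_funM. Qed.

Lemma measurable_sin_kernel : measurable_fun setT (fun z : RR * RR => sin_kernel z.1 z.2).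
Proof. by apply: (measurableT_comp measurable_sinR); exact: measurable_funM. Qed.

Variables (h : R -> R) (M : R).
Hypotheses (mh : measurable_fun setT h) (hM : forall r, `|h r| <= M)
  (hD : forall r, ~ D r -> h r = 0).

Let M0 : 0 <= M. Proof. by apply: le_trans (hM 0). Qed.

Let C := real_fourier cos_kernel h.
Let S := real_fourier sin_kernel h.

Let le_eq (a b : \bar R) : a = b -> (a <= b)%E.
Proof. by move=> ->. Qed.

Let cosb (u : R) : `|cos u| <= 1.
Proof. by rewrite ler_norml cos_geN1 cos_le1. Qed.

Let mc t : measurable_fun setT (fun r : R => cos (t * r)).
Proof. by apply: (measurableT_comp measurable_cosR); exact: measurable_funM. Qed.

Let ms t : measurable_fun setT (fun r : R => sin (t * r)).
Proof. by apply: (measurableT_comp measurable_sinR); exact: measurable_funM. Qed.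

Let ih (g : R -> R) (N : R) : measurable_fun setT g -> (forall r, `|g r| <= N) ->
  mu.-integrable setT (EFin \o (fun r => h r * g r)).
Proof.
move=> mg gN; have N0 : 0 <= N by apply: le_trans (gN 0).
apply: (@integrable_bounded_support _ RR _ mu D _ (M * N)) => //.
- exact: mulr_ge0.
- exact: measurable_funM.
- by move=> r; rewrite normrM ler_pM.
- by move=> r nr; rewrite hD// mul0r.
Qed.

Let ic t : mu.-integrable setT (EFin \o (fun r => h r * cos (t * r))).
Proof. by apply: (ih (N := 1)) => // r; rewrite ler_norml cos_geN1 cos_le1. Qed.

Let is_ t : mu.-integrable setT (EFin \o (fun r => h r * sin (t * r))).
Proof. by apply: (ih (N := 1)) => // r; rewrite ler_norml sin_geN1 sin_le1. Qed.

Let DD : set (RR * RR) := D `*` D.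

Let mDD : measurable DD. Proof. exact: measurableX. Qed.

Let muDD : ((mu \x mu)%E DD < +oo)%E.
Proof. by rewrite product_measure1E// lte_mul_pinfty// ge0_fin_numE. Qed.

Let mhh : measurable_fun setT (fun z : RR * RR => h z.1 * h z.2).
Proof.
by apply: measurable_funM; exact: (measurableT_comp mh).
Qed.

Let ihh (g : RR * RR -> R) (N : R) : measurable_fun setT g -> (forall z, `|g z| <= N) ->
  (mu \x mu)%E.-integrable setT (EFin \o (fun z => h z.1 * h z.2 * g z)).
Proof.
move=> mg gN; have N0 : 0 <= N by apply: le_trans (gN (0, 0)).
apply: (@integrable_bounded_support _ (RR * RR)%type _ (mu \x mu)%E DD _ (M * M * N)) => //.
- by rewrite !mulr_ge0.
- exact: measurable_funM.
- by move=> z; rewrite !normrM ler_pM ?mulr_ge0 ?ler_pM.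
- move=> z nz; have [z1|z1] := pselect (D z.1).
    by rewrite [h z.2]hD ?mulr0 ?mul0r// => z2; exact: nz.
  by rewrite hD ?mul0r.
Qed.

Let mcosdiff (t : R) : measurable_fun setT (fun z : RR * RR => cos (t * (z.1 - z.2))).
Proof.
apply: (measurableT_comp measurable_cosR); apply: measurable_funM => //.
exact: measurable_funB.
Qed.

(** The left side is the squared modulus of the integral of h(r) exp(i t r), written as a double
    integral with the formula for cos(t r - t s). *)
Let square_fourier (t : R) : (C t ^+ 2 + S t ^+ 2)%:E =
  (\int[(mu \x mu)%E]_z (h z.1 * h z.2 * cos (t * (z.1 - z.2)))%:E)%E.
Proof.
have i := @ihh _ 1 (mcosdiff t) (fun z => cosb _).
rewrite -(integral12_prod_meas1 i).
transitivity (\int[mu]_r (C t * (h r * cos (t * r)) + S t * (h r * sin (t * r)))%:E)%E.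
  rewrite EFin_Rintegral; last by apply: integrable_funD; exact: integrable_funZl.
  congr EFin; rewrite RintegralD//; last 2 first.
  - exact: integrable_funZl.
  - exact: integrable_funZl.
  by rewrite !RintegralZl// -!expr2.
apply: eq_integral => r _; rewrite /fubini_F.
transitivity (\int[mu]_s (h r * cos (t * r) * (h s * cos (t * s)) +
    h r * sin (t * r) * (h s * sin (t * s)))%:E)%E; last first.
  by apply: eq_integral => s _; rewrite /= mulrBr cosB; congr EFin; ring.
rewrite EFin_Rintegral; last by apply: integrable_funD; exact: integrable_funZl.
congr EFin; rewrite RintegralD//; last 2 first.
- exact: integrable_funZl.
- exact: integrable_funZl.
by rewrite !RintegralZl// mulrC (mulrC (S t)).
Qed.

Let measurable_C : measurable_fun setT C.
Proof.
apply: (@measurable_Rintegral_param _ _ _ _ _ mu (fun z => h z.2 * cos_kernel z.1 z.2)).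
by apply: measurable_funM; [exact: (measurableT_comp mh)|exact: measurable_cos_kernel].
Qed.

Let measurable_S : measurable_fun setT S.
Proof.
apply: (@measurable_Rintegral_param _ _ _ _ _ mu (fun z => h z.2 * sin_kernel z.1 z.2)).
by apply: measurable_funM; [exact: (measurableT_comp mh)|exact: measurable_sin_kernel].
Qed.

Let tent_fourier (L : R) : 0 < L ->
  (\int[mu]_t (tent L t * (C t ^+ 2 + S t ^+ 2))%:E =
  \int[(mu \x mu)%E]_z (h z.1 * h z.2 * fejer L (z.1 - z.2))%:E)%E.
Proof.
move=> L0.
pose G (y : RR * (RR * RR)) : R :=
  tent L y.1 * (h y.2.1 * h y.2.2 * cos (y.1 * (y.2.1 - y.2.2))).
have mG : measurable_fun setT G.
  have m21 : measurable_fun setT (fun y : RR * (RR * RR) => y.2.1).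
    exact: (measurableT_comp measurable_fst measurable_snd).
  have m22 : measurable_fun setT (fun y : RR * (RR * RR) => y.2.2).
    exact: (measurableT_comp measurable_snd measurable_snd).
  apply: measurable_funM.
    exact: (measurableT_comp (measurable_tent L) measurable_fst).
  apply: measurable_funM.
    exact: (measurableT_comp mhh measurable_snd).
  apply: (measurableT_comp measurable_cosR); apply: measurable_funM => //.
  exact: measurable_funB.
have mu0L : (mu `[0%R, L]%classic < +oo)%E.
  by rewrite lebesgue_measure_itv/= lte_fin L0 -EFinB ltry.
pose mu2 : {sigma_finite_measure set (RR * RR)%type -> \bar R} :=
  sigma_finite_product mu mu.
have iG : (mu \x mu2)%E.-integrable setT (EFin \o G).
  apply: (@integrable_bounded_support_prod _ _ RR (RR * RR)%type R mu mu2
    `[0, L]%classic DD _ (M * M)) => //.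
  - exact: mulr_ge0.
  - move=> y; rewrite /G; move: (tent_le1 y.1 L0); move: (tent L y.1) => v v1.
    rewrite !normrM -[leRHS]mul1r; apply: ler_pM => //.
    by rewrite -[leRHS]mulr1; apply: ler_pM => //; exact: ler_pM.
  - move=> y ny; rewrite /G; have [y1|y1] := pselect (`[0, L]%classic y.1); last first.
      by rewrite /tent indicE memNset ?mulr0 ?mul0r.
    have [z1|z1] := pselect (D y.2.1).
      by rewrite [h y.2.2]hD ?mulr0 ?mul0r ?mulr0// => z2; exact: ny.
    by rewrite hD ?mul0r ?mulr0.
have ihc t : (mu \x mu)%E.-integrable setT
    (EFin \o (fun z : RR * RR => h z.1 * h z.2 * cos (t * (z.1 - z.2)))).
  by apply: (@ihh _ 1 (mcosdiff t)) => z; rewrite ler_norml cos_geN1 cos_le1.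
transitivity (\int[mu]_t \int[mu2]_z (G (t, z))%:E)%E.
  apply: eq_integral => t _; rewrite EFinM square_fourier.
  by apply: etrans (esym (integralZl _ (ihc t) _)) _.
apply: etrans (Fubini iG) _; apply: eq_integral => z _ /=.
have itc : mu.-integrable setT (EFin \o (fun t => tent L t * cos (t * (z.1 - z.2)))).
  apply: (@integrable_bounded_support _ RR _ mu `[0, L]%classic _ 1) => //.
  - apply: measurable_funM; first exact: measurable_tent.
    by apply: (measurableT_comp measurable_cosR); exact: measurable_funM.
  - by move=> t; rewrite normrM mulr_ile1 ?tent_le1.
  - by move=> t nt; rewrite /tent indicE memNset ?mulr0 ?mul0r.
rewrite fejer_tent EFinM -EFin_Rintegral// -integralZl//.
by apply: eq_integral => t _; rewrite -EFinM; congr EFin; rewrite /G/=; ring.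
Qed.

Let sqr_h_integrable : mu.-integrable setT (EFin \o (fun r => h r ^+ 2)).
Proof. by apply: (ih (N := M)). Qed.

(** Schur's test: |h(r) h(s)| is at most (h(r)^2 + h(s)^2)/2, and the majorant of the Fejer kernel
    has integral at most 3 pi over [1, 2] in either variable, the other being fixed. *)
Let tent_fourier_le (L : R) : 0 < L ->
  (\int[mu]_t (tent L t * (C t ^+ 2 + S t ^+ 2))%:E <=
   (3 * pi)%:E * \int[mu]_r (h r ^+ 2)%:E)%E.
Proof.
move=> L0; rewrite tent_fourier//.
pose g1 (z : RR * RR) := h z.1 ^+ 2 * (\1_D z.2 * fejer_dominant L (z.1 - z.2)).
pose g2 (z : RR * RR) := h z.2 ^+ 2 * (\1_D z.1 * fejer_dominant L (z.1 - z.2)).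
have mdiff : measurable_fun setT (fun z : RR * RR => z.1 - z.2).
  exact: measurable_funB.
have mdom : measurable_fun setT (fun z : RR * RR => fejer_dominant L (z.1 - z.2)).
  apply: (measurableT_comp _ mdiff).
  by apply: continuous_measurable_fun; exact: continuous_fejer_dominant.
have m1D : measurable_fun setT (\1_D : R -> R) by exact: measurable_indic.
have mg1 : measurable_fun setT g1.
  apply: measurable_funM.
    by apply: measurable_funX; exact: (measurableT_comp mh).
  by apply: measurable_funM => //; exact: (measurableT_comp m1D).
have mg2 : measurable_fun setT g2.
  apply: measurable_funM.
    by apply: measurable_funX; exact: (measurableT_comp mh).
  by apply: measurable_funM => //; exact: (measurableT_comp m1D).
have dom0 u : 0 <= fejer_dominant L u by exact: fejer_dominant_ge0.
have g10 z : 0 <= g1 z by rewrite /g1 mulr_ge0 ?sqr_ge0// mulr_ge0.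
have g20 z : 0 <= g2 z by rewrite /g2 mulr_ge0 ?sqr_ge0// mulr_ge0.
have mdomr (r : R) : measurable_fun setT (fun s : R => fejer_dominant L (r - s)).
  apply: continuous_measurable_fun.
  apply: (@continuous_fun_comp _ (fun s => r - s)) => [s|]; first by derive_cont.
  exact: continuous_fejer_dominant.
have inner (r : R) : (\int[mu]_s (\1_D s * fejer_dominant L (r - s))%:E <= (3 * pi)%:E)%E.
  apply: le_trans (integral_fejer_dominant r L0).
  rewrite [leRHS]integral_mkcond; apply: le_eq; apply: eq_integral => s _.
  by rewrite patchE indicE; case: ifP => _; rewrite ?mul1r ?mul0r.
have sym u : fejer_dominant L (- u) = fejer_dominant L u.
  by rewrite /fejer_dominant sqrrN.
have mhr : measurable_fun setT (fun r => (h r ^+ 2)%:E : \bar R).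
  by apply/measurable_EFinP; exact: measurable_funX.
have h2_ge0 (r : R) : (0 <= (h r ^+ 2)%:E :> \bar R)%E by rewrite lee_fin sqr_ge0.
have pi3 : 0 <= 3 * (pi : R) by rewrite mulr_ge0// pi_ge0.
have mfej : measurable_fun setT (fun z : RR * RR => fejer L (z.1 - z.2)).
  apply: (measurableT_comp (f := fejer L) _ mdiff).
  rewrite (_ : fejer L = fun u => \int[mu]_t (tent L t * cos (t * u))); last first.
    by apply/funext => u; exact: fejer_tent.
  apply: (@measurable_Rintegral_param _ _ _ _ _ mu (fun z : RR * RR => tent L z.2 * cos (z.2 * z.1))).
  apply: measurable_funM; first exact: (measurableT_comp (measurable_tent L)).
  by apply: (measurableT_comp measurable_cosR); exact: measurable_funM.
have outer (f : R -> R -> R) : (forall r s, 0 <= f r s) ->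
    (forall r, measurable_fun setT (f r)) ->
    measurable_fun setT (fun r : R => \int[mu]_s (f r s)%:E)%E ->
    (forall r, \int[mu]_s (f r s)%:E <= (3 * pi)%:E)%E ->
    (\int[mu]_r \int[mu]_s (h r ^+ 2 * f r s)%:E <=
     (3 * pi)%:E * \int[mu]_r (h r ^+ 2)%:E)%E.
  move=> f0 mf mif fle.
  rewrite -ge0_integralZl//.
  apply: ge0_le_integral => //.
  - by move=> r _; apply: integral_ge0 => s _; rewrite lee_fin mulr_ge0 ?sqr_ge0.
  - rewrite (_ : (fun r => _) = (fun r => (h r ^+ 2)%:E * \int[mu]_s (f r s)%:E)%E).
      by apply: emeasurable_funM.
    by apply/funext => r; apply: ge0_integral_funZl; [exact: sqr_ge0|exact: mf|exact: f0].
  - exact: measurable_funeM.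
  - move=> r _; rewrite (ge0_integral_funZl mu (sqr_ge0 (h r)) (mf r) (f0 r)).
    by rewrite muleC lee_wpmul2r.
have b1 : (\int[(mu \x mu)%E]_z (g1 z)%:E <= (3 * pi)%:E * \int[mu]_r (h r ^+ 2)%:E)%E.
  rewrite (fubini_tonelli1 (fun z : RR * RR => (g1 z)%:E))//; last first.
  - exact/measurable_EFinP.
  - apply: outer => //.
    + by move=> r s; rewrite mulr_ge0.
    + by move=> r; exact: (measurable_funM m1D (mdomr r)).
    + apply: (@measurable_fun_fubini_tonelli_F _ _ _ _ _ mu
        (fun z : RR * RR => (\1_D z.2 * fejer_dominant L (z.1 - z.2))%:E)).
        apply/measurable_EFinP; apply: measurable_funM => //.
        exact: (measurableT_comp m1D).
      by move=> z; rewrite lee_fin mulr_ge0.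
have b2 : (\int[(mu \x mu)%E]_z (g2 z)%:E <= (3 * pi)%:E * \int[mu]_r (h r ^+ 2)%:E)%E.
  rewrite (fubini_tonelli2 (fun z : RR * RR => (g2 z)%:E))//; last first.
  - exact/measurable_EFinP.
  - apply: (@outer (fun r s => \1_D s * fejer_dominant L (s - r))) => //.
    + by move=> r s; rewrite mulr_ge0.
    + move=> r; apply: measurable_funM => //.
      rewrite (_ : (fun s => _) = fun s => fejer_dominant L (r - s)) ?mdomr//.
      by apply/funext => s; rewrite -opprB sym.
    + apply: (@measurable_fun_fubini_tonelli_F _ _ _ _ _ mu
        (fun z : RR * RR => (\1_D z.2 * fejer_dominant L (z.2 - z.1))%:E)).
        apply/measurable_EFinP; apply: measurable_funM => //.
          exact: (measurableT_comp m1D).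
        rewrite (_ : (fun x : RR * RR => _) = fun z => fejer_dominant L (z.1 - z.2)) ?mdom//.
        by apply/funext => z; rewrite -opprB sym.
      by move=> z; rewrite lee_fin mulr_ge0.
    + move=> r; apply: le_trans (inner r); apply: le_eq; apply: eq_integral => s _.
      by rewrite -opprB sym.
apply: (@le_trans _ _ (\int[(mu \x mu)%E]_z (2^-1 * (g1 z + g2 z))%:E)%E).
  apply: (@le_trans _ _ (\int[(mu \x mu)%E]_z `|(h z.1 * h z.2 * fejer L (z.1 - z.2))%:E|)%E).
    apply: (le_trans (lee_abs _)); apply: le_abse_integral => //.
    by apply/measurable_EFinP; exact: measurable_funM.
  apply: ge0_le_integral => //.
  - by apply: measurableT_comp => //; apply/measurable_EFinP; exact: measurable_funM.
  - apply/measurable_EFinP; apply: measurable_funM => //; exact: measurable_funD.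
  - move=> z _; rewrite lee_fin !normrM.
    have fb := fejer_bound (z.1 - z.2) L0.
    rewrite -/(fejer_dominant _ _) in fb.
    have [D1|D1] := pselect (D z.1); last first.
      by rewrite hD// normr0 !mul0r mulr_ge0// addr_ge0.
    have [D2|D2] := pselect (D z.2); last first.
      by rewrite [h z.2]hD// normr0 mulr0 !mul0r mulr_ge0// addr_ge0.
    rewrite /g1 /g2 !indicE !mem_set// !mul1r -mulrDl mulrA.
    apply: ler_pM => //.
    rewrite -(real_normK (num_real (h z.1))) -(real_normK (num_real (h z.2))).
    have := sqr_ge0 (`|h z.1| - `|h z.2|); nra.
rewrite ge0_integral_funZl//; last 2 first.
- exact: measurable_funD.
- by move=> z; rewrite addr_ge0.
under eq_integral do rewrite EFinD.
rewrite ge0_integralD//; last 4 first.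
- by move=> z _; rewrite lee_fin.
- exact/measurable_EFinP.
- by move=> z _; rewrite lee_fin.
- exact/measurable_EFinP.
set X := (_ * _)%E in b1 b2 *.
apply: (@le_trans _ _ ((2^-1)%:E * (X + X))%E).
  by rewrite lee_wpmul2l ?lee_fin// leeD.
have -> : X = (3 * pi * \int[mu]_r (h r ^+ 2))%:E by rewrite /X EFin_Rintegral.
by rewrite -EFinD -EFinM lee_fin; lra.
Qed.

Let fourier_cosN t : C (- t) = C t.
Proof. by apply: eq_Rintegral => r _; rewrite /cos_kernel mulNr cosN. Qed.

Let fourier_sinN t : S (- t) = - S t.
Proof.
rewrite -[RHS]mulN1r -[in RHS](RintegralZl _ _ (is_ t))//.
by apply: eq_Rintegral => r _; rewrite /sin_kernel mulNr sinN; ring.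
Qed.

Let fourier_le (G : R -> R) : measurable_fun setT G -> (forall t, 0 <= G t) ->
  (forall t, G (- t) = G t) -> (forall t, G t <= C t ^+ 2 + S t ^+ 2) ->
  (\int[mu]_t (G t)%:E <= (12 * pi)%:E * \int[mu]_r (h r ^+ 2)%:E)%E.
Proof.
move=> mG G0 evG GCS.
have -> : ((12 * pi)%:E * \int[mu]_r (h r ^+ 2)%:E =
  (6 * pi)%:E * \int[mu]_r (h r ^+ 2)%:E + (6 * pi)%:E * \int[mu]_r (h r ^+ 2)%:E)%E.
  by rewrite EFin_Rintegral// -!EFinM -EFinD; congr EFin; ring.
apply: ge0_integral_even_le => // n.
(* With L >= 2n the tent is at least 1/2 on [0, n], which turns 3 pi into 6 pi on the half-line;
   evenness then gives 12 pi on the line. *)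
pose L : R := 2 * n.+1%:R.
have L0 : 0 < L by rewrite /L mulr_gt0.
have -> : ((6 * pi)%:E * \int[mu]_r (h r ^+ 2)%:E =
  2%:E * ((3 * pi)%:E * \int[mu]_r (h r ^+ 2)%:E))%E.
  by rewrite EFin_Rintegral// -!EFinM; congr EFin; ring.
apply: (@le_trans _ _ (2%:E * \int[mu]_t (tent L t * (C t ^+ 2 + S t ^+ 2))%:E)%E); last first.
  by rewrite lee_wpmul2l ?lee_fin// tent_fourier_le.
have mT : measurable_fun setT (fun t => tent L t * (C t ^+ 2 + S t ^+ 2)).
  apply: measurable_funM; first exact: measurable_tent.
  by apply: measurable_funD; exact: measurable_funX.
have T0 t : 0 <= tent L t * (C t ^+ 2 + S t ^+ 2).
  by rewrite mulr_ge0 ?tent_ge0// addr_ge0 ?sqr_ge0.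
rewrite -ge0_integral_funZl//.
rewrite [leLHS]integral_mkcond; apply: ge0_le_integral => //.
- by move=> t _; apply: erestrict_ge0 => ? _; rewrite lee_fin.
- by apply/(measurable_restrictT (EFin \o G)) => //; apply/measurable_EFinP/measurable_funTS.
- by apply/measurable_EFinP; exact: measurable_funM.
move=> t _; rewrite patchE mem_setE in_itv/=; case: ifPn => [/andP[t0 tn]|_]; last first.
  by rewrite lee_fin mulr_ge0.
rewrite lee_fin (le_trans (GCS t))// mulrA.
have nL : n%:R <= L / 2.
  by rewrite /L mulrAC divff// mul1r ler_nat.
have t2 : t <= L / 2 by exact: le_trans nL.
have tt : 2^-1 <= tent L t.
  rewrite /tent indicE mem_set ?mulr1; last by rewrite /= in_itv/= t0/=; lra.
  have : t / L <= 2^-1 by rewrite ler_pdivrMr// mulrC.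
  lra.
by rewrite ler_peMl ?addr_ge0 ?sqr_ge0//; lra.
Qed.

Lemma plancherel_cos :
  (\int[mu]_t (real_fourier cos_kernel h t ^+ 2)%:E <=
   (12 * pi)%:E * \int[mu]_r (h r ^+ 2)%:E)%E.
Proof.
apply: fourier_le.
- exact: measurable_funX.
- by move=> t; exact: sqr_ge0.
- by move=> t; rewrite -/C fourier_cosN.
- by move=> t; rewrite lerDl sqr_ge0.
Qed.

Lemma plancherel_sin :
  (\int[mu]_t (real_fourier sin_kernel h t ^+ 2)%:E <=
   (12 * pi)%:E * \int[mu]_r (h r ^+ 2)%:E)%E.
Proof.
apply: fourier_le.
- exact: measurable_funX.
- by move=> t; exact: sqr_ge0.
- by move=> t; rewrite -/S fourier_sinN sqrrN.
- by move=> t; rewrite lerDr sqr_ge0.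
Qed.

End plancherel.

(** * Interpolation *)

Section marcinkiewicz.
Context (R : realType).
Local Notation mu := (@lebesgue_measure R).
Local Notation RR := (measurableTypeR R).
Local Notation D := (`[1, (2 : R)]%classic).

Lemma integral_expR_tail (a c : R) : 0 < a ->
  (\int[mu]_(y in `[c, +oo[) (a * expR (- (a * y)))%:E = (expR (- (a * c)))%:E)%E.
Proof.
move=> a0.
have dF (y : R) : is_derive y 1 (fun y => - expR (- (a * y))) (a * expR (- (a * y))).
  by derive; ring.
rewrite (@ge0_continuous_FTC2y _ _ (fun y => - expR (- (a * y))) c 0).
- by rewrite -EFinB sub0r opprK.
- by move=> y _; rewrite mulr_ge0 ?expR_ge0 ?(ltW a0).
- by apply: continuous_subspaceT => y; derive_cont.
- rewrite -oppr0; apply: cvgN.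
  apply: (@cvg_comp _ _ _ (fun y => a * y) (fun y => expR (- y)) _ (+oo%R : set_system R)).
    exact: gt0_cvgMry.
  exact: cvgr_expR.
- by move=> y _; apply: ex_derive; exact: dF.
- apply: cvg_at_right_filter; exact: (is_derive_continuous (dF c)).
- by move=> y _; rewrite (is_derive_derive1 dF).
Qed.

(** The kernel stays abstract so that one interpolation argument serves the cosine and the sine:
    [k1] carries the L^1-L^oo bound and [k2] the L^2 bound. *)
Variables (k : R -> R -> R) (K : R).
Hypotheses (mk : measurable_fun setT (fun z : RR * RR => k z.1 z.2))
  (k1 : forall t r, `|k t r| <= 1) (K0 : 0 <= K)
  (k2 : forall (h : R -> R) M, measurable_fun setT h -> (forall r, `|h r| <= M) ->
    (forall r, ~ D r -> h r = 0) ->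
    (\int[mu]_t (real_fourier k h t ^+ 2)%:E <= K%:E * \int[mu]_r (h r ^+ 2)%:E)%E).

Let muD : (mu D < +oo)%E.
Proof. by rewrite lebesgue_measure_itv/= lte_fin ltr1n -EFinB ltry. Qed.

Let mkt t : measurable_fun setT (k t).
Proof.
exact: (measurable_comp measurableT (@subsetT _ _) mk (measurable_pair1 t)).
Qed.

Lemma measurable_real_fourier (h : R -> R) : measurable_fun setT h ->
  measurable_fun setT (real_fourier k h).
Proof.
move=> mh; apply: (@measurable_Rintegral_param _ _ RR RR _ mu (fun z => h z.2 * k z.1 z.2)).
by apply: measurable_funM => //; exact: (measurableT_comp mh).
Qed.

Section level_truncation.
Variables (q B : R) (h : R -> R).
Hypotheses (q2 : 2 < q) (B0 : 0 < B) (mh : measurable_fun setT h)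
  (hD : forall r, ~ D r -> h r = 0)
  (hB : (\int[mu]_r (`|h r| `^ (q / (q - 1)))%:E <= B%:E)%E).

Let p := q / (q - 1).

(* At height e^-y, h is cut at [level y], chosen so that its large values
   contribute at most half of the height; the L^2 bounds of the remaining parts
   are then integrated over y. *)
Let level (y : R) : R := expR ((q - 1) * (y + ln (2 * B))).

Let low y r : R := if `|h r| <= level y then h r else 0.
Let high y r : R := if `|h r| <= level y then 0 else h r.

Let mlevel : measurable_fun setT level.
Proof.
apply: (measurableT_comp (@measurable_expR R)); apply: measurable_funM => //.
exact: measurable_funD.
Qed.

Let mcond (y : R) : measurable_fun setT (fun r => `|h r| <= level y).
Proof. by apply: measurable_fun_ler => //; exact: measurableT_comp. Qed.

Let mlow y : measurable_fun setT (low y).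
Proof. exact: measurable_fun_ifT. Qed.

Let mhigh y : measurable_fun setT (high y).
Proof. exact: measurable_fun_ifT. Qed.

Let lowD y r : ~ D r -> low y r = 0.
Proof. by move=> nr; rewrite /low hD// if_same. Qed.

Let low_le y r : `|low y r| <= level y.
Proof. by rewrite /low; case: ifP => // _; rewrite normr0 expR_ge0. Qed.

Let q1 : 0 < q - 1. Proof. by move: q2; lra. Qed.

Let mhp : measurable_fun setT (fun r => `|h r| `^ p).
Proof.
apply: (measurableT_comp (measurable_powR p)).
exact: measurableT_comp.
Qed.

Let ihp : mu.-integrable setT (EFin \o (fun r => `|h r| `^ p)).
Proof.
apply/integrableP; split; first exact/measurable_EFinP.
under eq_integral => r _ do rewrite /= ger0_norm ?powR_ge0//.
exact: le_lt_trans hB (ltry _).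
Qed.

Let level_gt0 y : 0 < level y. Proof. exact: expR_gt0. Qed.

(** The exponent q - 1 in [level] is the inverse of p - 1, so that this power of the level is
    proportional to the height e^-y. *)
Let levelE y : level y `^ (1 - p) = expR (- y) / (2 * B).
Proof.
have B2 : 0 < 2 * B by rewrite mulr_gt0.
rewrite /level -expRM.
rewrite [X in expR X](_ : _ = - y - ln (2 * B)); last first.
  by rewrite /p; field; rewrite gt_eqF.
by rewrite expRD (expRN (ln _)) lnK.
Qed.

(** Where |h| exceeds the level, |h| = |h|^(1-p) |h|^p and 1 - p <= 0, so the first factor is at
    most its value at the level. Integrating against the bound B leaves exactly half of the
    height. *)
Let high_le y r : `|high y r| <= (expR (- y) / (2 * B)) * `|h r| `^ p.
Proof.
rewrite -levelE /high; case: ifPn => [_|]; first by rewrite normr0 mulr_ge0 ?powR_ge0.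
rewrite -ltNge => lt.
have h0 : 0 < `|h r| by exact: lt_trans lt.
have {1}-> : `|h r| = `|h r| `^ (1 - p) * `|h r| `^ p.
  by rewrite -powRD ?(gt_eqF h0) ?implybT// subrK powRr1.
apply: ler_wpM2r; first exact: powR_ge0.
have p1 : 1 - p <= 0.
  rewrite [X in X <= 0](_ : _ = - (q - 1)^-1) ?oppr_le0 ?invr_ge0 ?(ltW q1)//.
  by rewrite /p; field; rewrite gt_eqF.
rewrite /powR (gt_eqF h0) (gt_eqF (level_gt0 y)) ler_expR.
by apply: ler_wnM2l => //; rewrite ler_ln ?posrE// ltW.
Qed.

Let kM t (g : R -> R) : measurable_fun setT g ->
  measurable_fun setT (fun r => g r * k t r).
Proof. by move=> mg; exact: measurable_funM. Qed.

Let integrable_low y t : mu.-integrable setT (EFin \o (fun r => low y r * k t r)).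
Proof.
apply: (@integrable_bounded_support _ RR _ mu D _ (level y)) => //.
- exact: ltW.
- exact: kM.
- by move=> r; rewrite normrM -[leRHS]mulr1 ler_pM.
- by move=> r nr; rewrite lowD// mul0r.
Qed.

Let integrable_high y t : mu.-integrable setT (EFin \o (fun r => high y r * k t r)).
Proof.
apply: (@le_integrable _ _ _ mu _ measurableT _
  (EFin \o (fun r => (expR (- y) / (2 * B)) * `|h r| `^ p))).
- by apply/measurable_EFinP; exact: kM.
- move=> r _; rewrite /= lee_fin [leRHS]ger0_norm; last first.
    by rewrite mulr_ge0 ?powR_ge0// divr_ge0 ?expR_ge0// mulr_ge0// ltW.
  rewrite normrM (le_trans _ (high_le y r))// -[leRHS]mulr1.
  exact: ler_wpM2l.
- exact: integrable_funZl.
Qed.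

Let fourier_high y t : `|real_fourier k (high y) t| <= expR (- y) / 2.
Proof.
have e0 : 0 <= expR (- y) / (2 * B).
  by rewrite divr_ge0 ?expR_ge0// mulr_ge0// ltW.
rewrite -lee_fin; apply: (@le_trans _ _
  (\int[mu]_r (expR (- y) / (2 * B) * `|h r| `^ p)%:E)%E).
  apply: (@le_trans _ _ (\int[mu]_r (`|high y r * k t r|)%:E)%E).
    rewrite EFin_Rintegral; last exact: (integrable_norm (integrable_high y t)).
    by rewrite lee_fin; apply: le_normr_Rintegral => //; exact: integrable_high.
  apply: ge0_le_integral => //.
  - by apply/measurable_EFinP; apply: measurableT_comp => //; exact: kM.
  - by apply/measurable_EFinP; exact: measurable_funM.
  - move=> r _; rewrite lee_fin normrM (le_trans _ (high_le y r))// -[leRHS]mulr1.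
    exact: ler_wpM2l.
rewrite ge0_integral_funZl//.
apply: (@le_trans _ _ ((expR (- y) / (2 * B))%:E * B%:E)%E).
  by rewrite lee_wpmul2l// lee_fin.
rewrite -EFinM lee_fin [leLHS](_ : _ = expR (- y) / 2)//.
by field; rewrite gt_eqF.
Qed.

Let fourier_split y t :
  real_fourier k h t = real_fourier k (low y) t + real_fourier k (high y) t.
Proof.
apply: etrans _ (RintegralD measurableT (integrable_low y t) (integrable_high y t)).
apply: eq_Rintegral => r _.
by rewrite -mulrDl /low /high; case: ifP; rewrite ?addr0 ?add0r.
Qed.

(** If the transform reaches the height e^-y while the high part contributes at most half of it,
    then the low part contributes at least the other half. *)
Let fourier_low y t : expR (- y) <= `|real_fourier k h t| ->
  expR (- y) ^+ 2 <= 4 * real_fourier k (low y) t ^+ 2.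
Proof.
rewrite (fourier_split y) => le.
have := ler_normD (real_fourier k (low y) t) (real_fourier k (high y) t).
have := fourier_high y t; have := expR_ge0 (- y).
rewrite -(real_normK (num_real (real_fourier k (low y) t))).
move: (`|real_fourier k (low y) t|) (`|real_fourier k (high y) t|) le => a b le.
set e := expR (- y) in le *; move=> e0 hb ab.
have : e <= 2 * a by lra.
nra.
Qed.

(** In the layer-cake formula with height e^-y, the density q e^(-q y) is split as q e^(-(q-2) y)
    times e^(-2y), and the last factor is replaced by its bound from [fourier_low]. *)
Let majorant (z : RR * RR) : R :=
  4 * q * expR (- ((q - 2) * z.2)) * real_fourier k (low z.2) z.1 ^+ 2.

Let majorant_ge0 z : 0 <= majorant z.
Proof.
by apply: mulr_ge0; [apply: mulr_ge0; [move: q2; lra|exact: expR_ge0]|exact: sqr_ge0].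
Qed.

Let measurable_lowz : measurable_fun setT (fun z : RR * RR => low z.1 z.2).
Proof.
apply: measurable_fun_ifT => //; last exact: (measurableT_comp mh).
apply: measurable_fun_ler; last exact: (measurableT_comp mlevel).
by apply: measurableT_comp => //; exact: (measurableT_comp mh).
Qed.

Let measurable_majorant : measurable_fun setT majorant.
Proof.
apply: measurable_funM.
  apply: measurable_funM => //; apply: (measurableT_comp (@measurable_expR R)).
  by apply: measurableT_comp => //; exact: measurable_funM.
apply: measurable_funX.
apply: (@measurable_Rintegral_param _ _ (RR * RR)%type RR _ mu
  (fun w : (RR * RR) * RR => low w.1.2 w.2 * k w.1.1 w.2)).
have m12 : measurable_fun setT (fun w : (RR * RR) * RR => w.1.2).
  exact: (measurableT_comp measurable_snd measurable_fst).
have m11 : measurable_fun setT (fun w : (RR * RR) * RR => w.1.1).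
  exact: (measurableT_comp measurable_fst measurable_fst).
apply: measurable_funM.
  exact: (measurableT_comp measurable_lowz (measurable_fun_pair m12 measurable_snd)).
exact: (measurableT_comp mk (measurable_fun_pair m11 measurable_snd)).
Qed.

Let layer_cake t :
  ((`|real_fourier k h t| `^ q)%:E <= \int[mu]_y (majorant (t, y))%:E)%E.
Proof.
have q0 : 0 < q by move: q2; lra.
have [->|T0] := eqVneq (real_fourier k h t) 0.
  rewrite normr0 powR0 ?gt_eqF//; apply: integral_ge0 => y _.
  by rewrite lee_fin.
have T1 : 0 < `|real_fourier k h t| by rewrite normr_gt0.
rewrite /powR (gt_eqF T1); set a := ln _.
have -> : q * a = - (q * - a) by ring.
rewrite -(integral_expR_tail _ q0) integral_mkcond.
apply: ge0_le_integral => //.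
- move=> y _; rewrite patchE; case: ifP => // _.
  by rewrite lee_fin mulr_ge0 ?expR_ge0 ?(ltW q0).
- apply/(measurable_restrictT (fun y => (q * expR (- (q * y)))%:E)) => //.
  apply/measurable_EFinP; apply: measurable_funTS; apply: measurable_funM => //.
  by apply: (measurableT_comp (@measurable_expR R)); apply: measurableT_comp => //; exact: measurable_funM.
- apply/measurable_EFinP.
  exact: (measurable_comp measurableT (@subsetT _ _) measurable_majorant (measurable_pair1 t)).
move=> y _; rewrite patchE mem_setE in_itv/= andbT; case: ifP => [ay|_]; last by rewrite lee_fin.
rewrite lee_fin /majorant/=.
have ey : expR (- y) <= `|real_fourier k h t|.
  by rewrite -[leRHS]lnK ?posrE// ler_expR lerNl.
have -> : q * expR (- (q * y)) = q * expR (- ((q - 2) * y)) * expR (- y) ^+ 2.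
  rewrite expr2 -mulrA -!expRD; congr (_ * expR _); ring.
rewrite [leRHS](_ : _ = q * expR (- ((q - 2) * y)) * (4 * real_fourier k (low y) t ^+ 2)); last by ring.
apply: ler_wpM2l; first by rewrite mulr_ge0 ?expR_ge0 ?(ltW q0).
exact: fourier_low.
Qed.

Let lowmajorant (z : RR * RR) : R :=
  4 * q * K * expR (- ((q - 2) * z.1)) * low z.1 z.2 ^+ 2.

Let lowmajorant_ge0 z : 0 <= lowmajorant z.
Proof.
apply: mulr_ge0; last exact: sqr_ge0.
apply: mulr_ge0; last exact: expR_ge0.
by apply: mulr_ge0 => //; move: q2; lra.
Qed.

Let measurable_lowmajorant : measurable_fun setT lowmajorant.
Proof.
apply: measurable_funM; last exact: measurable_funX.
apply: measurable_funM => //; apply: (measurableT_comp (@measurable_expR R)).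
by apply: measurableT_comp => //; exact: measurable_funM.
Qed.

Let Cq : R := 4 * q * K / (q - 2) * (2 * B) `^ (q - 2).

Let integral_lowmajorant r :
  (\int[mu]_y (lowmajorant (y, r))%:E = (Cq * `|h r| `^ p)%:E)%E.
Proof.
have q20 : 0 < q - 2 by move: q2; lra.
have B2 : 0 < 2 * B by rewrite mulr_gt0.
have p0 : p != 0 by rewrite /p mulf_neq0 ?invr_eq0 ?(gt_eqF q1)//; move: q2; lra.
have [h0|h0] := eqVneq (h r) 0.
  rewrite h0 normr0 powR0// mulr0 integral0_eq// => y _.
  by rewrite /lowmajorant/= /low h0 if_same expr0n/= mulr0.
have h1 : 0 < `|h r| by rewrite normr_gt0.
(* [c] solves level c = |h r|, so [low y r] is nonzero exactly for y >= c. Since q > 2 the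
   exponential tail converges, and it contributes |h|^(-(q-2)/(q-1)); times h^2 this is |h|^p. *)
pose c := ln `|h r| / (q - 1) - ln (2 * B).
pose A := 4 * q * K / (q - 2) * h r ^+ 2.
have A0 : 0 <= A.
  apply: mulr_ge0; last exact: sqr_ge0.
  by apply: divr_ge0; [apply: mulr_ge0 => //; move: q2; lra|exact: ltW].
transitivity (A%:E * \int[mu]_(y in `[c, +oo[) ((q - 2) * expR (- ((q - 2) * y)))%:E)%E.
  rewrite -ge0_integralZl_EFin//; last 2 first.
  - by move=> y _; rewrite lee_fin mulr_ge0 ?expR_ge0 ?(ltW q20).
  - apply/measurable_EFinP; apply: measurable_funTS; apply: measurable_funM => //.
    apply: (measurableT_comp (@measurable_expR R)).
    by apply: measurableT_comp => //; exact: measurable_funM.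
  rewrite [RHS]integral_mkcond; apply: eq_integral => y _.
  rewrite patchE mem_setE in_itv/= andbT.
  have -> : (c <= y) = (`|h r| <= level y).
    rewrite /level -[X in _ = (X <= _)]lnK ?posrE// ler_expR /c lerBlDr.
    by rewrite ler_pdivrMr// mulrC.
  rewrite /lowmajorant/= /low; case: ifP => _; last by rewrite expr0n/= mulr0.
  by rewrite -EFinM; congr EFin; rewrite /A; field; rewrite gt_eqF.
rewrite integral_expR_tail// -EFinM; congr EFin.
rewrite /A /Cq /powR (gt_eqF B2) (gt_eqF h1).
rewrite -(real_normK (num_real (h r))) -[in LHS](lnK h1) -expRM_natl.
rewrite -!mulrA; do 4 congr (_ * _); rewrite -!expRD; congr expR.
by rewrite /c /p; field; rewrite gt_eqF.
Qed.

(** The majorant is integrated in t at fixed y, where the L^2 bound applies to [low y], and the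
    result is integrated in y at fixed r. Tonelli justifies both exchanges. *)
Lemma hausdorff_young_normalized :
  (\int[mu]_t (`|real_fourier k h t| `^ q)%:E <=
   (4 * q * K / (q - 2) * (2 * B) `^ (q - 2) * B)%:E)%E.
Proof.
have mT : measurable_fun setT (real_fourier k h) by exact: measurable_real_fourier.
have Cq0 : 0 <= Cq.
  apply: mulr_ge0; last exact: powR_ge0.
  by apply: divr_ge0; [apply: mulr_ge0 => //|]; move: q2; lra.
have mmaj : measurable_fun setT (EFin \o majorant) by exact/measurable_EFinP.
have mlowmaj : measurable_fun setT (EFin \o lowmajorant) by exact/measurable_EFinP.
have maj0 z : (0 <= (EFin \o majorant) z)%E by rewrite lee_fin.
have lowmaj0 z : (0 <= (EFin \o lowmajorant) z)%E by rewrite lee_fin.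
apply: (@le_trans _ _ (\int[mu]_t \int[mu]_y (majorant (t, y))%:E)%E).
  apply: ge0_le_integral => //.
  - apply/measurable_EFinP; apply: (measurableT_comp (measurable_powR q)).
    exact: measurableT_comp.
  - apply: (@measurable_fun_fubini_tonelli_F _ _ RR RR _ mu (EFin \o majorant)) => //.
rewrite (@fubini_tonelli _ _ RR RR _ mu mu (EFin \o majorant))//.
apply: (@le_trans _ _ (\int[mu]_y \int[mu]_r (lowmajorant (y, r))%:E)%E).
  apply: ge0_le_integral => //.
  - by move=> y _; apply: integral_ge0 => t _; rewrite lee_fin.
  - apply: (@measurable_fun_fubini_tonelli_G _ _ RR RR _ mu (EFin \o majorant)) => //.
  - apply: (@measurable_fun_fubini_tonelli_F _ _ RR RR _ mu (EFin \o lowmajorant)) => //.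
  move=> y _.
  have c0 : 0 <= 4 * q * expR (- ((q - 2) * y)).
    by apply: mulr_ge0; [move: q2; lra|exact: expR_ge0].
  rewrite /majorant/= (ge0_integral_funZl mu c0); last 2 first.
  - by apply: measurable_funX; exact: measurable_real_fourier.
  - by move=> t; exact: sqr_ge0.
  apply: (@le_trans _ _ ((4 * q * expR (- ((q - 2) * y)))%:E *
      (K%:E * \int[mu]_r (low y r ^+ 2)%:E))%E).
    by apply: lee_wpmul2l; rewrite ?lee_fin//; apply: k2 (low_le y) _ => // r; exact: lowD.
  have mlow2 : measurable_fun setT (fun r => low y r ^+ 2) by apply: measurable_funX; exact: mlow.
  rewrite muleA -EFinM -(ge0_integral_funZl mu (mulr_ge0 c0 K0) mlow2); last first.
    by move=> r; exact: sqr_ge0.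
  rewrite le_eqVlt; apply/orP; left; apply/eqP; apply: eq_integral => r _.
  by congr EFin; rewrite /lowmajorant/=; ring.
rewrite (@fubini_tonelli _ _ RR RR _ mu mu (EFin \o lowmajorant))//.
under eq_integral do rewrite integral_lowmajorant.
rewrite ge0_integral_funZl//.
by rewrite -/Cq [leRHS]EFinM; apply: lee_wpmul2l; rewrite ?lee_fin.
Qed.

End level_truncation.

(** When A is the integral of |h|^q', A^(q-1) is the q-th power of the L^q' norm of h, so the
    inequality is homogeneous in h. *)
Lemma hausdorff_young (q : R) : 2 < q -> exists2 C : R, 0 <= C &
  forall (h : R -> R) (A : R), measurable_fun setT h ->
    (forall r, ~ D r -> h r = 0) -> 0 < A ->
    (\int[mu]_r (`|h r| `^ (q / (q - 1)))%:E <= A%:E)%E ->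
    (\int[mu]_t (`|real_fourier k h t| `^ q)%:E <= (C * A `^ (q - 1))%:E)%E.
Proof.
move=> q2; exists (4 * q * K / (q - 2) * 2 `^ (q - 2)).
  apply: mulr_ge0; last exact: powR_ge0.
  by apply: divr_ge0; [apply: mulr_ge0 => //|]; lra.
move=> h A mh hD A0 hA; apply: le_trans (hausdorff_young_normalized q2 A0 mh hD hA) _.
rewrite lee_fin powRM ?(ltW A0)// -!mulrA.
rewrite -{2}[A]powRr1 ?(ltW A0)// -powRD ?(gt_eqF A0) ?implybT//.
by rewrite [X in A `^ X](_ : _ = q - 1)//; ring.
Qed.

End marcinkiewicz.

(** * Fourier integrals of radial functions *)

Local Arguments lebesgue_Rn : simpl never.

Lemma eq_RintegralT d (T : measurableType d) (R : realType)
    (m : {measure set T -> \bar R}) (g f : T -> R) : f =1 g ->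
  \int[m]_x f x = \int[m]_x g x.
Proof. by move=> fg; apply: eq_Rintegral => x _; exact: fg. Qed.

Section polar_constants.
Context (R : realType).
Local Notation mu := (@lebesgue_measure R).
Local Notation D := (`[1, (2 : R)]%classic).
Local Notation J := (@bessel_int R).

(** At s = 0 the recurrence becomes Wallis's formula, which advances the index by two; hence the
    induction on pairs of consecutive indices. *)
Lemma bessel_int0_gt0 k : 0 < J k 0.
Proof.
suff [] : 0 < J k 0 /\ 0 < J k.+1 0 by [].
have ltI : - (pi / 2) < pi / 2 :> R by have := @pi_gt0 R; lra.
elim: k => [|k [IH0 IH1]]; split => //.
- rewrite /bessel_int; under eq_Rintegral do rewrite mul0r cos0 expr0 mulr1.
  rewrite Rintegral_cst//= lebesgue_measure_itv/= lte_fin ltI/= mul1r.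
  by have := @pi_gt0 R; lra.
- rewrite /bessel_int; under eq_Rintegral do rewrite mul0r cos0 expr1 mul1r.
  rewrite (@Rintegral_is_derive _ sin)//; last exact: continuous_cos.
  by rewrite sinN sin_pihalf opprK; lra.
- have := @bessel_int_recurrence R k 0; rewrite expr2 !mul0r => /esym/eqP.
  rewrite mulf_eq0 pnatr_eq0/= subr_eq0 => /eqP E.
  by rewrite -(pmulr_rgt0 _ (ltr0Sn R k.+1)) E mulr_gt0.
Qed.

Lemma ball_volume_gt0 k : 0 < ball_volume R k.
Proof. by elim: k => //= k IH; rewrite mulr_gt0 ?bessel_int0_gt0. Qed.

(** This is the Fourier transform, at a frequency of length s, of the surface measure on the sphere
    of radius r in R^(k+2). In particular s = 0 gives the area of the sphere. *)
Definition radial_kernel (k : nat) (s r : R) : R :=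
  ball_volume R k.+1 * (k.+1%:R * r ^+ k.+1 * J k (s * r)).

Lemma polar_densityE k s r :
  polar_density k s r = radial_kernel k 0 r + radial_kernel k s r.
Proof. by rewrite /polar_density /radial_kernel mul0r -mulrDr -mulrDr. Qed.

Lemma continuous_radial_kernel k s : continuous (radial_kernel k s).
Proof.
apply: continuous_funM; first exact: cst_continuous.
apply: continuous_funM; first by move=> r; derive_cont.
apply: (@continuous_fun_comp _ (fun r => s * r)); last exact: continuous_bessel_int.
by move=> u; derive_cont.
Qed.

Lemma radial_kernel0_gt0 k r : 0 < r -> 0 < radial_kernel k 0 r.
Proof.
move=> r0; rewrite /radial_kernel mul0r !mulr_gt0 ?ball_volume_gt0 ?bessel_int0_gt0//.
by rewrite exprn_gt0.
Qed.

Lemma radial_kernel_le k s r : D r ->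
  `|radial_kernel k s r| <= ball_volume R k.+1 * (k.+1%:R * 2 ^+ k.+1 * pi).
Proof.
rewrite /radial_kernel; move: (ball_volume_gt0 k.+1); move: (ball_volume R k.+1) => v v0.
rewrite /= in_itv/= => /andP[r1 r2]; have r0 : 0 <= r by lra.
rewrite !normrM (gtr0_norm v0) normr_nat (ger0_norm (exprn_ge0 _ r0)).
apply: ler_wpM2l; first exact: ltW.
apply: ler_pM => //; last exact: bessel_int_le_pi.
- by apply: mulr_ge0 => //; exact: exprn_ge0.
- by apply: ler_wpM2l => //; apply: lerXn2r; rewrite ?nnegrE.
Qed.

(** The division by r anticipates the density 1/|xi| of the cone measure. With n = k + 2 the
    exponent is -(n-1)/4 in 1 + s^2. *)
Lemma radial_kernel_decay k : exists2 C : R, 0 < C &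
  forall s r : R, 0 <= s -> D r ->
    `|radial_kernel k s r / r| <= C * (1 + s ^+ 2) `^ (- (k.+1%:R / 4)).
Proof.
have [C0 C0_ge0 decay] := bessel_int_decay R k.
have v0 := ball_volume_gt0 k.+1.
rewrite /radial_kernel; move: (ball_volume R k.+1) v0 => v v0.
pose C1 := v * (k.+1%:R * 2 ^+ k.+1).
have C1_gt0 : 0 < C1.
  by apply: mulr_gt0 => //; apply: mulr_gt0; rewrite ?exprn_gt0.
(* [C0] bounds a fourth power, and C0 <= (C0 + 1)^4, so C0 + 1 stands in for the fourth root; it is
   also positive. *)
exists (C1 * (C0 + 1)).
  by rewrite mulr_gt0// ltr_wpDl.
move=> s r s0; rewrite /= in_itv/= => /andP[r1 r2]; have r0 : 0 <= r by lra.
have r3 : 0 < r by lra.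
have s1 : 0 < 1 + s ^+ 2 by rewrite ltr_wpDr// sqr_ge0.
have -> : v * (k.+1%:R * r ^+ k.+1 * J k (s * r)) / r =
    (v * (k.+1%:R * r ^+ k)) * J k (s * r).
  by rewrite exprS; field; rewrite gt_eqF.
rewrite normrM -mulrA; apply: (@le_trans _ _ (C1 * `|J k (s * r)|)).
  apply: ler_wpM2r => //; rewrite ger0_norm; last first.
    by apply: mulr_ge0; [exact: ltW|apply: mulr_ge0 => //; exact: exprn_ge0].
  apply: ler_wpM2l; first exact: ltW.
  apply: ler_wpM2l => //; apply: (@le_trans _ _ (2 ^+ k)).
    by apply: lerXn2r; rewrite ?nnegrE.
  by rewrite ler_eXn2l//; lra.
apply: ler_wpM2l; first exact: ltW.
have le1 : J k (s * r) ^+ 4 * (1 + s ^+ 2) ^+ k.+1 <= C0.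
  apply: le_trans (decay (s * r) _); last by rewrite mulr_ge0.
  apply: ler_wpM2l; first by rewrite exprn_even_ge0.
  have s2 : 0 <= 1 + (s * r) ^+ 2 by rewrite addr_ge0// sqr_ge0.
  apply: lerXn2r; rewrite ?nnegrE ?(ltW s1)//.
  rewrite lerD2l exprMn ler_peMr ?sqr_ge0//.
  by rewrite -(expr1n _ 2) lerXn2r// ?nnegrE//; lra.
have W0 : 0 < (1 + s ^+ 2) `^ (- (k.+1%:R / 4)) by exact: powR_gt0.
have W4 : ((1 + s ^+ 2) `^ (- (k.+1%:R / 4))) ^+ 4 = ((1 + s ^+ 2) ^+ k.+1)^-1.
  rewrite -powR_mulrn ?(ltW W0)// -powRrM mulNr mulfVK// powRN powR_mulrn// ltW//.
rewrite -(@ler_pXn2r _ 4)// ?nnegrE ?mulr_ge0 ?(ltW W0)//; last first.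
  by rewrite addr_ge0.
rewrite exprMn W4 ler_pdivlMr ?exprn_gt0//.
rewrite -normrX (ger0_norm (exprn_even_ge0 _ _))//.
apply: le_trans le1 _.
have : C0 + 1 <= (C0 + 1) ^+ 4 by rewrite ler_eXnr// lerDr.
lra.
Qed.

End polar_constants.

Section radial_integrals.
Context (R : realType) (k : nat).
Local Notation mu := (@lebesgue_measure R).
Local Notation D := (`[1, (2 : R)]%classic).
Local Notation L := (lebesgue_Rn R k.+2).
Implicit Types (psi : R -> R) (x xi : Rn R k.+2).

Lemma dotp0 n (xi : Rn R n) : dotp [tuple of nseq n 0] xi = 0.
Proof. by apply: big1 => i _; rewrite tnth_nseq mul0r. Qed.

Lemma ge0_integral_radial (psi : R -> \bar R) :
  measurable_fun setT psi -> (forall r, 0 <= psi r)%E ->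
  (forall r, ~ D r -> psi r = 0%E) ->
  (\int[L]_xi psi (enorm xi) = \int[mu]_r (psi r * (radial_kernel k 0 r)%:E))%E.
Proof.
move=> mpsi psi0 psiD.
have mrk : measurable_fun setT (fun r => (radial_kernel k (0 : R) r)%:E).
  by apply/measurable_EFinP; apply: continuous_measurable_fun; exact: continuous_radial_kernel.
have menorm : measurable_fun setT (fun xi : Rn R k.+2 => psi (enorm xi)).
  exact: (measurableT_comp mpsi (@measurable_enorm R k.+2)).
have nonneg r : (0 <= psi r * (radial_kernel k 0 r)%:E)%E.
  have [r1|/psiD ->] := pselect (D r); last by rewrite mul0e.
  apply: mule_ge0 => //; rewrite lee_fin ltW// radial_kernel0_gt0//.
  by move: r1; rewrite /= in_itv/=; lra.
(* At x = 0 the weight 1 + cos is the constant 2 on one side and doubles the radial kernel on the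
   other; the factor 2 is cancelled at the end. *)
have := ge0_integral_polar [tuple of nseq k.+2 0] mpsi psi0.
under eq_integral do rewrite dotp0 cos0.
have -> : enorm ([tuple of nseq k.+2 0] : Rn R k.+2) = 0 by rewrite /enorm dotp0 sqrtr0.
have -> : (\int[mu]_r (psi r * (polar_density k 0 r * \1_`[0%R, +oo[ r)%:E) =
    \int[mu]_r (2%:E * (psi r * (radial_kernel k 0 r)%:E)))%E.
  apply: eq_integral => r _.
  have [r1|/psiD ->] := pselect (D r); last by rewrite !mul0e mule0.
  rewrite indicE mem_set/=; last by move: r1; rewrite /= !in_itv/= andbT; lra.
  by rewrite mulr1 polar_densityE muleCA -EFinM mulr2n mulrDl mul1r.
under eq_integral do rewrite muleC.
rewrite !ge0_integralZl_EFin//; last exact: emeasurable_funM.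
move=> E.
have : ((2^-1)%:E * ((1 + 1)%:E * \int[L]_xi psi (enorm xi)) =
  (2^-1)%:E * (2%:E * \int[mu]_r (psi r * (radial_kernel k 0 r)%:E)))%E by rewrite E.
by rewrite !muleA -!EFinM mulVf// !mul1e.
Qed.

Section integrable_profile.
Variable psi : R -> R.
Hypotheses (mpsi : measurable_fun setT psi) (psiD : forall r, ~ D r -> psi r = 0)
  (ipsi : mu.-integrable setT (EFin \o psi)).

Let menorm : measurable_fun setT (fun xi : Rn R k.+2 => psi (enorm xi)).
Proof. exact: (measurableT_comp mpsi (@measurable_enorm R k.+2)). Qed.

Lemma integrable_radial_kernel s :
  mu.-integrable setT (EFin \o (fun r => psi r * radial_kernel k s r)).
Proof.
pose C := ball_volume R k.+1 * (k.+1%:R * 2 ^+ k.+1 * pi).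
apply: (@le_integrable _ _ _ mu _ measurableT _ (EFin \o (fun r => C * psi r))).
- apply/measurable_EFinP; apply: measurable_funM => //.
  by apply: continuous_measurable_fun; exact: continuous_radial_kernel.
- move=> r _; rewrite /= lee_fin.
  have [r1|/psiD ->] := pselect (D r); last by rewrite mul0r mulr0 normr0.
  rewrite !(normrM _ (psi r)) (normrM (psi r)) mulrC.
  apply: ler_wpM2r => //; apply: le_trans (ler_norm _); exact: radial_kernel_le.
- exact: integrable_funZl.
Qed.

Lemma integrable_radial (c : Rn R k.+2 -> R) : measurable_fun setT c ->
  (forall xi, `|c xi| <= 1) ->
  L.-integrable setT (EFin \o (fun xi => psi (enorm xi) * c xi)).
Proof.
move=> mc c1.
apply: (@le_integrable _ _ _ L _ measurableT _ (EFin \o (fun xi => psi (enorm xi)))).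
- by apply/measurable_EFinP; exact: measurable_funM.
- move=> xi _; rewrite /= lee_fin normrM -[leRHS]mulr1.
  exact: ler_wpM2l.
apply/integrableP; split; first exact/measurable_EFinP.
have := @ge0_integral_radial (fun r => (`|psi r|)%:E).
move=> /= ->//; last 2 first.
- by apply/measurable_EFinP; exact: measurableT_comp.
- by move=> r /psiD ->; rewrite normr0.
have /integrableP[_] := integrable_radial_kernel 0.
apply: le_lt_trans; rewrite le_eqVlt; apply/orP; left; apply/eqP.
apply: eq_integral => r _ /=; rewrite (normrM (psi r)).
have [r1|/psiD ->] := pselect (D r); last by rewrite normr0 !mul0r mul0e.
have r0 : 0 < r by move: r1; rewrite /= in_itv/=; lra.
by rewrite -EFinM (gtr0_norm (radial_kernel0_gt0 k r0)).
Qed.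

End integrable_profile.

Let mcosdot x : measurable_fun setT (fun xi : Rn R k.+2 => cos (dotp x xi)).
Proof. exact: (measurableT_comp (@measurable_cosR R) (measurable_dotp x)). Qed.

Let msindot x : measurable_fun setT (fun xi : Rn R k.+2 => sin (dotp x xi)).
Proof. exact: (measurableT_comp (@measurable_sinR R) (measurable_dotp x)). Qed.

Let cos1 (u : R) : `|cos u| <= 1. Proof. by rewrite ler_norml cos_geN1 cos_le1. Qed.
Let sin1 (u : R) : `|sin u| <= 1. Proof. by rewrite ler_norml sin_geN1 sin_le1. Qed.

(** The polar formula at x computes the integral against 1 + cos; the purely radial integral
    accounts for the 1, and all terms are finite, so it can be subtracted. *)
Let ge0_Rintegral_radial_cos psi x : measurable_fun setT psi ->
  (forall r, ~ D r -> psi r = 0) -> mu.-integrable setT (EFin \o psi) ->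
  (forall r, 0 <= psi r) ->
  \int[L]_xi (psi (enorm xi) * cos (dotp x xi)) =
  \int[mu]_r (psi r * radial_kernel k (enorm x) r).
Proof.
move=> mpsi psiD ipsi psi0.
have i1 : L.-integrable setT (EFin \o (fun xi => psi (enorm xi))).
  have := integrable_radial mpsi psiD ipsi (c := cst 1) (measurable_cst _).
  by rewrite /= normr1 lexx => /(_ (fun=> isT)); under eq_fun do rewrite /= mulr1.
have ic := integrable_radial mpsi psiD ipsi (mcosdot x) (fun xi => cos1 _).
have j0 := integrable_radial_kernel mpsi psiD ipsi 0.
have jx := integrable_radial_kernel mpsi psiD ipsi (enorm x).
have := @ge0_integral_polar R k x (EFin \o psi).
move=> /(_ _ _)/wrap[]; first exact/measurable_EFinP.
  by move=> r; rewrite lee_fin.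
under eq_integral do rewrite /= -EFinM mulrDr mulr1.
rewrite EFin_Rintegral; last exact: integrable_funD.
have -> : (\int[mu]_r ((EFin \o psi) r * (polar_density k (enorm x) r * \1_`[0%R, +oo[ r)%:E) =
    \int[mu]_r (psi r * radial_kernel k 0 r + psi r * radial_kernel k (enorm x) r)%:E)%E.
  apply: eq_integral => r _ /=.
  have [r1|/psiD ->] := pselect (D r); last by rewrite !mul0r mul0e addr0.
  rewrite indicE mem_set/=; last by move: r1; rewrite /= !in_itv/= andbT; lra.
  by rewrite mulr1 polar_densityE -EFinM mulrDr.
rewrite EFin_Rintegral; last exact: integrable_funD.
case=> E.
have := @ge0_integral_radial (EFin \o psi).
move=> /(_ _ _ _)/wrap[].
- exact/measurable_EFinP.
- by move=> r; rewrite lee_fin.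
- by move=> r /psiD /= ->.
rewrite EFin_Rintegral//.
under eq_integral do rewrite /= -EFinM.
rewrite EFin_Rintegral//; case=> E0.
move: E; rewrite (RintegralD measurableT i1 ic) (RintegralD measurableT j0 jx) E0.
exact: addrI.
Qed.

Lemma Rintegral_radial_cos psi x : measurable_fun setT psi ->
  (forall r, ~ D r -> psi r = 0) -> mu.-integrable setT (EFin \o psi) ->
  \int[L]_xi (psi (enorm xi) * cos (dotp x xi)) =
  \int[mu]_r (psi r * radial_kernel k (enorm x) r).
Proof.
move=> mpsi psiD ipsi.
(* A signed profile is the difference of the nonnegative functions |psi| and |psi| - psi, both
   integrable and supported in [1, 2]. *)
pose a r := `|psi r|; pose b r := `|psi r| - psi r.
have ma : measurable_fun setT a by exact: measurableT_comp.
have mb : measurable_fun setT b by exact: measurable_funB.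
have aD r : ~ D r -> a r = 0 by move=> /psiD; rewrite /a => ->; rewrite normr0.
have bD r : ~ D r -> b r = 0 by move=> /psiD; rewrite /b => ->; rewrite normr0 subr0.
have ia : mu.-integrable setT (EFin \o a) by exact: (integrable_norm ipsi).
have ib : mu.-integrable setT (EFin \o b).
  have := integrable_funD ia (integrable_funZl (-1) ipsi).
  by under eq_fun do rewrite mulN1r.
have a0 r : 0 <= a r by exact: normr_ge0.
have b0 r : 0 <= b r by rewrite subr_ge0 ler_norm.
have psiE r : psi r = a r - b r by rewrite /b /a opprB addrC subrK.
rewrite (@eq_RintegralT _ _ _ L (fun xi => a (enorm xi) * cos (dotp x xi) - b (enorm xi) * cos (dotp x xi))); last first.
  by move=> xi; rewrite psiE mulrBl.
rewrite RintegralB//; last 2 first.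
- exact: (integrable_radial ma aD ia (mcosdot x) (fun xi => cos1 _)).
- exact: (integrable_radial mb bD ib (mcosdot x) (fun xi => cos1 _)).
rewrite !ge0_Rintegral_radial_cos// -RintegralB//; last 2 first.
- exact: integrable_radial_kernel.
- exact: integrable_radial_kernel.
by apply: eq_Rintegral => r _; rewrite -mulrBl -psiE.
Qed.

(** The integral against 1 + sin(x.xi) depends on x only through |x|, so it is the same at x and at
    -x. The sine integral therefore equals its own opposite. *)
Let ge0_Rintegral_radial_sin psi x : measurable_fun setT psi ->
  (forall r, ~ D r -> psi r = 0) -> mu.-integrable setT (EFin \o psi) ->
  (forall r, 0 <= psi r) ->
  \int[L]_xi (psi (enorm xi) * sin (dotp x xi)) = 0.
Proof.
move=> mpsi psiD ipsi psi0.
have i1 : L.-integrable setT (EFin \o (fun xi => psi (enorm xi))).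
  have := integrable_radial mpsi psiD ipsi (c := cst 1) (measurable_cst _).
  by rewrite /= normr1 lexx => /(_ (fun=> isT)); under eq_fun do rewrite /= mulr1.
pose y : Rn R k.+2 := [tuple - tnth x i | i < k.+2].
have dy xi : dotp y xi = - dotp x xi.
  rewrite /dotp -sumrN; apply: eq_bigr => i _.
  by rewrite tnth_mktuple mulNr.
have ny : enorm y = enorm x.
  rewrite /enorm; congr Num.sqrt; apply: eq_bigr => i _.
  by rewrite tnth_mktuple mulrNN.
have is_ z := integrable_radial mpsi psiD ipsi (msindot z) (fun xi => sin1 _).
have mphi : measurable_fun setT (fun u : R => (psi (Num.sqrt u))%:E).
  apply/measurable_EFinP; apply: (measurableT_comp mpsi).
  by apply: continuous_measurable_fun; exact: sqrt_continuous.
have mG : measurable_fun setT (fun a : R => (1 + sin a)%:E).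
  by apply/measurable_EFinP; apply: measurable_funD => //; exact: measurable_sinR.
have phi0 u : (0 <= (psi (Num.sqrt u))%:E)%E by rewrite lee_fin.
have G0 (a : R) : (0 <= (1 + sin a)%:E)%E by rewrite lee_fin; have := sin_geN1 a; lra.
have := ge0_integral_plane_wave_Rn y mphi mG phi0 G0.
rewrite ny -(ge0_integral_plane_wave_Rn x mphi mG phi0 G0).
under eq_integral do rewrite -EFinM -/(enorm _) mulrDr mulr1.
rewrite EFin_Rintegral; last exact: integrable_funD.
under [in RHS]eq_integral do rewrite -EFinM -/(enorm _) mulrDr mulr1.
rewrite EFin_Rintegral; last exact: integrable_funD.
case; rewrite (RintegralD measurableT i1 (is_ y)) (RintegralD measurableT i1 (is_ x)).
move/addrI.
rewrite (@eq_RintegralT _ _ _ L (fun xi => - 1 * (psi (enorm xi) * sin (dotp x xi)))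
  (fun xi => psi (enorm xi) * sin (dotp y xi))); last first.
  by move=> xi; rewrite dy sinN; ring.
rewrite RintegralZl//; lra.
Qed.

Lemma Rintegral_radial_sin psi x : measurable_fun setT psi ->
  (forall r, ~ D r -> psi r = 0) -> mu.-integrable setT (EFin \o psi) ->
  \int[L]_xi (psi (enorm xi) * sin (dotp x xi)) = 0.
Proof.
move=> mpsi psiD ipsi.
pose a r := `|psi r|; pose b r := `|psi r| - psi r.
have ma : measurable_fun setT a by exact: measurableT_comp.
have mb : measurable_fun setT b by exact: measurable_funB.
have aD r : ~ D r -> a r = 0 by move=> /psiD; rewrite /a => ->; rewrite normr0.
have bD r : ~ D r -> b r = 0 by move=> /psiD; rewrite /b => ->; rewrite normr0 subr0.
have ia : mu.-integrable setT (EFin \o a) by exact: (integrable_norm ipsi).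
have ib : mu.-integrable setT (EFin \o b).
  have := integrable_funD ia (integrable_funZl (-1) ipsi).
  by under eq_fun do rewrite mulN1r.
have a0 r : 0 <= a r by exact: normr_ge0.
have b0 r : 0 <= b r by rewrite subr_ge0 ler_norm.
have psiE r : psi r = a r - b r by rewrite /b /a opprB addrC subrK.
rewrite (@eq_RintegralT _ _ _ L (fun xi => a (enorm xi) * sin (dotp x xi) - b (enorm xi) * sin (dotp x xi))); last first.
  by move=> xi; rewrite psiE mulrBl.
rewrite RintegralB//; last 2 first.
- exact: (integrable_radial ma aD ia (msindot x) (fun xi => sin1 _)).
- exact: (integrable_radial mb bD ib (msindot x) (fun xi => sin1 _)).
by rewrite !ge0_Rintegral_radial_sin// subr0.
Qed.

End radial_integrals.

(** * Decay and norms *)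

Section power_integrals.
Context (R : realType).
Local Notation mu := (@lebesgue_measure R).

Lemma is_derive_expR_ln1D (a x : R) : 0 <= x ->
  is_derive x 1 (fun y => expR (a * ln (1 + y))) (a * expR ((a - 1) * ln (1 + x))).
Proof.
move=> x0; have x1 : 0 < 1 + x by lra.
have d : is_derive x 1 (fun y => ln (1 + y)) (1 + x)^-1.
  apply: (is_derive_eq (is_derive1_comp (is_derive1_ln x1)
    (is_derive_funD (is_derive_fun_cst x 1) (is_derive_fun_id x)))).
  by rewrite add0r mulr1.
apply: (is_derive_eq (is_derive_fun_expR (is_derive_funM (is_derive_fun_cst x a) d))).
rewrite mul0r add0r mulrBl mul1r expRD expRN lnK ?posrE//; ring.
Qed.

Lemma integral_1D_powR_le (a T : R) : 0 < a -> 0 <= T ->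
  (\int[mu]_(x in `[0%R, T]) (a * expR (- (1 + a) * ln (1 + x)))%:E <= 1%:E)%E.
Proof.
move=> a0; rewrite le_eqVlt => /predU1P[<-|T0].
  by rewrite set_itv1 integral_set1.
pose F x := - expR (- a * ln (1 + x)).
have dF (x : R) : 0 <= x -> is_derive x 1 F (a * expR (- (1 + a) * ln (1 + x))).
  move=> x0; apply: (is_derive_eq (is_derive_funN (is_derive_expR_ln1D (- a) x0))).
  by rewrite -mulNr opprK (_ : - a - 1 = - (1 + a)); last ring.
have cF (x : R) : 0 <= x -> {for x, continuous F}.
  by move=> x0; exact: is_derive_continuous (dF x x0).
rewrite (@continuous_FTC2 _ _ F)//.
- rewrite -EFinB lee_fin /F addr0 ln1 mulr0 expR0 opprK gerDr oppr_le0.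
  exact: expR_ge0.
- apply: continuous_in_subspaceT => x; rewrite inE/= in_itv/= => /andP[x0 _].
  exact: (is_derive_continuous (is_derive_funM (is_derive_fun_cst (x : R) a)
    (is_derive_expR_ln1D (- (1 + a)) x0))).
- split=> [x||].
  + by rewrite in_itv/= => /andP[/ltW/dF[]].
  + exact: cvg_at_right_filter (cF 0 (lexx _)).
  + exact: cvg_at_left_filter (cF T (ltW T0)).
- move=> x; rewrite in_itv/= => /andP[/ltW/dF d _].
  by rewrite derive1E; have [_ ->] := d.
Qed.

Lemma measurable_sqr1D_powR (g : R) :
  measurable_fun setT (fun x : R => (1 + x ^+ 2) `^ g).
Proof.
apply: (measurableT_comp (measurable_powR g)).
by apply: measurable_funD => //; exact: measurable_funX.
Qed.

Lemma integral_sqr1D_powR_lty (g : R) : 1 / 2 < g ->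
  (\int[mu]_x ((1 + x ^+ 2) `^ (- g))%:E < +oo)%E.
Proof.
(* From (1 + x)^2 <= 2(1 + x^2) on the half-line, the integrand is at most 2^g (1 + x)^(-2g). Here
   2g = 1 + a, and a (1 + x)^(-1-a) has the bounded primitive -(1 + x)^(-a). *)
move=> g12; pose a := 2 * g - 1.
have a0 : 0 < a by rewrite /a; lra.
pose B := (2 `^ g / a)%:E.
apply: (@le_lt_trans _ _ (B + B)%E); last by rewrite -EFinD ltry.
apply: ge0_integral_even_le.
- exact: measurable_sqr1D_powR.
- by move=> t; exact: powR_ge0.
- by move=> t; rewrite sqrrN.
move=> n.
have c0 : 0 <= 2 `^ g / a by rewrite divr_ge0 ?powR_ge0 ?ltW.
apply: (@le_trans _ _ ((2 `^ g / a)%:E *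
    \int[mu]_(x in `[0%R, n%:R]) (a * expR (- (1 + a) * ln (1 + x)))%:E)%E); last first.
  by rewrite /B -[leRHS]mule1; apply: lee_wpmul2l; [rewrite lee_fin|exact: integral_1D_powR_le].
have mf : measurable_fun setT (fun x : R => a * expR (- (1 + a) * ln (1 + x))).
  apply: measurable_funM => //; apply: (measurableT_comp (@measurable_expR R)).
  apply: measurable_funM => //; apply: (measurableT_comp (@measurable_ln R)).
  exact: measurable_funD.
rewrite -ge0_integralZl_EFin//; last 2 first.
- by move=> x _; rewrite lee_fin mulr_ge0 ?expR_ge0 ?ltW.
- by apply/measurable_EFinP; exact: measurable_funTS.
apply: ge0_le_integral => //.
- by move=> x _; rewrite lee_fin powR_ge0.
- by apply/measurable_EFinP; apply: measurable_funTS; exact: measurable_sqr1D_powR.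
- by apply/measurable_EFinP; apply: measurable_funTS; apply: measurable_funM.
move=> x; rewrite /= in_itv/= => /andP[x0 _].
rewrite -EFinM lee_fin mulrA divfK ?gt_eqF//.
have x1 : 0 < 1 + x by lra.
have x2 : 0 < 1 + x ^+ 2 by rewrite ltr_wpDr// sqr_ge0.
rewrite /powR (gt_eqF x2) gt_eqF// -expRD ler_expR.
have le2 : 2 * ln (1 + x) <= ln 2 + ln (1 + x ^+ 2).
  rewrite -lnM ?posrE// mulrC mulr_natr -lnXn// ler_ln ?posrE ?exprn_gt0 ?mulr_gt0//.
  by have := sqr_ge0 (x - 1); lra.
have g0 : 0 <= g by lra.
have := ler_wpM2l g0 le2; rewrite /a; lra.
Qed.

Lemma integral_prod_powR_lty (g : R) (n : nat) : 1 / 2 < g ->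
  (\int[lebesgue_Rn R n]_x (\prod_(i < n) (1 + tnth x i ^+ 2) `^ (- g))%:E < +oo)%E.
Proof.
move=> g12; have f0 m (x : Rn R m) : 0 <= \prod_(i < m) (1 + tnth x i ^+ 2) `^ (- g).
  by apply: prodr_ge0 => i _; exact: powR_ge0.
have mf m : measurable_fun setT (fun x : Rn R m => \prod_(i < m) (1 + tnth x i ^+ 2) `^ (- g)).
  apply: measurable_prod => i _.
  exact: (measurableT_comp (measurable_sqr1D_powR (- g)) (measurable_tnth i)).
elim: n => [|n IH].
  rewrite ge0_integral_lebesgue_Rn0.
  - by rewrite big_ord0 ltry.
  - by apply/measurable_EFinP; exact: mf.
  - by move=> x; rewrite lee_fin.
rewrite ge0_integral_lebesgue_RnS; last 2 first.
- by apply/measurable_EFinP; exact: mf.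
- by move=> x; rewrite lee_fin.
set I := (X in (X < _)%E) in IH.
have I0 : (0 <= I)%E by apply: integral_ge0 => x _; rewrite lee_fin.
apply: (@le_lt_trans _ _ (\int[mu]_a (((1 + a ^+ 2) `^ (- g))%:E * I))%E).
  rewrite le_eqVlt; apply/orP; left; apply/eqP; apply: eq_integral => a _.
  rewrite -ge0_integralZl_EFin ?powR_ge0//; last 2 first.
  - by move=> x _; rewrite lee_fin.
  - by apply/measurable_EFinP; exact: mf.
  apply: eq_integral => x _; rewrite -EFinM; congr EFin.
  rewrite big_ord_recl; congr (_ * _).
  by apply: eq_bigr => i _; rewrite /= tnthS.
rewrite -(fineK (_ : I \is a fin_num)); last by rewrite ge0_fin_numE.
under eq_integral do rewrite muleC -EFinM.
rewrite (ge0_integral_funZl mu (fine_ge0 I0) (measurable_sqr1D_powR (- g))); last first.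
  by move=> a; exact: powR_ge0.
by apply: lte_mul_pinfty; rewrite ?lee_fin ?fine_ge0// integral_sqr1D_powR_lty.
Qed.

Lemma prod_le_dotp (n : nat) (x : Rn R n) :
  \prod_(i < n) (1 + tnth x i ^+ 2) <= (1 + dotp x x) ^+ n.
Proof.
rewrite -[X in _ ^+ X]card_ord -prodr_const; apply: ler_prod => i _.
rewrite addr_ge0 ?sqr_ge0//= lerD2l /dotp (bigD1 i)//= -expr2 lerDl.
by apply: sumr_ge0 => j _; rewrite -expr2 sqr_ge0.
Qed.

Lemma measurable_dotp1D_powR (n : nat) (s : R) :
  measurable_fun setT (fun x : Rn R n => (1 + dotp x x) `^ s).
Proof.
apply: (measurableT_comp (measurable_powR s)).
by apply: measurable_funD => //; exact: measurable_dotpp.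
Qed.

(** Since (1 + |x|^2)^n dominates the product of the 1 + x_i^2, the integrand is at most the product
    of the (1 + x_i^2)^(-s/n). The condition s/n > 1/2 is exactly the one-dimensional condition, so
    this comparison loses nothing in the range of s. *)
Lemma integral_dotp1D_powR_lty (n : nat) (s : R) : (0 < n)%N -> n%:R / 2 < s ->
  (\int[lebesgue_Rn R n]_x ((1 + dotp x x) `^ (- s))%:E < +oo)%E.
Proof.
move=> n0 ns; have n1 : 0 < n%:R :> R by rewrite ltr0n.
pose g := s / n%:R.
have g12 : 1 / 2 < g by rewrite /g ltr_pdivlMr//; move: ns; lra.
have g0 : 0 < g by lra.
apply: le_lt_trans (integral_prod_powR_lty n g12).
apply: ge0_le_integral => //.
- by move=> x _; rewrite lee_fin powR_ge0.
- by apply/measurable_EFinP; exact: measurable_dotp1D_powR.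
- apply/measurable_EFinP; apply: measurable_prod => i _.
  exact: (measurableT_comp (measurable_sqr1D_powR (- g)) (measurable_tnth i)).
move=> x _; rewrite lee_fin.
have d0 : 0 < 1 + dotp x x by rewrite ltr_wpDr// dotpp_ge0.
have p0 i : 0 < 1 + tnth x i ^+ 2 by rewrite ltr_wpDr// sqr_ge0.
have pp : 0 < \prod_(i < n) (1 + tnth x i ^+ 2) by apply: prodr_gt0.
have -> : \prod_(i < n) (1 + tnth x i ^+ 2) `^ (- g) =
    (\prod_(i < n) (1 + tnth x i ^+ 2)) `^ (- g).
  apply/esym; apply: (big_morph_in Num.nneg (fun y => y `^ (- g))) => //.
  - by move=> a b; rewrite !nnegrE; exact: mulr_ge0.
  - by rewrite nnegrE.
  - by move=> a b; rewrite !nnegrE => *; rewrite powRM.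
  - by rewrite powR1.
  - by move=> i _; rewrite nnegrE ltW.
have -> : - s = n%:R * - g by rewrite /g mulrN mulrC divfK ?gt_eqF.
rewrite powRrM powR_mulrn ?(ltW d0)// !powRN lef_pV2 ?posrE ?powR_gt0 ?exprn_gt0//.
apply: ge0_ler_powR => //; rewrite ?nnegrE ?(ltW pp) ?(ltW g0) ?exprn_ge0 ?(ltW d0)//.
exact: prod_le_dotp.
Qed.

End power_integrals.

(** * Comparison of power integrals and norms on a finite measure space *)

Section finite_measure_norms.
Context d (T : measurableType d) (R : realType).
Variables (m : {measure set T -> \bar R}) (V : R).
Hypothesis mV : (m setT <= V%:E)%E.

(* Interpolating [g ^ e <= M ^ e (1 + (g / M) ^ p)] avoids Hoelder's inequality. *)
Lemma integral_powR_le_Lnorm (p : \bar R) (e M : R) (g : T -> R) :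
  0 <= e -> (e%:E <= p)%E -> 0 < M -> measurable_fun setT g -> (forall x, 0 <= g x) ->
  (Lnorm m p (EFin \o g) <= M%:E)%E ->
  (\int[m]_x (g x `^ e)%:E <= (M `^ e * (V + 1))%:E)%E.
Proof.
move=> e0; have mpow r : measurable_fun setT g -> measurable_fun setT (fun x => g x `^ r).
  by move=> mg; exact: (measurableT_comp (measurable_powR r)).
case: p => [p| |] ep M0 mg g0 gM; last by move: ep; rewrite leeNy_eq.
- rewrite lee_fin in ep.
  have [p0|p0] := eqVneq p 0.
    have -> : e = 0 by apply/eqP; rewrite eq_le e0 -p0 ep.
    under eq_integral do rewrite powRr0.
    rewrite integral_cst// mul1e powRr0 mul1r; apply: le_trans mV _.
    by rewrite lee_fin lerDl.
  have p1 : 0 < p by rewrite lt_neqAle eq_sym p0 (le_trans e0).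
  have gp : (\int[m]_x (g x `^ p)%:E <= (M `^ p)%:E)%E.
    have I0 : (0 <= \int[m]_x (g x `^ p)%:E)%E.
      by apply: integral_ge0 => x _; rewrite lee_fin powR_ge0.
    rewrite -[leLHS]poweRe1// -(mulVf p0) poweRrM -poweR_EFin.
    apply: gt0_ler_poweR; first exact: ltW.
    - by rewrite in_itv/= poweR_ge0 leey.
    - by rewrite in_itv/= lee_fin (ltW M0) leey.
    move: gM; rewrite unlock; under eq_integral => x _ do rewrite /= ger0_norm//.
    by [].
  have Me : 0 <= M `^ e by exact: powR_ge0.
  have Mp : 0 < M `^ p by exact: powR_gt0.
  apply: (@le_trans _ _ (\int[m]_x (M `^ e * (1 + (M `^ p)^-1 * g x `^ p))%:E)%E).
    apply: ge0_le_integral => //.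
    + by move=> x _; rewrite lee_fin powR_ge0.
    + by apply/measurable_EFinP; exact: mpow.
    + apply/measurable_EFinP; apply: measurable_funM => //.
      by apply: measurable_funD => //; apply: measurable_funM => //; exact: mpow.
    move=> x _; rewrite lee_fin.
    have [y [y0 ->]] : exists y, 0 <= y /\ g x = M * y.
      exists (g x / M); split; first by rewrite divr_ge0// ltW.
      by field; rewrite gt_eqF.
    rewrite !powRM ?(ltW M0)//; apply: ler_wpM2l => //.
    rewrite mulKf ?gt_eqF//.
    have [y1|y1] := leP y 1.
      apply: (@le_trans _ _ 1); last by rewrite lerDl powR_ge0.
      by have := ge0_ler_powR e0 (y0 : y \is Num.nneg) (ler01 : 1 \is Num.nneg) y1; rewrite powR1.
    apply: (@le_trans _ _ (y `^ p)); last by rewrite lerDr.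
    by apply: ler_powR => //; exact: ltW.
  rewrite ge0_integral_funZl//; last 2 first.
  + by apply: measurable_funD => //; apply: measurable_funM => //; exact: mpow.
  + by move=> x; rewrite addr_ge0// mulr_ge0 ?invr_ge0 ?powR_ge0.
  rewrite EFinM; apply: lee_wpmul2l; first by rewrite lee_fin.
  under eq_integral do rewrite EFinD.
  rewrite ge0_integralD//; last 2 first.
  + by move=> x _; rewrite lee_fin mulr_ge0 ?invr_ge0 ?powR_ge0.
  + by apply/measurable_EFinP; apply: measurable_funM => //; exact: mpow.
  rewrite integral_cst// mul1e EFinD; apply: leeD => //.
  rewrite ge0_integral_funZl ?invr_ge0 ?powR_ge0//; last 2 first.
  + exact: mpow.
  + by move=> x; exact: powR_ge0.
  apply: (@le_trans _ _ (((M `^ p)^-1)%:E * (M `^ p)%:E)%E).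
    by apply: lee_wpmul2l; rewrite ?lee_fin ?invr_ge0 ?powR_ge0.
  by rewrite -EFinM mulVf ?gt_eqF.
- have gM' : {ae m, forall x, g x <= M}.
    (* The norm at p = +oo is an essential supremum only when the space has positive measure; on a
       null space every almost-everywhere bound holds. *)
    have [m0|m0] := ltP 0%E (m setT); last first.
      exists setT; split => //; apply/eqP; rewrite eq_le m0; exact: measure_ge0.
    move: gM; rewrite unlock m0 => /ess_supP; apply: filterS => x /=.
    by rewrite lee_fin ger0_norm.
  apply: (@le_trans _ _ (\int[m]_x (cst (M `^ e)%:E x))%E).
    apply: ae_ge0_le_integral => //.
    + by move=> x _; rewrite lee_fin powR_ge0.
    + by apply/measurable_EFinP; exact: mpow.
    + by move=> x _; rewrite lee_fin powR_ge0.
    apply: filterS gM' => x gx _; rewrite lee_fin.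
    by apply: ge0_ler_powR; rewrite ?nnegrE// ltW.
  rewrite integral_cst// EFinM; apply: lee_wpmul2l; first by rewrite lee_fin powR_ge0.
  by apply: le_trans mV _; rewrite lee_fin lerDl.
Qed.

End finite_measure_norms.

(** * The shell of the cone *)

Section shell.
Context (R : realType) (k : nat).
Local Notation mu := (@lebesgue_measure R).
Local Notation D := (`[1, (2 : R)]%classic).
Local Notation L := (lebesgue_Rn R k.+2).
Local Notation RR := (measurableTypeR R).
Implicit Types (x xi eta : Rn R k.+2) (z : Rspacetime R k.+2).

Definition axis (r : R) : Rn R k.+2 := tuple_cons (r, [tuple of nseq k.+1 0]).

Lemma enorm_axis r : 0 <= r -> enorm (axis r) = r.
Proof.
move=> r0; rewrite /enorm /axis dotp_cons dotp0 addr0 -expr2 sqrtr_sqr.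
exact: ger0_norm.
Qed.

Lemma measurable_axis : measurable_fun setT (axis : RR -> Rn R k.+2).
Proof.
apply: (measurableT_comp (@measurable_tuple_cons R k.+1)).
exact/measurable_fun_pair.
Qed.

Lemma cone_shell_cone_point xi : cone_shell (cone_point xi) <-> D (enorm xi).
Proof. by rewrite /= in_itv/=; split=> [[_ //]|]. Qed.

Let muD : (mu D < +oo)%E.
Proof. by rewrite lebesgue_measure_itv/= lte_fin ltr1n -EFinB ltry. Qed.

(** It combines the density 1/|xi| of the cone measure with the restriction to the shell, as a
    function of |xi|. *)
Definition shell_weight (r : R) : R := \1_D r / r.

Lemma measurable_shell_weight : measurable_fun setT shell_weight.
Proof.
rewrite (_ : shell_weight = fun r => \1_D r * r `^ (-1)).
  by apply: measurable_funM; [exact: measurable_indic|exact: measurable_powR].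
apply/funext => r; rewrite /shell_weight indicE.
have [r1|_] := boolP (r \in D); last by rewrite !mul0r.
by rewrite powR_inv1//; move: r1; rewrite inE/= in_itv/=; lra.
Qed.

Lemma shell_weight_ge0 r : 0 <= shell_weight r.
Proof.
rewrite /shell_weight indicE; have [r1|_] := boolP (r \in D); last by rewrite mul0r.
by rewrite mul1r invr_ge0; move: r1; rewrite inE/= in_itv/=; lra.
Qed.

Lemma shell_weight_le1 r : shell_weight r <= 1.
Proof.
rewrite /shell_weight indicE; have [r1|_] := boolP (r \in D); last by rewrite mul0r.
have r2 : 1 <= r by move: r1; rewrite inE/= in_itv/=; lra.
by rewrite mul1r invf_le1//; lra.
Qed.

Lemma shell_weight_support r : ~ D r -> shell_weight r = 0.
Proof. by move=> nr; rewrite /shell_weight indicE memNset// mul0r. Qed.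

(** [shell_measure] is the image under [cone_point] of the measure with density
    [shell_weight (enorm xi)], because [cone_point xi] lies in the shell exactly when 1 <= |xi| <=
    2. *)
Lemma ge0_integral_shell (g : Rspacetime R k.+2 -> \bar R) :
  measurable_fun setT g -> (forall z, 0 <= g z)%E ->
  (\int[shell_measure]_z g z =
   \int[L]_xi (g (cone_point xi) * (shell_weight (enorm xi))%:E))%E.
Proof.
move=> mg g0.
pose w xi : \bar R := (shell_weight (enorm xi))%:E.
have mw : measurable_fun setT w.
  apply/measurable_EFinP; apply: (measurableT_comp measurable_shell_weight).
  exact: measurable_enorm.
have w0 xi : (0 <= w xi)%E by rewrite lee_fin shell_weight_ge0.
pose nu := pushforward (density_measure L mw w0) (@cone_point R k.+2).
transitivity (\int[nu]_z g z)%E.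
  apply: eq_measure_integral; first exact: measurable_cone_point.
  move=> mc A mA _.
  rewrite /nu /pushforward /density_measure /shell_measure /mrestr /cone_measure.
  rewrite [LHS]integral_mkcond [RHS]integral_mkcond; apply: eq_integral => xi _.
  rewrite !patchE /w /shell_weight indicE.
  have [D1|D1] := pselect (D (enorm xi)); last first.
    rewrite (memNset D1) mul0r memNset; first by case: ifP.
    by move=> -[_] /cone_shell_cone_point.
  rewrite [in RHS](mem_set D1) mul1r.
  congr (if _ then _ else _); apply/idP/idP; rewrite !inE/=; first by case.
  by move=> Axi; split => //; move: D1; rewrite /= in_itv.
rewrite ge0_integral_pushforward//; last exact: measurable_cone_point.
rewrite preimage_setT ge0_integral_density//; last by move=> xi; exact: g0.
exact: (measurableT_comp mg (@measurable_cone_point R k.+2)).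
Qed.

Lemma integral_shell_radial (G : R -> R) (g : Rspacetime R k.+2 -> R) :
  measurable_fun setT g -> (forall z, 0 <= g z) ->
  measurable_fun setT G -> (forall r, 0 <= G r) -> (forall r, ~ D r -> G r = 0) ->
  (forall xi, g (cone_point xi) = G (enorm xi)) ->
  (\int[shell_measure]_z (g z)%:E = \int[mu]_r (G r * (radial_kernel k 0 r / r))%:E)%E.
Proof.
move=> mg g0 mG G0 GD gG.
rewrite ge0_integral_shell//; last exact/measurable_EFinP.
under eq_integral do rewrite gG -EFinM.
rewrite (@ge0_integral_radial R k (fun r => (G r * shell_weight r)%:E)); last 3 first.
- by apply/measurable_EFinP; apply: measurable_funM => //; exact: measurable_shell_weight.
- by move=> r; rewrite lee_fin mulr_ge0// shell_weight_ge0.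
- by move=> r /GD ->; rewrite mul0r.
apply: eq_integral => r _; rewrite -EFinM; congr EFin.
have [r1|/GD ->] := pselect (D r); last by rewrite !mul0r.
by rewrite /shell_weight indicE mem_set// mul1r; ring.
Qed.

Lemma shell_measure_lty :
  (shell_measure [set: Rspacetime R k.+2] < +oo)%E.
Proof.
rewrite -[X in (X < _)%E]mul1e -integral_cst//.
rewrite ge0_integral_shell//.
under eq_integral do rewrite mul1e.
have ih : mu.-integrable setT (EFin \o shell_weight).
  apply: (@integrable_bounded_support _ RR _ mu D _ 1) => //.
  - exact: measurable_shell_weight.
  - by move=> r; rewrite ger0_norm ?shell_weight_ge0 ?shell_weight_le1.
  - exact: shell_weight_support.
rewrite (@ge0_integral_radial R k (EFin \o shell_weight)).
- have /integrableP[_] := integrable_radial_kernel k measurable_shell_weight shell_weight_support ih 0.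
  apply: le_lt_trans; rewrite le_eqVlt; apply/orP; left; apply/eqP.
  apply: eq_integral => r _ /=; rewrite -EFinM.
  have [r1|/shell_weight_support ->] := pselect (D r); last by rewrite !mul0r normr0.
  have r0 : 0 < r by move: r1; rewrite /= in_itv/=; lra.
  by rewrite ger0_norm// mulr_ge0 ?shell_weight_ge0// ltW// radial_kernel0_gt0.
- by apply/measurable_EFinP; exact: measurable_shell_weight.
- by move=> r; rewrite lee_fin shell_weight_ge0.
- by move=> r /shell_weight_support /= ->.
Qed.

(** Sampling g along a half-axis gives a measurable function of the radius, and cylindrical symmetry
    makes it represent g on the whole cone ([profile_enorm]). *)
Definition profile (g : Rspacetime R k.+2 -> R) (r : R) : R :=
  \1_D r * g (cone_point (axis r)).

Section profile_properties.
Variable g : Rspacetime R k.+2 -> R.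
Hypotheses (mg : measurable_fun setT g)
  (g_shell : forall z, ~ cone_shell z -> g z = 0)
  (g_sym : forall xi eta, enorm xi = enorm eta -> g (cone_point xi) = g (cone_point eta)).

Lemma measurable_profile : measurable_fun setT (profile g).
Proof.
apply: measurable_funM; first exact: measurable_indic.
apply: (measurableT_comp mg); apply: (measurableT_comp (@measurable_cone_point R k.+2)).
exact: measurable_axis.
Qed.

Lemma profile_support r : ~ D r -> profile g r = 0.
Proof. by move=> nr; rewrite /profile indicE memNset// mul0r. Qed.

Lemma profile_enorm xi : profile g (enorm xi) = g (cone_point xi).
Proof.
rewrite /profile indicE; have [D1|D1] := boolP (enorm xi \in D).
  rewrite mul1r; apply: g_sym; apply: enorm_axis; exact: enorm_ge0.
rewrite mul0r g_shell// => /cone_shell_cone_point.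
by apply/negP; rewrite notin_setE in D1; exact/negP.
Qed.

(** In polar form the shell measure has radial density c r^k, which is at least the constant c
    because r >= 1 on the support. This converts a bound on the shell into one for dr. *)
Lemma profile_powR_le (e B : R) : 0 < e ->
  (\int[shell_measure]_z (`|g z| `^ e)%:E <= B%:E)%E ->
  (\int[mu]_r (`|profile g r| `^ e)%:E <=
   (B / (ball_volume R k.+1 * (k.+1%:R * bessel_int k 0)))%:E)%E.
Proof.
move=> e0 gB; set c := ball_volume R k.+1 * _.
have c0 : 0 < c by rewrite !mulr_gt0 ?ball_volume_gt0 ?bessel_int0_gt0.
have mpow : measurable_fun setT (fun r => `|profile g r| `^ e).
  apply: (measurableT_comp (measurable_powR e)).
  by apply: measurableT_comp => //; exact: measurable_profile.
have mgpow : measurable_fun setT (fun z => `|g z| `^ e).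
  by apply: (measurableT_comp (measurable_powR e)); exact: measurableT_comp.
have pD r : ~ D r -> `|profile g r| `^ e = 0.
  by move=> nr; rewrite profile_support// normr0 powR0// gt_eqF.
move: gB; rewrite (integral_shell_radial mgpow (fun z => powR_ge0 _ _) mpow
  (fun r => powR_ge0 _ _) pD) => [|xi]; last by rewrite profile_enorm.
move=> gB; rewrite EFinM muleC -lee_pdivrMl ?lte_fin ?invr_gt0// -?EFinV ?gt_eqF// ?invrK.
apply: le_trans gB; rewrite -ge0_integral_funZl ?(ltW c0)//.
apply: ge0_le_integral => //.
- by move=> r _; rewrite lee_fin mulr_ge0 ?powR_ge0 ?(ltW c0).
- by apply/measurable_EFinP; exact: measurable_funM.
- apply/measurable_EFinP.
  rewrite (_ : (fun r => _) = fun r => `|profile g r| `^ e * (c * r ^+ k)).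
    by apply: measurable_funM => //; apply: measurable_funM => //; exact: measurable_funX.
  apply/funext => r; have [r1|/pD ->] := pselect (D r); last by rewrite !mul0r.
  have r0 : 0 < r by move: r1; rewrite /= in_itv/=; lra.
  rewrite /radial_kernel /c mul0r exprS; congr (_ * _); field; rewrite gt_eqF//.
move=> r _; rewrite lee_fin.
have [r1|/pD ->] := pselect (D r); last by rewrite mulr0 mul0r.
have r0 : 1 <= r by move: r1; rewrite /= in_itv/=; lra.
rewrite mulrC ler_wpM2l ?powR_ge0//.
have -> : radial_kernel k 0 r / r = c * r ^+ k.
  by rewrite /radial_kernel /c mul0r exprS; field; rewrite gt_eqF//; lra.
by rewrite ler_peMr ?(ltW c0)// exprn_ege1.
Qed.

End profile_properties.

End shell.

(** * The extension operator *)

Section complex_modulus.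
Context (R : realType).
Implicit Type z : R[i].

Lemma normr_Re_le_normc z : `|complex.Re z| <= Normc.normc z.
Proof.
case: z => a b /=; rewrite -sqrtr_sqr; apply: ler_wsqrtr.
by rewrite lerDl sqr_ge0.
Qed.

Lemma normr_Im_le_normc z : `|complex.Im z| <= Normc.normc z.
Proof.
case: z => a b /=; rewrite -sqrtr_sqr; apply: ler_wsqrtr.
by rewrite lerDr sqr_ge0.
Qed.

Lemma normc_ge0 z : 0 <= Normc.normc z.
Proof. by case: z => a b; exact: sqrtr_ge0. Qed.

Lemma normc_le_Re_Im z : Normc.normc z <= `|complex.Re z| + `|complex.Im z|.
Proof.
case: z => a b /=.
have ab : 0 <= `|a| + `|b| by rewrite addr_ge0.
rewrite -[leRHS]ger0_norm// -sqrtr_sqr; apply: ler_wsqrtr.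
rewrite sqrrD !real_normK ?num_real// -addrA lerD2l lerDr.
by rewrite mulrn_wge0// mulr_ge0.
Qed.

Lemma measurable_normc d (T : measurableType d) (f : T -> R[i]) :
  measurable_fun setT (fun x => complex.Re (f x)) ->
  measurable_fun setT (fun x => complex.Im (f x)) ->
  measurable_fun setT (fun x => Normc.normc (f x)).
Proof.
move=> mRe mIm.
rewrite (_ : (fun x => _) = fun x =>
    Num.sqrt (complex.Re (f x) ^+ 2 + complex.Im (f x) ^+ 2)); last first.
  by apply/funext => x; case: (f x).
apply: (@measurableT_comp _ _ _ _ _ _ (@Num.sqrt R)).
  by apply: continuous_measurable_fun; exact: sqrt_continuous.
by apply: measurable_funD; exact: measurable_funX.
Qed.

End complex_modulus.

Section extension_formula.
Context (R : realType) (k : nat).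
Local Notation mu := (@lebesgue_measure R).
Local Notation D := (`[1, (2 : R)]%classic).
Local Notation L := (lebesgue_Rn R k.+2).
Local Notation RR := (measurableTypeR R).
Implicit Types (x xi eta : Rn R k.+2) (z : Rspacetime R k.+2).

Definition radial_density (a : R -> R) (s r : R) : R :=
  a r * (shell_weight r * radial_kernel k s r).

Lemma measurable_radial_density a s : measurable_fun setT a ->
  measurable_fun setT (radial_density a s).
Proof.
move=> ma; apply: measurable_funM => //; apply: measurable_funM.
  exact: measurable_shell_weight.
by apply: continuous_measurable_fun; exact: continuous_radial_kernel.
Qed.

Lemma radial_density_support a s r : (forall r, ~ D r -> a r = 0) ->
  ~ D r -> radial_density a s r = 0.
Proof. by move=> aD nr; rewrite /radial_density aD// mul0r. Qed.

Lemma integrable_mul_bounded (a c : R -> R) (N : R) :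
  measurable_fun setT a -> measurable_fun setT c ->
  (forall r, ~ D r -> a r = 0) -> mu.-integrable setT (EFin \o a) ->
  (forall r, D r -> `|c r| <= N) ->
  mu.-integrable setT (EFin \o (fun r => a r * c r)).
Proof.
move=> ma mc aD ia cN.
apply: (@le_integrable _ _ _ mu _ measurableT _ (EFin \o (fun r => N * a r))).
- by apply/measurable_EFinP; exact: measurable_funM.
- move=> r _; rewrite /= lee_fin.
  have [r1|/aD ->] := pselect (D r); last by rewrite mul0r mulr0 normr0.
  rewrite !(normrM _ (a r)) (normrM (a r)) mulrC; apply: ler_wpM2r => //.
  by apply: le_trans (cN r r1) _; exact: ler_norm.
- exact: integrable_funZl.
Qed.

Variable f : Rspacetime R k.+2 -> R[i].
Hypotheses (mRe : measurable_fun setT (fun z => complex.Re (f z)))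
  (mIm : measurable_fun setT (fun z => complex.Im (f z)))
  (f_shell : forall z, ~ cone_shell z -> f z = 0)
  (f_sym : cylindrically_symmetric f).

Local Notation a := (profile (fun z => complex.Re (f z))).
Local Notation b := (profile (fun z => complex.Im (f z))).

Let ReD z : ~ cone_shell z -> complex.Re (f z) = 0.
Proof. by move=> nz; rewrite f_shell. Qed.

Let ImD z : ~ cone_shell z -> complex.Im (f z) = 0.
Proof. by move=> nz; rewrite f_shell. Qed.

Let Re_sym xi eta : enorm xi = enorm eta ->
  complex.Re (f (cone_point xi)) = complex.Re (f (cone_point eta)).
Proof. by move=> /f_sym ->. Qed.

Let Im_sym xi eta : enorm xi = enorm eta ->
  complex.Im (f (cone_point xi)) = complex.Im (f (cone_point eta)).
Proof. by move=> /f_sym ->. Qed.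

Let ma : measurable_fun setT a. Proof. exact: measurable_profile. Qed.
Let mb : measurable_fun setT b. Proof. exact: measurable_profile. Qed.
Let aD r : ~ D r -> a r = 0. Proof. exact: profile_support. Qed.
Let bD r : ~ D r -> b r = 0. Proof. exact: profile_support. Qed.

(** [psi1] and [psi2] are the real and imaginary parts of F(r) exp(i t r), weighted by
    [shell_weight]; they isolate the dependence on x in a plane wave. *)
Let psi1 t (r : R) := a r * (shell_weight r * cos (t * r)) - b r * (shell_weight r * sin (t * r)).
Let psi2 t (r : R) := a r * (shell_weight r * sin (t * r)) + b r * (shell_weight r * cos (t * r)).

Let weightE (g : R -> R) r : (forall r, ~ D r -> g r = 0) ->
  g r * r^-1 = g r * shell_weight r.
Proof.
move=> gD; have [r1|/gD ->] := pselect (D r); last by rewrite !mul0r.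
by rewrite /shell_weight indicE mem_set// mul1r.
Qed.

Let integrand x t xi : R[i] :=
  f (cone_point xi) * expi (phase (t, x) xi) * ((enorm xi)^-1)%:C%C.

Let Re_integrand t x xi : complex.Re (integrand x t xi) =
  psi1 t (enorm xi) * cos (dotp x xi) - psi2 t (enorm xi) * sin (dotp x xi).
Proof.
rewrite /integrand /psi1 /psi2 /expi /phase/=.
have := weightE (enorm xi) aD; have := weightE (enorm xi) bD.
rewrite (profile_enorm ReD Re_sym xi) (profile_enorm ImD Im_sym xi).
case: (f (cone_point xi)) => A B /= wB wA.
rewrite mulr0 subr0 cosD sinD; set d := dotp x xi; set u := t * enorm xi.
transitivity (A * (enorm xi)^-1 * (cos d * cos u - sin d * sin u) -
  B * (enorm xi)^-1 * (sin d * cos u + cos d * sin u)); first by ring.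
by rewrite wA wB; ring.
Qed.

Let Im_integrand t x xi : complex.Im (integrand x t xi) =
  psi2 t (enorm xi) * cos (dotp x xi) + psi1 t (enorm xi) * sin (dotp x xi).
Proof.
rewrite /integrand /psi1 /psi2 /expi /phase/=.
have := weightE (enorm xi) aD; have := weightE (enorm xi) bD.
rewrite (profile_enorm ReD Re_sym xi) (profile_enorm ImD Im_sym xi).
case: (f (cone_point xi)) => A B /= wB wA.
rewrite mulr0 add0r cosD sinD; set d := dotp x xi; set u := t * enorm xi.
transitivity (A * (enorm xi)^-1 * (sin d * cos u + cos d * sin u) +
  B * (enorm xi)^-1 * (cos d * cos u - sin d * sin u)); first by ring.
by rewrite wA wB; ring.
Qed.

Let mcos t : measurable_fun setT (fun r : R => cos (t * r)).
Proof. by apply: (measurableT_comp (@measurable_cosR R)); exact: measurable_funM. Qed.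

Let msin t : measurable_fun setT (fun r : R => sin (t * r)).
Proof. by apply: (measurableT_comp (@measurable_sinR R)); exact: measurable_funM. Qed.

Let cos1 (u : R) : `|cos u| <= 1. Proof. by rewrite ler_norml cos_geN1 cos_le1. Qed.
Let sin1 (u : R) : `|sin u| <= 1. Proof. by rewrite ler_norml sin_geN1 sin_le1. Qed.

Let mwcos t : measurable_fun setT (fun r : R => shell_weight r * cos (t * r)).
Proof. by apply: measurable_funM => //; exact: measurable_shell_weight. Qed.

Let mwsin t : measurable_fun setT (fun r : R => shell_weight r * sin (t * r)).
Proof. by apply: measurable_funM => //; exact: measurable_shell_weight. Qed.

Let weight1 (r : R) : `|shell_weight r| <= 1.
Proof. by rewrite ger0_norm ?shell_weight_ge0 ?shell_weight_le1. Qed.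

Let wcos1 (t r : R) : `|shell_weight r * cos (t * r)| <= 1.
Proof. by rewrite normrM mulr_ile1. Qed.

Let wsin1 (t r : R) : `|shell_weight r * sin (t * r)| <= 1.
Proof. by rewrite normrM mulr_ile1. Qed.

Let mpsi1 t : measurable_fun setT (psi1 t).
Proof. by apply: measurable_funB; exact: measurable_funM. Qed.

Let mpsi2 t : measurable_fun setT (psi2 t).
Proof. by apply: measurable_funD; exact: measurable_funM. Qed.

Let psi1D t r : ~ D r -> psi1 t r = 0.
Proof. by move=> nr; rewrite /psi1 aD// bD// !mul0r subr0. Qed.

Let psi2D t r : ~ D r -> psi2 t r = 0.
Proof. by move=> nr; rewrite /psi2 aD// bD// !mul0r addr0. Qed.

Section integrable_profiles.
Hypotheses (ia : mu.-integrable setT (EFin \o a)) (ib : mu.-integrable setT (EFin \o b)).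

Let ipsi1 t : mu.-integrable setT (EFin \o psi1 t).
Proof.
have i1 := integrable_mul_bounded ma (mwcos t) aD ia (fun r _ => wcos1 t r).
have i2 := integrable_mul_bounded mb (mwsin t) bD ib (fun r _ => wsin1 t r).
have := integrable_funD i1 (integrable_funZl (-1) i2).
by rewrite /psi1; under eq_fun do rewrite mulN1r.
Qed.

Let ipsi2 t : mu.-integrable setT (EFin \o psi2 t).
Proof.
have i1 := integrable_mul_bounded ma (mwsin t) aD ia (fun r _ => wsin1 t r).
have i2 := integrable_mul_bounded mb (mwcos t) bD ib (fun r _ => wcos1 t r).
exact: integrable_funD i1 i2.
Qed.

Let mcosdot x : measurable_fun setT (fun xi => cos (dotp x xi)).
Proof. exact: (measurableT_comp (@measurable_cosR R) (measurable_dotp x)). Qed.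

Let msindot x : measurable_fun setT (fun xi => sin (dotp x xi)).
Proof. exact: (measurableT_comp (@measurable_sinR R) (measurable_dotp x)). Qed.

Let icos t x := integrable_radial (mpsi1 t) (@psi1D t) (ipsi1 t) (mcosdot x) (fun xi => cos1 _).
Let isin t x := integrable_radial (mpsi1 t) (@psi1D t) (ipsi1 t) (msindot x) (fun xi => sin1 _).
Let icos2 t x := integrable_radial (mpsi2 t) (@psi2D t) (ipsi2 t) (mcosdot x) (fun xi => cos1 _).
Let isin2 t x := integrable_radial (mpsi2 t) (@psi2D t) (ipsi2 t) (msindot x) (fun xi => sin1 _).

Let mrk s : measurable_fun setT (radial_kernel k (s : R)).
Proof. by apply: continuous_measurable_fun; exact: continuous_radial_kernel. Qed.

Let idens (g : R -> R) (c : R -> R) s : measurable_fun setT g ->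
  (forall r, ~ D r -> g r = 0) -> mu.-integrable setT (EFin \o g) ->
  measurable_fun setT c -> (forall r, `|c r| <= 1) ->
  mu.-integrable setT (EFin \o (fun r => radial_density g s r * c r)).
Proof.
move=> mg gD ig mc c1.
have -> : (fun r => radial_density g s r * c r) =
    (fun r => g r * (shell_weight r * radial_kernel k s r * c r)).
  by apply/funext => r; rewrite /radial_density !mulrA.
apply: (integrable_mul_bounded (N := ball_volume R k.+1 * (k.+1%:R * 2 ^+ k.+1 * pi))) => //.
  apply: measurable_funM => //; apply: measurable_funM => //.
  exact: measurable_shell_weight.
move=> r r1; have := radial_kernel_le k s r1; have := weight1 r; have := c1 r.
move: (radial_kernel k s r) (shell_weight r) (c r) => u v w w1 v1 uC.
rewrite !normrM -[leRHS]mulr1 -[X in _ <= X * _]mul1r.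
by apply: ler_pM => //; exact: ler_pM.
Qed.

(** Expanding cos and sin of x.xi + t|xi| leaves radial profiles times cos(x.xi) or sin(x.xi). The
    sine terms integrate to 0, and the cosine terms become one-dimensional transforms in t with the
    radial kernel as density. *)
Lemma Re_cone_extension t x : complex.Re (cone_extension f (t, x)) =
  real_fourier (@cos_kernel R) (radial_density a (enorm x)) t -
  real_fourier (@sin_kernel R) (radial_density b (enorm x)) t.
Proof.
rewrite /cone_extension /cRintegral/= -/(integrand x t).
rewrite (eq_RintegralT _ (Re_integrand t x)).
rewrite (RintegralB measurableT (icos t x) (isin2 t x)).
rewrite (Rintegral_radial_cos x (mpsi1 t) (@psi1D t) (ipsi1 t)).
rewrite (Rintegral_radial_sin x (mpsi2 t) (@psi2D t) (ipsi2 t)) subr0.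
apply: etrans _ (RintegralB measurableT
  (idens (enorm x) ma aD ia (mcos t) (fun r => cos1 _))
  (idens (enorm x) mb bD ib (msin t) (fun r => sin1 _))).
apply: eq_RintegralT => r; rewrite /psi1 /radial_density; ring.
Qed.

Lemma Im_cone_extension t x : complex.Im (cone_extension f (t, x)) =
  real_fourier (@sin_kernel R) (radial_density a (enorm x)) t +
  real_fourier (@cos_kernel R) (radial_density b (enorm x)) t.
Proof.
rewrite /cone_extension /cRintegral/= -/(integrand x t).
rewrite (eq_RintegralT _ (Im_integrand t x)).
rewrite (RintegralD measurableT (icos2 t x) (isin t x)).
rewrite (Rintegral_radial_cos x (mpsi2 t) (@psi2D t) (ipsi2 t)).
rewrite (Rintegral_radial_sin x (mpsi1 t) (@psi1D t) (ipsi1 t)) addr0.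
apply: etrans _ (RintegralD measurableT
  (idens (enorm x) ma aD ia (msin t) (fun r => sin1 _))
  (idens (enorm x) mb bD ib (mcos t) (fun r => cos1 _))).
apply: eq_RintegralT => r; rewrite /psi2 /radial_density; ring.
Qed.

End integrable_profiles.

Let mphase : measurable_fun setT
  (fun w : Rspacetime R k.+2 * Rn R k.+2 => phase w.1 w.2).
Proof.
apply: measurable_funD.
  apply: measurable_sum => i; apply: measurable_funM.
    apply: (measurableT_comp (measurable_tnth i)).
    exact: (measurableT_comp measurable_snd measurable_fst).
  exact: (measurableT_comp (measurable_tnth i) measurable_snd).
apply: measurable_funM; first exact: (measurableT_comp measurable_fst measurable_fst).
exact: (measurableT_comp (@measurable_enorm R k.+2) measurable_snd).
Qed.

Let mprofile (g : R -> R) : measurable_fun setT g ->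
  measurable_fun setT (fun w : Rspacetime R k.+2 * Rn R k.+2 =>
    g (enorm w.2) * shell_weight (enorm w.2)).
Proof.
move=> mg.
have me : measurable_fun setT (fun w : Rspacetime R k.+2 * Rn R k.+2 => enorm w.2).
  exact: (measurableT_comp (@measurable_enorm R k.+2) measurable_snd).
apply: measurable_funM; first exact: (measurableT_comp mg me).
exact: (measurableT_comp (@measurable_shell_weight R) me).
Qed.

Let joint_Re z xi :
  complex.Re (f (cone_point xi) * expi (phase z xi) * ((enorm xi)^-1)%:C%C) =
  a (enorm xi) * shell_weight (enorm xi) * cos (phase z xi) -
  b (enorm xi) * shell_weight (enorm xi) * sin (phase z xi).
Proof.
rewrite -!weightE// (profile_enorm ReD Re_sym xi) (profile_enorm ImD Im_sym xi) /expi.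
case: (f (cone_point xi)) => A B /=; rewrite mulr0 subr0; ring.
Qed.

Let joint_Im z xi :
  complex.Im (f (cone_point xi) * expi (phase z xi) * ((enorm xi)^-1)%:C%C) =
  a (enorm xi) * shell_weight (enorm xi) * sin (phase z xi) +
  b (enorm xi) * shell_weight (enorm xi) * cos (phase z xi).
Proof.
rewrite -!weightE// (profile_enorm ReD Re_sym xi) (profile_enorm ImD Im_sym xi) /expi.
case: (f (cone_point xi)) => A B /=; rewrite mulr0 add0r; ring.
Qed.

Lemma measurable_Re_cone_extension :
  measurable_fun setT (fun z => complex.Re (cone_extension f z)).
Proof.
rewrite /cone_extension /cRintegral/=.
apply: (@measurable_Rintegral_param _ _ _ _ _ L (fun w : Rspacetime R k.+2 * Rn R k.+2 =>
  complex.Re (f (cone_point w.2) * expi (phase w.1 w.2) * ((enorm w.2)^-1)%:C%C))).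
under eq_fun do rewrite joint_Re.
apply: measurable_funB; apply: measurable_funM; try exact: mprofile.
  exact: (measurableT_comp (@measurable_cosR R) mphase).
exact: (measurableT_comp (@measurable_sinR R) mphase).
Qed.

Lemma measurable_Im_cone_extension :
  measurable_fun setT (fun z => complex.Im (cone_extension f z)).
Proof.
rewrite /cone_extension /cRintegral/=.
apply: (@measurable_Rintegral_param _ _ _ _ _ L (fun w : Rspacetime R k.+2 * Rn R k.+2 =>
  complex.Im (f (cone_point w.2) * expi (phase w.1 w.2) * ((enorm w.2)^-1)%:C%C))).
under eq_fun do rewrite joint_Im.
apply: measurable_funD; apply: measurable_funM; try exact: mprofile.
  exact: (measurableT_comp (@measurable_sinR R) mphase).
exact: (measurableT_comp (@measurable_cosR R) mphase).
Qed.

(** The exponential has modulus 1, so the L^1 norm bounds the real and the imaginary part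
    separately; this is the origin of the factor 2. *)
Lemma normc_cone_extension_le (B : R) z :
  (\int[shell_measure]_w (Normc.normc (f w))%:E <= B%:E)%E ->
  Normc.normc (cone_extension f z) <= 2 * B.
Proof.
move=> fB.
pose N xi := Normc.normc (f (cone_point xi)) * shell_weight (enorm xi).
have mN : measurable_fun setT N.
  apply: measurable_funM.
    exact: (measurableT_comp (measurable_normc mRe mIm) (@measurable_cone_point R k.+2)).
  exact: (measurableT_comp (@measurable_shell_weight R) (@measurable_enorm R k.+2)).
have N0 xi : 0 <= N xi by rewrite mulr_ge0 ?normc_ge0 ?shell_weight_ge0.
have NB : (\int[L]_xi (N xi)%:E <= B%:E)%E.
  apply: le_trans fB; rewrite ge0_integral_shell.
  - by rewrite le_eqVlt; apply/orP; left; apply/eqP; apply: eq_integral => xi _; rewrite -EFinM.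
  - by apply/measurable_EFinP; exact: measurable_normc.
  - by move=> w; rewrite lee_fin normc_ge0.
have part (g : Rn R k.+2 -> R) : measurable_fun setT g -> (forall xi, `|g xi| <= N xi) ->
    `|\int[L]_xi g xi| <= B.
  move=> mg gN.
  have le1 : (\int[L]_xi (`|g xi|)%:E <= B%:E)%E.
    apply: le_trans NB; apply: ge0_le_integral => //.
    - by apply/measurable_EFinP; exact: measurableT_comp.
    - exact/measurable_EFinP.
    - by move=> xi _; rewrite lee_fin.
  have ig : L.-integrable setT (EFin \o g).
    apply/integrableP; split; first exact/measurable_EFinP.
    exact: le_lt_trans le1 (ltry _).
  rewrite -lee_fin; apply: le_trans le1.
  rewrite EFin_Rintegral; last exact: (integrable_norm ig).
  by rewrite lee_fin; exact: le_normr_Rintegral.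
have mz : measurable_fun setT (fun xi => phase z xi).
  exact: (measurable_comp measurableT (@subsetT _ _) mphase (measurable_pair1 z)).
have mw (g : R -> R) : measurable_fun setT g ->
    measurable_fun setT (fun xi : Rn R k.+2 => g (enorm xi) * shell_weight (enorm xi)).
  move=> mg; exact: (measurable_comp measurableT (@subsetT _ _) (mprofile mg) (measurable_pair1 z)).
have normN xi : Normc.normc (f (cone_point xi) * expi (phase z xi) * ((enorm xi)^-1)%:C%C) = N xi.
  rewrite !Normc.normcM /N.
  have -> : Normc.normc (expi (phase z xi)) = 1.
    by rewrite /expi/= cos2Dsin2 sqrtr1.
  have -> : Normc.normc (((enorm xi)^-1)%:C%C) = (enorm xi)^-1.
    by rewrite /= expr0n/= addr0 sqrtr_sqr ger0_norm// invr_ge0 enorm_ge0.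
  rewrite mulr1.
  have [D1|D1] := pselect (D (enorm xi)).
    by rewrite /shell_weight indicE mem_set// mul1r.
  rewrite f_shell; last by move/cone_shell_cone_point.
  by rewrite Normc.normc0 !mul0r.
rewrite mulr2n mulrDl mul1r; apply: le_trans (normc_le_Re_Im _) _.
rewrite /cone_extension /cRintegral/=; apply: lerD; apply: part.
- under eq_fun do rewrite joint_Re.
  apply: measurable_funB; apply: measurable_funM; try exact: mw.
    exact: (measurableT_comp (@measurable_cosR R) mz).
  exact: (measurableT_comp (@measurable_sinR R) mz).
- by move=> xi; rewrite -normN; exact: normr_Re_le_normc.
- under eq_fun do rewrite joint_Im.
  apply: measurable_funD; apply: measurable_funM; try exact: mw.
    exact: (measurableT_comp (@measurable_sinR R) mz).
  exact: (measurableT_comp (@measurable_cosR R) mz).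
- by move=> xi; rewrite -normN; exact: normr_Im_le_normc.
Qed.

End extension_formula.

(** * The restriction estimate *)

Section restriction.
Context (R : realType) (k : nat).
Local Notation mu := (@lebesgue_measure R).
Local Notation D := (`[1, (2 : R)]%classic).
Local Notation L := (lebesgue_Rn R k.+2).
Local Notation RR := (measurableTypeR R).
Implicit Types (x xi eta : Rn R k.+2) (z : Rspacetime R k.+2).

Lemma powRD_le (q x y : R) : 0 <= q -> 0 <= x -> 0 <= y ->
  (x + y) `^ q <= 2 `^ q * (x `^ q + y `^ q).
Proof.
move=> q0; wlog xy : x y / x <= y => [wl|x0 y0].
  move=> x0 y0; have [xy|/ltW yx] := leP x y; first exact: wl.
  by rewrite addrC [_ `^ q + _]addrC; exact: wl.
apply: (@le_trans _ _ ((2 * y) `^ q)).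
  apply: ge0_ler_powR; rewrite ?nnegrE ?addr_ge0 ?mulr_ge0//; lra.
by rewrite powRM// ler_wpM2l ?powR_ge0// lerDr powR_ge0.
Qed.

Let pi12 : 0 <= 12 * pi :> R.
Proof. by rewrite mulr_ge0// pi_ge0. Qed.

Lemma hausdorff_young_cos (q : R) : 2 < q -> exists2 C : R, 0 <= C &
  forall (h : R -> R) (A : R), measurable_fun setT h ->
    (forall r, ~ D r -> h r = 0) -> 0 < A ->
    (\int[mu]_r (`|h r| `^ (q / (q - 1)))%:E <= A%:E)%E ->
    (\int[mu]_t (`|real_fourier (@cos_kernel R) h t| `^ q)%:E <= (C * A `^ (q - 1))%:E)%E.
Proof.
apply: (hausdorff_young (@measurable_cos_kernel R) _ pi12).
- by move=> t r; rewrite ler_norml cos_geN1 cos_le1.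
- by move=> h M mh hM hD; exact: (plancherel_cos mh hM hD).
Qed.

Lemma hausdorff_young_sin (q : R) : 2 < q -> exists2 C : R, 0 <= C &
  forall (h : R -> R) (A : R), measurable_fun setT h ->
    (forall r, ~ D r -> h r = 0) -> 0 < A ->
    (\int[mu]_r (`|h r| `^ (q / (q - 1)))%:E <= A%:E)%E ->
    (\int[mu]_t (`|real_fourier (@sin_kernel R) h t| `^ q)%:E <= (C * A `^ (q - 1))%:E)%E.
Proof.
apply: (hausdorff_young (@measurable_sin_kernel R) _ pi12).
- by move=> t r; rewrite ler_norml sin_geN1 sin_le1.
- by move=> h M mh hM hD; exact: (plancherel_sin mh hM hD).
Qed.

(** Pointwise, |a| is at most the indicator of [1, 2] plus |a|^e. *)
Lemma integrable_of_powR (a : R -> R) (e N : R) : 1 <= e ->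
  measurable_fun setT a -> (forall r, ~ D r -> a r = 0) ->
  (\int[mu]_r (`|a r| `^ e)%:E <= N%:E)%E -> mu.-integrable setT (EFin \o a).
Proof.
move=> e1 ma aD aN; apply/integrableP; split; first exact/measurable_EFinP.
have mpow : measurable_fun setT (fun r => `|a r| `^ e).
  by apply: (measurableT_comp (measurable_powR e)); exact: measurableT_comp.
apply: (@le_lt_trans _ _ (\int[mu]_r ((\1_D r : R) + `|a r| `^ e)%:E)%E).
  apply: ge0_le_integral => //.
  - by apply: measurableT_comp => //; exact/measurable_EFinP.
  - by apply/measurable_EFinP; apply: measurable_funD => //; exact: measurable_indic.
  move=> r _; rewrite /= lee_fin indicE.
  have [r1|/aD ->] := pselect (D r); last by rewrite normr0 addr_ge0 ?powR_ge0.
  rewrite mem_set//; have [a1|a1] := leP `|a r| 1.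
    by apply: (le_trans a1); rewrite lerDl powR_ge0.
  by apply: (@le_trans _ _ (`|a r| `^ e)); [exact: le1r_powR (ltW a1) e1|rewrite lerDr].
under eq_integral do rewrite EFinD.
rewrite ge0_integralD//; last 2 first.
- by apply/measurable_EFinP; exact: measurable_indic.
- exact/measurable_EFinP.
rewrite integral_indic// setIT lte_add_pinfty//.
  by change (mu D < +oo)%E; rewrite lebesgue_measure_itv/= lte_fin ltr1n -EFinB ltry.
exact: le_lt_trans aN (ltry _).
Qed.

Lemma radial_density_powR_le (Cd e N : R) (a : R -> R) x : 0 < Cd -> 0 < e ->
  (forall s r : R, 0 <= s -> D r ->
    `|radial_kernel k s r / r| <= Cd * (1 + s ^+ 2) `^ (- (k.+1%:R / 4))) ->
  measurable_fun setT a -> (forall r, ~ D r -> a r = 0) ->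
  (\int[mu]_r (`|a r| `^ e)%:E <= N%:E)%E ->
  (\int[mu]_r (`|radial_density k a (enorm x) r| `^ e)%:E <=
   ((Cd * (1 + dotp x x) `^ (- (k.+1%:R / 4))) `^ e * N)%:E)%E.
Proof.
move=> Cd0 e0 decay ma aD aN.
have mpow (g : R -> R) : measurable_fun setT g -> measurable_fun setT (fun r : R => `|g r| `^ e).
  move=> mg; apply: (measurableT_comp (measurable_powR e)); exact: measurableT_comp.
set W := Cd * _; have W0 : 0 <= W by rewrite mulr_ge0 ?powR_ge0 ?ltW.
apply: (@le_trans _ _ (\int[mu]_r (W `^ e * `|a r| `^ e)%:E)%E).
  apply: ge0_le_integral => //.
  - by apply/measurable_EFinP; apply: mpow; exact: measurable_radial_density.
  - by apply/measurable_EFinP; apply: measurable_funM => //; exact: mpow.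
  move=> r _; rewrite lee_fin -powRM//.
  apply: ge0_ler_powR; rewrite ?nnegrE ?(ltW e0)//; first exact: mulr_ge0.
  rewrite /radial_density; have [r1|/aD ->] := pselect (D r); last by rewrite mul0r normr0 mulr0.
  rewrite normrM mulrC; apply: ler_wpM2r => //.
  have := decay _ _ (enorm_ge0 x) r1; rewrite sqr_enorm -/W.
  by rewrite /shell_weight indicE mem_set// mul1r mulrC.
rewrite (ge0_integral_funZl mu (powR_ge0 _ _) (mpow _ ma)) => [|r]; last exact: powR_ge0.
by rewrite [leRHS]EFinM; apply: lee_wpmul2l; rewrite ?lee_fin ?powR_ge0.
Qed.

Lemma integral_le_sum4 (G : R -> R) (K : R) (F1 F2 F3 F4 : R -> R) (b1 b2 b3 b4 : R) :
  (forall t, 0 <= G t) ->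
  measurable_fun setT G -> measurable_fun setT F1 -> measurable_fun setT F2 ->
  measurable_fun setT F3 -> measurable_fun setT F4 -> 0 <= K ->
  (forall t, 0 <= F1 t) -> (forall t, 0 <= F2 t) ->
  (forall t, 0 <= F3 t) -> (forall t, 0 <= F4 t) ->
  (forall t, G t <= K * (F1 t + F2 t + (F3 t + F4 t))) ->
  (\int[mu]_t (F1 t)%:E <= b1%:E)%E -> (\int[mu]_t (F2 t)%:E <= b2%:E)%E ->
  (\int[mu]_t (F3 t)%:E <= b3%:E)%E -> (\int[mu]_t (F4 t)%:E <= b4%:E)%E ->
  (\int[mu]_t (G t)%:E <= (K * (b1 + b2 + (b3 + b4)))%:E)%E.
Proof.
move=> G0 mG mF1 mF2 mF3 mF4 K0 F10 F20 F30 F40 GF h1 h2 h3 h4.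
have ge0D (f g : R -> R) : (forall t, 0 <= f t) -> (forall t, 0 <= g t) ->
    measurable_fun setT f -> measurable_fun setT g ->
    (\int[mu]_t (f t + g t)%:E = \int[mu]_t (f t)%:E + \int[mu]_t (g t)%:E)%E.
  move=> f0 g0 mf mg; under eq_integral do rewrite EFinD.
  by rewrite ge0_integralD//; first [by move=> t _; rewrite lee_fin|exact/measurable_EFinP].
have m12 : measurable_fun setT (fun t => F1 t + F2 t) by exact: measurable_funD.
have m34 : measurable_fun setT (fun t => F3 t + F4 t) by exact: measurable_funD.
have p12 t : 0 <= F1 t + F2 t by exact: addr_ge0.
have p34 t : 0 <= F3 t + F4 t by exact: addr_ge0.
have m1234 : measurable_fun setT (fun t => F1 t + F2 t + (F3 t + F4 t)) by exact: measurable_funD.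
apply: (@le_trans _ _ (\int[mu]_t (K * (F1 t + F2 t + (F3 t + F4 t)))%:E)%E).
  apply: ge0_le_integral => //; try by move=> t _; rewrite lee_fin.
  - exact/measurable_EFinP.
  - by apply/measurable_EFinP; exact: measurable_funM.
rewrite (ge0_integral_funZl mu K0 m1234) => [|t]; last exact: addr_ge0.
rewrite (ge0D _ _ p12 p34 m12 m34) (ge0D _ _ F10 F20 mF1 mF2) (ge0D _ _ F30 F40 mF3 mF4).
rewrite EFinM; apply: lee_wpmul2l; first by rewrite lee_fin.
by rewrite !EFinD; apply: leeD; exact: leeD.
Qed.

Lemma cone_extension_powR_le (q : R) : 2 * k.+2%:R / k.+1%:R < q ->
  exists2 C : R, 0 <= C & forall (f : Rspacetime R k.+2 -> R[i]) (B : R),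
    measurable_fun setT (fun z => complex.Re (f z)) ->
    measurable_fun setT (fun z => complex.Im (f z)) ->
    (forall z, ~ cone_shell z -> f z = 0) -> cylindrically_symmetric f -> 0 < B ->
    (\int[shell_measure]_z (Normc.normc (f z) `^ (q / (q - 1)))%:E <= B%:E)%E ->
    (\int[(mu \x L)%E]_z (Normc.normc (cone_extension f z) `^ q)%:E <=
     (C * B `^ (q - 1))%:E)%E.
Proof.
move=> qk; have k1 : 0 < k.+1%:R :> R by rewrite ltr0n.
have q2 : 2 < q.
  apply: lt_trans qk; rewrite ltr_pdivlMr// ltr_pM2l// ltr_nat; exact: ltnSn.
have q0 : 0 < q by lra.
have q1 : 0 < q - 1 by lra.
pose p := q / (q - 1).
have p0 : 0 < p by rewrite divr_gt0.
have p1 : 1 <= p by rewrite /p ler_pdivlMr// mul1r; lra.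
have [Cc Cc0 HYc] := hausdorff_young_cos q2.
have [Cs Cs0 HYs] := hausdorff_young_sin q2.
have [Cd Cd0 decay] := radial_kernel_decay R k.
(* For n = k + 2, s is the decay exponent (n-1)/4 multiplied by q. The condition s > n/2 for
   integrability in x is the hypothesis q > 2n/(n-1). *)
pose s := k.+1%:R / 4 * q.
have ns : k.+2%:R / 2 < s.
  rewrite /s; move: qk; rewrite ltr_pdivrMr// => qk; lra.
pose I := (\int[L]_x ((1 + dotp x x) `^ (- s))%:E)%E.
have Ioo : (I < +oo)%E by exact: integral_dotp1D_powR_lty.
have I0 : (0 <= I)%E by apply: integral_ge0 => x _; rewrite lee_fin powR_ge0.
pose c := ball_volume R k.+1 * (k.+1%:R * bessel_int k 0).
have c0 : 0 < c by rewrite !mulr_gt0 ?ball_volume_gt0 ?bessel_int0_gt0.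
(* The real and imaginary parts each consist of two transforms: splitting the modulus and then each
   part costs 2^q twice, and the four transforms contribute [2 * Cc + 2 * Cs]. *)
pose K := 2 `^ q * 2 `^ q * (2 * Cc + 2 * Cs) * Cd `^ q.
have K0 : 0 <= K.
  by rewrite /K; apply: mulr_ge0; rewrite ?powR_ge0// !mulr_ge0 ?powR_ge0// addr_ge0// mulr_ge0.
exists (K * c^-1 `^ (q - 1) * fine I).
  by apply: mulr_ge0; [apply: mulr_ge0 => //; exact: powR_ge0|exact: fine_ge0].
move=> f B mRe mIm f_shell f_sym B0 fB.
pose a := profile (fun z => complex.Re (f z)).
pose b := profile (fun z => complex.Im (f z)).
have ReD z : ~ cone_shell z -> complex.Re (f z) = 0 by move=> nz; rewrite f_shell.
have ImD z : ~ cone_shell z -> complex.Im (f z) = 0 by move=> nz; rewrite f_shell.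
have Re_sym xi eta : enorm xi = enorm eta ->
  complex.Re (f (cone_point xi)) = complex.Re (f (cone_point eta)) by move=> /f_sym ->.
have Im_sym xi eta : enorm xi = enorm eta ->
  complex.Im (f (cone_point xi)) = complex.Im (f (cone_point eta)) by move=> /f_sym ->.
have ma : measurable_fun setT a by exact: measurable_profile.
have mb : measurable_fun setT b by exact: measurable_profile.
have aD r : ~ D r -> a r = 0 by exact: profile_support.
have bD r : ~ D r -> b r = 0 by exact: profile_support.
pose N := B / c.
have N0 : 0 < N by rewrite divr_gt0.
have part (g : Rspacetime R k.+2 -> R) : measurable_fun setT g ->
    (forall z, `|g z| <= Normc.normc (f z)) ->
    (\int[shell_measure]_z (`|g z| `^ p)%:E <= B%:E)%E.
  move=> mg gf; apply: le_trans fB; apply: ge0_le_integral => //.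
  - apply/measurable_EFinP; apply: (measurableT_comp (measurable_powR p)).
    exact: measurableT_comp.
  - apply/measurable_EFinP; apply: (measurableT_comp (measurable_powR p)).
    exact: measurable_normc.
  move=> z _; rewrite lee_fin; apply: ge0_ler_powR; rewrite ?nnegrE ?normc_ge0 ?(ltW p0)//.
have aN : (\int[mu]_r (`|a r| `^ p)%:E <= N%:E)%E.
  apply: (profile_powR_le mRe ReD Re_sym p0); apply: part => // z.
  exact: normr_Re_le_normc.
have bN : (\int[mu]_r (`|b r| `^ p)%:E <= N%:E)%E.
  apply: (profile_powR_le mIm ImD Im_sym p0); apply: part => // z.
  exact: normr_Im_le_normc.
have ia := integrable_of_powR p1 ma aD aN.
have ib := integrable_of_powR p1 mb bD bN.
have mnorm : measurable_fun setT (fun z => Normc.normc (cone_extension f z) `^ q).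
  apply: (measurableT_comp (measurable_powR q)); apply: measurable_normc.
    exact: measurable_Re_cone_extension.
  exact: measurable_Im_cone_extension.
have fixed_x x : (\int[mu]_t (Normc.normc (cone_extension f (t, x)) `^ q)%:E <=
    (K * N `^ (q - 1) * (1 + dotp x x) `^ (- s))%:E)%E.
  have d0 : 0 < 1 + dotp x x by rewrite ltr_wpDr// dotpp_ge0.
  pose W := Cd * (1 + dotp x x) `^ (- (k.+1%:R / 4)).
  have W0 : 0 < W by rewrite mulr_gt0// powR_gt0.
  (* [A] bounds the integral of the p-th power of the radial densities at x. As p(q - 1) = q, the
     Hausdorff-Young factor A^(q-1) contains W^q, which is the decay integrated later in x. *)
  pose A := W `^ p * N.
  have A0 : 0 < A by rewrite mulr_gt0// powR_gt0.
  have AE : A `^ (q - 1) = Cd `^ q * (1 + dotp x x) `^ (- s) * N `^ (q - 1).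
    rewrite /A powRM ?powR_ge0 ?(ltW N0)// -powRrM /p divfK ?gt_eqF//.
    by rewrite /W powRM ?powR_ge0 ?(ltW Cd0)// -powRrM /s mulNr.
  have ha := radial_density_powR_le x Cd0 p0 decay ma aD aN.
  have hb := radial_density_powR_le x Cd0 p0 decay mb bD bN.
  have mda := measurable_radial_density k (enorm x) ma.
  have mdb := measurable_radial_density k (enorm x) mb.
  have Da r := @radial_density_support R k a (enorm x) r aD.
  have Db r := @radial_density_support R k b (enorm x) r bD.
  pose F1 t := `|real_fourier (@cos_kernel R) (radial_density k a (enorm x)) t| `^ q.
  pose F2 t := `|real_fourier (@sin_kernel R) (radial_density k b (enorm x)) t| `^ q.
  pose F3 t := `|real_fourier (@sin_kernel R) (radial_density k a (enorm x)) t| `^ q.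
  pose F4 t := `|real_fourier (@cos_kernel R) (radial_density k b (enorm x)) t| `^ q.
  have b1 : (\int[mu]_t (F1 t)%:E <= (Cc * A `^ (q - 1))%:E)%E by exact: (HYc _ _ mda Da A0 ha).
  have b2 : (\int[mu]_t (F2 t)%:E <= (Cs * A `^ (q - 1))%:E)%E by exact: (HYs _ _ mdb Db A0 hb).
  have b3 : (\int[mu]_t (F3 t)%:E <= (Cs * A `^ (q - 1))%:E)%E by exact: (HYs _ _ mda Da A0 ha).
  have b4 : (\int[mu]_t (F4 t)%:E <= (Cc * A `^ (q - 1))%:E)%E by exact: (HYc _ _ mdb Db A0 hb).
  have mpow (g : R -> R) : measurable_fun setT g -> measurable_fun setT (fun r : R => `|g r| `^ q).
    move=> mg; apply: (measurableT_comp (measurable_powR q)); exact: measurableT_comp.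
  have mF1 : measurable_fun setT F1.
    by apply: mpow; apply: measurable_real_fourier => //; exact: measurable_cos_kernel.
  have mF2 : measurable_fun setT F2.
    by apply: mpow; apply: measurable_real_fourier => //; exact: measurable_sin_kernel.
  have mF3 : measurable_fun setT F3.
    by apply: mpow; apply: measurable_real_fourier => //; exact: measurable_sin_kernel.
  have mF4 : measurable_fun setT F4.
    by apply: mpow; apply: measurable_real_fourier => //; exact: measurable_cos_kernel.
  have F10 t : 0 <= F1 t by exact: powR_ge0.
  have F20 t : 0 <= F2 t by exact: powR_ge0.
  have F30 t : 0 <= F3 t by exact: powR_ge0.
  have F40 t : 0 <= F4 t by exact: powR_ge0.
  have mG : measurable_fun setT (fun t => Normc.normc (cone_extension f (t, x)) `^ q).
    exact: (measurable_comp measurableT (@subsetT _ _) mnorm (measurable_pair2 x)).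
  apply: le_trans (@integral_le_sum4 _ (2 `^ q * 2 `^ q) F1 F2 F3 F4 _ _ _ _
    _ mG mF1 mF2 mF3 mF4 _ F10 F20 F30 F40 _ b1 b2 b3 b4) _.
  - by move=> t; exact: powR_ge0.
  - by rewrite mulr_ge0 ?powR_ge0.
  - move=> t.
    have n0 := normc_ge0 (cone_extension f (t, x)).
    apply: (@le_trans _ _ ((`|complex.Re (cone_extension f (t, x))| +
        `|complex.Im (cone_extension f (t, x))|) `^ q)).
      apply: ge0_ler_powR; rewrite ?nnegrE ?addr_ge0 ?(ltW q0)//.
      exact: normc_le_Re_Im.
    apply: le_trans (powRD_le (ltW q0) (normr_ge0 _) (normr_ge0 _)) _.
    rewrite -mulrA; apply: ler_wpM2l; first exact: powR_ge0.
    rewrite mulrDr (Re_cone_extension mRe mIm f_shell f_sym ia ib).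
    rewrite (Im_cone_extension mRe mIm f_shell f_sym ia ib).
    apply: lerD.
      apply: le_trans (powRD_le (ltW q0) (normr_ge0 _) (normr_ge0 _)).
      by apply: ge0_ler_powR; rewrite ?nnegrE ?addr_ge0 ?(ltW q0)// ler_normB.
    apply: le_trans (powRD_le (ltW q0) (normr_ge0 _) (normr_ge0 _)).
    by apply: ge0_ler_powR; rewrite ?nnegrE ?addr_ge0 ?(ltW q0)// ler_normD.
  rewrite lee_fin AE /K le_eqVlt; apply/orP; left; apply/eqP; ring.
(* The estimates in t hold for each fixed x, so the integral over space-time is taken in t first. *)
rewrite (fubini_tonelli2 (fun z => (Normc.normc (cone_extension f z) `^ q)%:E))//; last 2 first.
- exact/measurable_EFinP.
- by move=> z; rewrite lee_fin powR_ge0.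
apply: (@le_trans _ _ (\int[L]_x (K * N `^ (q - 1) * (1 + dotp x x) `^ (- s))%:E)%E).
  apply: ge0_le_integral => //.
  - by move=> x _; apply: integral_ge0 => t _; rewrite lee_fin powR_ge0.
  - apply: (@measurable_fun_fubini_tonelli_G _ _ RR _ R mu
      (fun z => (Normc.normc (cone_extension f z) `^ q)%:E)) => //.
      exact/measurable_EFinP.
    by move=> z; rewrite lee_fin powR_ge0.
  - apply/measurable_EFinP; apply: measurable_funM => //.
    exact: measurable_dotp1D_powR.
  - by move=> x _; exact: fixed_x.
rewrite ge0_integral_funZl; last 3 first.
- by rewrite mulr_ge0 ?powR_ge0.
- exact: measurable_dotp1D_powR.
- by move=> x; exact: powR_ge0.
rewrite -/I -(fineK (_ : I \is a fin_num)) ?ge0_fin_numE//.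
rewrite -EFinM lee_fin /N powRM ?invr_ge0 ?(ltW B0) ?(ltW c0)//.
by rewrite le_eqVlt; apply/orP; left; apply/eqP; ring.
Qed.

End restriction.

(** * From power integrals to norms, including the endpoint q = +oo *)

Section norm_bounds.
Context (R : realType) (k : nat).
Local Notation mu := (@lebesgue_measure R).
Local Notation L := (lebesgue_Rn R k.+2).
Local Open Scope ereal_scope.

Let V := fine (shell_measure [set: Rspacetime R k.+2]).

Let shell_le : shell_measure [set: Rspacetime R k.+2] <= V%:E.
Proof. by rewrite /V fineK// ge0_fin_numE// shell_measure_lty. Qed.

Let V0 : (0 <= V)%R. Proof. by apply: fine_ge0; exact: measure_ge0. Qed.

(** Conjugation of exponents reverses order, so p' <= q is q' <= p, the form in which the finite
    measure of the shell is used. *)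
Lemma hoelder_conjugate_le (p : \bar R) (q : R) : 1 <= p -> (1 < q)%R ->
  hoelder_conjugate p <= q%:E -> (q / (q - 1))%:E <= p.
Proof.
move=> p1 q1; case: p p1 => [r| |//] p1; last by rewrite leey.
(* For p = 1 the conjugate exponent is +oo, which cannot be at most the finite q. *)
rewrite lee_fin in p1; have [->|r1] := eqVneq r 1%R.
  by rewrite hoelder_conjugate1 leye_eq.
have r2 : (0 < r - 1)%R by rewrite subr_gt0 lt_neqAle eq_sym r1.
rewrite /hoelder_conjugate/= eqe gt_eqF ?(lt_le_trans ltr01)//.
rewrite -EFinB inver gt_eqF// -EFinM !lee_fin.
rewrite ler_pdivrMr// ler_pdivrMr ?subr_gt0// => le.
nra.
Qed.

Lemma cone_extension_Lnorm_le (p q : \bar R) : 1 <= p ->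
  (2 * k.+2%:R / k.+1%:R)%:E < q -> hoelder_conjugate p <= q ->
  exists2 C : R, (0 <= C)%R & forall (f : Rspacetime R k.+2 -> R[i]) (M : R),
    measurable_fun setT (fun z => complex.Re (f z)) ->
    measurable_fun setT (fun z => complex.Im (f z)) ->
    (forall z, ~ cone_shell z -> f z = 0%R) -> cylindrically_symmetric f ->
    (0 < M)%R -> cLnorm shell_measure p f <= M%:E ->
    cLnorm (mu \x L) q (cone_extension f) <= (C * M)%:E.
Proof.
move=> p1; case: q => [q| |//] qk pq; last first.
  (* At q = +oo the pointwise bound by twice the L^1 norm is enough, that norm being at most M (V +
     1) on the shell. *)
  exists (2 * (V + 1))%R; first by rewrite mulr_ge0// addr_ge0.
  move=> f M mRe mIm f_shell f_sym M0 fM.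
  have B : \int[shell_measure]_z (Normc.normc (f z))%:E <= (M * (V + 1))%:E.
    have := integral_powR_le_Lnorm shell_le ler01 p1 M0 (measurable_normc mRe mIm)
      (fun z => normc_ge0 _) fM.
    rewrite (powRr1 (ltW M0)); apply: le_trans; rewrite le_eqVlt; apply/orP; left.
    by apply/eqP; apply: eq_integral => z _; rewrite powRr1 ?normc_ge0.
  have ub z : (Normc.normc (cone_extension f z) <= 2 * (M * (V + 1)))%R.
      exact: normc_cone_extension_le.
  rewrite /cLnorm unlock; case: ifP => _; last first.
    by rewrite lee_fin mulr_ge0 ?(ltW M0)// mulr_ge0// addr_ge0.
  apply/ess_supP; apply: nearW => z /=; rewrite lee_fin ger0_norm ?normc_ge0//.
  by rewrite (mulrAC 2%R _ M) -mulrA; exact: ub.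
rewrite lte_fin in qk.
have q2 : (1 < q)%R.
  apply: lt_trans qk; rewrite ltr_pdivlMr// mul1r -natrM ltr_nat; lia.
have q0 : (0 < q)%R by exact: lt_trans q2.
have q1 : (0 < q - 1)%R by rewrite subr_gt0.
have [C0 C00 HC] := cone_extension_powR_le qk.
have pp : (q / (q - 1))%:E <= p by exact: hoelder_conjugate_le.
have pp0 : (0 <= q / (q - 1))%R by rewrite divr_ge0 ?ltW.
(* Passing from the L^p norm to the integral of the q'-th power costs V + 1, which the estimate
   raises to the power q - 1. *)
pose K := (C0 * (V + 1) `^ (q - 1))%R.
have V1 : (0 < V + 1)%R by rewrite ltr_wpDl.
have K0 : (0 <= K)%R by rewrite mulr_ge0 ?powR_ge0.
exists (K `^ q^-1)%R; first exact: powR_ge0.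
move=> f M mRe mIm f_shell f_sym M0 fM.
have fB := integral_powR_le_Lnorm shell_le pp0 pp M0 (measurable_normc mRe mIm)
  (fun z => normc_ge0 _) fM.
have B0 : (0 < M `^ (q / (q - 1)) * (V + 1))%R by rewrite mulr_gt0// powR_gt0.
have := HC f _ mRe mIm f_shell f_sym B0 fB.
rewrite powRM ?powR_ge0 ?(ltW V1)// -powRrM divfK ?gt_eqF// => le.
have I0 : 0 <= \int[mu \x L]_z (Normc.normc (cone_extension f z) `^ q)%:E.
  by apply: integral_ge0 => z _; rewrite lee_fin powR_ge0.
rewrite /cLnorm unlock.
under eq_integral => z _ do rewrite /= ger0_norm ?normc_ge0//.
have -> : (K `^ q^-1 * M = (C0 * (M `^ q * (V + 1) `^ (q - 1))) `^ q^-1)%R.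
  rewrite mulrCA [X in (_ = X `^ _)%R](_ : _ = (M `^ q * K)%R); last by rewrite /K; ring.
  by rewrite powRM ?powR_ge0// -powRrM divff ?gt_eqF// powRr1 ?(ltW M0)// mulrC.
rewrite -poweR_EFin; apply: gt0_ler_poweR => //.
- by rewrite invr_ge0 ltW.
- by rewrite in_itv/= I0 leey.
- by rewrite in_itv/= leey lee_fin mulr_ge0// mulr_ge0 ?powR_ge0.
Qed.

End norm_bounds.

Unset Implicit Arguments.
Set Strict Implicit.
Set Printing Implicit Defensive.
Local Open Scope ereal_scope.

Theorem mainTheorem2 (R : realType) (n : nat) (p q : \bar R)
    (n_ge2 : (2 <= n)%N) (p_ge1 : 1 <= p)
    (q_gt : (2 * n%:R / (n%:R - 1))%:E < q)
    (q_ge : hoelder_conjugate p <= q) :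
  exists C : R, forall f : Rspacetime R n -> R[i],
    (forall z, ~ cone_shell z -> f z = 0%R) ->
    cylindrically_symmetric f ->
    cLfun shell_measure p f ->
    cLnorm (lebesgue_measure \x lebesgue_Rn R n) q (cone_extension f) <=
      C%:E * cLnorm shell_measure p f.
Proof.
case: n n_ge2 q_gt => [|[|k]]// _ q_gt.
have qk : (2 * k.+2%:R / k.+1%:R)%:E < q.
  have E : (k.+2%:R - 1 = k.+1%:R :> R)%R by rewrite -natr1 addrK.
  by rewrite -E.
have [C C0 HC] := cone_extension_Lnorm_le p_ge1 qk q_ge.
exists C => f f_shell f_sym [mRe mIm foo].
set m := cLnorm shell_measure p f in foo *.
have m0 : 0 <= m by exact: Lnorm_ge0.
rewrite -(fineK (_ : m \is a fin_num)) ?ge0_fin_numE// -EFinM.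
(* The norm of f may be 0, while the bound is available for positive M; M is taken as the norm plus
   e/(C + 1), which increases the right-hand side by at most e. *)
apply/lee_addgt0Pr => e e0.
have C1 : (0 < C + 1)%R by rewrite ltr_wpDl.
have e1 : (0 < e / (C + 1))%R by rewrite divr_gt0.
apply: le_trans (HC f (fine m + e / (C + 1))%R mRe mIm f_shell f_sym _ _) _.
- by rewrite ltr_wpDl// fine_ge0.
- by rewrite EFinD fineK ?ge0_fin_numE// leeDl// lee_fin ltW.
rewrite -EFinD lee_fin mulrDr lerD2l mulrCA ger_pMr// ler_pdivrMr// mul1r.
by rewrite lerDl.
Qed.
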